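(* For each $H\in(0,1]$ one has $$\gamma_H(k)\ \sim\ \frac{2(1-\rho_H(1))}{\pi^2(1+\rho_H(1))}\,H^2(2H-1)^2\,k^{4H-4}\qquad\text{as }k\to\infty .$$
   Context: For $H\in(0,1]$, $(B(t))_{t\ge0}$ is, with respect to the probability measure $\mathbb{P}_H$, standard fractional Brownian motion with Hurst parameter $H$: a mean-zero Gaussian process with $\mathrm{Cov}_H(B(t),B(s))=\frac12(t^{2H}+s^{2H}-|t-s|^{2H})$ for $s,t\ge 0$, where $\mathrm{Cov}_H$ is covariance with respect to $\mathbb{P}_H$. Put $X_k:=B(k)$ for $k\in\mathbb{N}_0$ and $Y_k:=X_k-X_{k-1}$ for $k\in\mathbb{N}$, and let $\rho_H(k):=\mathrm{Cov}_H(Y_1,Y_{1+k})=\frac12(|k+1|^{2H}-2|k|^{2H}+|k-1|^{2H})$ for $k\in\mathbb{N}_0$. The indicator of a change between up and down at time $k\in\mathbb{N}_0$ is $C_k:=\mathbf{1}_{\{X_k\ge X_{k+1}<X_{k+2}\}}+\mathbf{1}_{\{X_k<X_{k+1}\ge X_{k+2}\}}$, and $\gamma_H(k):=\mathrm{Cov}_H(C_0,C_k)$ for $k\in\mathbb{N}_0$. For real sequences, $f(k)\sim g(k)$ means $\lim_{k\to\infty}f(k)/g(k)=1$, with the convention $\frac00:=1$. *)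

(* Defs.v *)
From HB Require Import structures.
From mathcomp Require Import all_boot all_order all_algebra.
From mathcomp Require Import all_classical all_reals all_analysis.

Set Implicit Arguments.
Unset Strict Implicit.
Unset Printing Implicit Defensive.

Import Order.TTheory GRing.Theory Num.Theory.
Import numFieldNormedType.Exports.

Local Open Scope classical_set_scope.
Local Open Scope ring_scope.

(* Normal law with mean m and standard deviation |s|, degenerate case included.
   The case s = 0 is separate because the library's [normal_prob m 0] is the
   uniform law on [0, 1], not the Dirac mass at m. *)
Definition gaussian_law (R : realType) (m s : R) (A : set R) : \bar R :=
  if s == 0 then \d_m A else normal_prob m s A.

(* Every finite linear combination of the coordinates is normally distributed,
   possibly degenerately. *)
Definition gaussian_process (R : realType) (d : measure_display)
    (T : measurableType d) (P : probability T R) (I : Type)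
    (Z : I -> {RV P >-> R}) : Prop :=
  forall (n : nat) (t : 'I_n -> I) (a : 'I_n -> R), exists m s : R,
    forall A : set R, measurable A ->
      P ((fun w => \sum_(i < n) a i * Z (t i) w) @^-1` A) = gaussian_law m s A.

Definition is_fBm (R : realType) (d : measure_display) (T : measurableType d)
    (P : probability T R) (H : R) (B : {nonneg R} -> {RV P >-> R}) : Prop :=
  [/\ gaussian_process B,
      forall t : {nonneg R}, ('E_P[B t] = 0)%E &
      forall s t : {nonneg R}, covariance P (B t) (B s) =
        (2^-1 * (t%:num `^ (2 * H) + s%:num `^ (2 * H)
                 - `|t%:num - s%:num| `^ (2 * H)))%:E].

Section UpDown.
Context (R : realType) (d : measure_display) (T : measurableType d).
Context (P : probability T R) (B : {nonneg R} -> {RV P >-> R}).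

Definition X (k : nat) : T -> R := B (k%:R)%:nng.

(* Meaningful for k >= 1 only; Y 0 = 0 by truncated predecessor. *)
Definition Y (k : nat) : T -> R := X k \- X k.-1.

Definition rho (k : nat) : R := fine (covariance P (Y 1) (Y k.+1)).

Definition C (k : nat) : T -> R :=
  \1_[set w | X k w >= X k.+1 w /\ X k.+1 w < X k.+2 w] \+
  \1_[set w | X k w < X k.+1 w /\ X k.+1 w >= X k.+2 w].

(* [fine] loses nothing: C 0 and C k are bounded. *)
Definition gamma (k : nat) : R := fine (covariance P (C 0) (C k)).

End UpDown.

(* Quotient with the convention 0 / 0 = 1. For y = 0 and x != 0 the library's
   total division yields 0, so [asymp_equiv f g] below still forces f k = 0
   whenever g k = 0, for all large k. *)
Definition quot01 (R : realType) (x y : R) : R :=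
  if (x == 0) && (y == 0) then 1 else x / y.

Definition asymp_equiv (R : realType) (f g : nat -> R) : Prop :=
  quot01 (f k) (g k) @[k --> \oo] --> (1 : R).

(* Main.v *)
Require Import Defs.
From HB Require Import structures.
From mathcomp Require Import all_boot all_order all_algebra.
From mathcomp Require Import all_classical all_reals all_analysis.
From mathcomp Require Import measurable_realfun.
From mathcomp Require Import ring lra.

(** Why the theorem holds. Off a null set, a change between up and down at [k]
    means that the increments [Y k.+1] and [Y k.+2] have opposite signs. Put
    [r = rho B 1], [p^2 = 2 (1 + r)], [q^2 = 2 (1 - r)]. The sum [U_k] of these
    two increments divided by [p], and their difference [V_k] divided by [q],
    are independent standard normal variables, and opposite signs means
    [(p U_k)^2 < (q V_k)^2]. So [gamma B k] is the covariance of the indicator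
    of one fixed double cone evaluated at [(U_0, V_0)] and at [(U_k, V_k)].

    The two pairs decorrelate. With [kappa = k^(2 H - 2)] and [L = H (2 H - 1)],
    the second difference that defines [rho] gives [rho (k + j) / kappa --> L]
    for [j = -1, 0, 1] ([cvg_fgn_cov]). Hence the covariance of [U_0] and [U_k]
    is [A kappa] to leading order, [A = 4 L / p^2], whereas the three other
    cross-covariances are combinations whose coefficients sum to zero, and are
    [o(kappa)].

    The joint density of the four variables with respect to independent standard
    normal ones is explicit ([pair_density]); it is [exp (D + B)], with [D] and
    [B] polynomials of degree 2, [B] of order [kappa] and odd in the first pair,
    [D] of order [kappa^2] and even. The cone is symmetric, so the density may be
    averaged over the sign of [B] ([pair_covariance]); the first-order term
    disappears and [exp D * cosh B - 1 ~ D + B^2 / 2] remains. Passing to the limit under the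
    integral ([cvg_pair_expansion]) leaves [A^2 / 2 * (u^2 - 1) (u'^2 - 1)] and
    therefore [gamma B k ~ kappa^2 A^2 / 2 * c^2], where [c] is the integral of
    [u^2 - 1] over the cone. That integral is elementary ([hermite2_cone]):
    [c = - 2 p q / (pi (p^2 + q^2))], and substituting gives the constant. For
    [H = 1 / 2] distant increments are uncorrelated and for [H = 1] all
    increments agree almost surely; then both sides vanish for large [k].

    A Gaussian process is given by the laws of the linear combinations of its
    coordinates, that is, by the characteristic function of each finite vector
    ([updown_gaussian_pairs]). The joint law is recovered from it without an
    inversion theorem: the normal density is its own Fourier transform, so the
    characteristic function determines every Gaussian smoothing of the law, and
    shrinking the smoothing yields the measure of rays ([ray_independent]). The
    coordinates are treated one at a time, the remaining ones being kept in a
    nonnegative weight ([conditioning_cos], [standard_gaussian_law]). *)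

Set Implicit Arguments.
Unset Strict Implicit.
Unset Printing Implicit Defensive.

Import Order.TTheory GRing.Theory Num.Theory.
Import numFieldNormedType.Exports.

Local Open Scope classical_set_scope.
Local Open Scope ring_scope.

(** * Measures with a density, and affine changes of variable *)

Section density.
Import HBNNSimple.
Context d (T : measurableType d) (R : realType).
Variables (mu nu : {measure set T -> \bar R}) (p : T -> R).
Hypotheses (mp : measurable_fun setT p) (p0 : forall x, 0 <= p x).
Hypothesis nuE : forall A, measurable A -> nu A = (\int[mu]_(x in A) (p x)%:E)%E.
Local Open Scope ereal_scope.

Let density_nnsfun (f : {nnsfun T >-> R}) :
  \int[nu]_x (f x)%:E = \int[mu]_x ((f x)%:E * (p x)%:E).
Proof.
under [LHS]eq_integral do rewrite fimfunE -fsumEFin//.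
rewrite [LHS]ge0_integral_fsum//; last 2 first.
  - by move=> r; exact/measurable_EFinP/measurableT_comp.
  - by move=> n x _; rewrite EFinM nnfun_muleindic_ge0.
under [RHS]eq_integral.
  move=> x _; rewrite fimfunE -fsumEFin// ge0_mule_fsuml; last first.
    by move=> r; rewrite EFinM nnfun_muleindic_ge0.
  over.
rewrite [RHS]ge0_integral_fsum//; last 2 first.
  - move=> r; apply: emeasurable_funM; last exact/measurable_EFinP.
    exact/measurable_EFinP/measurableT_comp.
  - move=> n x _; apply: mule_ge0; last by rewrite lee_fin.
    by rewrite EFinM nnfun_muleindic_ge0.
apply: eq_fsbigr => r _.
rewrite integralZl_indic_nnsfun//= integral_indic// setIT nuE//.
have [r0|r0] := ltP r 0%R.
  rewrite preimage_nnfun0// integral_set0 mule0.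
  by under eq_integral do rewrite indicE in_set0 mulr0 mul0e; rewrite integral0.
rewrite integral_mkcond -ge0_integralZl//; last 2 first.
- apply/(measurable_restrictT _ _).1 => //.
  exact/measurable_EFinP/measurable_funTS.
- by move=> x _; rewrite patchE; case: ifP => // _; rewrite lee_fin.
apply: eq_integral => x _; rewrite patchE indicE EFinM -muleA; congr (_ * _).
by case: ifP => _; rewrite ?mul1e ?mul0e.
Qed.

(** The hypothesis is only about sets, hence the passage through simple functions
    and monotone convergence. *)
Lemma ge0_integral_density (f : T -> \bar R) :
  measurable_fun setT f -> (forall x, 0 <= f x) ->
  \int[nu]_x f x = \int[mu]_x (f x * (p x)%:E).
Proof.
move=> mf f0.
pose f_ := nnsfun_approx measurableT mf.
transitivity (limn (fun n => \int[nu]_x (f_ n x)%:E)).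
  rewrite -monotone_convergence//=.
  - apply: eq_integral => x _; apply/esym/cvg_lim => //.
    exact: cvg_nnsfun_approx.
  - by move=> n; exact/measurable_EFinP/measurable_funTS.
  - by move=> n x _; rewrite lee_fin.
  - by move=> x _ a b ab; rewrite lee_fin; exact/lefP/nd_nnsfun_approx.
transitivity (limn (fun n => \int[mu]_x ((f_ n x)%:E * (p x)%:E))).
  by apply: congr_lim; apply/funext => n; exact: density_nnsfun.
rewrite -monotone_convergence//=.
- apply: eq_integral => x _; apply/cvg_lim => //.
  by apply: cvgeZr => //; exact: cvg_nnsfun_approx.
- move=> n; apply: emeasurable_funM; last exact/measurable_EFinP.
  exact/measurable_EFinP.
- by move=> n x _; rewrite mule_ge0// lee_fin.
- move=> x _ a b ab; rewrite lee_pmul ?lee_fin//.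
  exact/lefP/nd_nnsfun_approx.
Qed.

Lemma integrable_density (f : T -> \bar R) : measurable_fun setT f ->
  nu.-integrable setT f <-> mu.-integrable setT (fun x => f x * (p x)%:E).
Proof.
move=> mf.
have mfp : measurable_fun setT (fun x => f x * (p x)%:E).
  by apply: emeasurable_funM => //; exact/measurable_EFinP.
have E : \int[nu]_x `|f x| = \int[mu]_x `|f x * (p x)%:E|.
  rewrite ge0_integral_density//; last exact: measurableT_comp.
  by apply: eq_integral => x _; rewrite abseM (@gee0_abs _ (p x)%:E)// lee_fin.
by split=> /integrableP[_ ioo]; apply/integrableP; split => //; rewrite ?E// -E.
Qed.

Lemma integral_density (f : T -> \bar R) : measurable_fun setT f ->
  \int[nu]_x f x = \int[mu]_x (f x * (p x)%:E).
Proof.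
move=> mf; rewrite integralE [RHS]integralE.
rewrite !ge0_integral_density; [|exact: measurable_funeneg|by []|
  exact: measurable_funepos|by []].
congr (_ - _); apply: eq_integral => x _.
  by rewrite !funepos.unlock maxe_pMl ?mul0e ?lee_fin.
by rewrite !funeneg.unlock -mulNe maxe_pMl ?mul0e ?lee_fin.
Qed.

End density.

(** The pushforward as a bundled measure, the form that uniqueness theorems for
    measures take as argument. *)
Definition image_measure d1 d2 (T1 : measurableType d1) (T2 : measurableType d2)
    (R : realType) (m : {measure set T1 -> \bar R}) (f : T1 -> T2)
    (mf : measurable_fun setT f) : {measure set T2 -> \bar R} :=
  measure_function_pushforward__canonical__measure_function_Measure m mf.

Section affine.
Context (R : realType).
Local Notation mu := (@lebesgue_measure R).
Local Open Scope ereal_scope.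

(** Both sides are integrals of [h] against measures that agree on intervals, and
    Lebesgue measure is determined by its values there. *)
Lemma ge0_integral_affine (m s : R) (h : R -> \bar R) : (0 < s)%R ->
  measurable_fun setT h -> (forall x, 0 <= h x) ->
  \int[mu]_x h x = s%:E * \int[mu]_x h (m + s * x)%R.
Proof.
move=> s0 mh h0.
pose g : measurableTypeR R -> measurableTypeR R := fun x => (m + s * x)%R.
have mg : measurable_fun setT g.
  by apply: measurable_funD => //; exact: measurable_funM.
pose nu := image_measure mu mg.
pose k : {nonneg R} := NngNum (ltW s0).
have E A : measurable A -> mu A = mscale k nu A.
  apply: lebesgue_measure_unique => _ [[a b]] _ <-.
  have Eg : g @^-1` `]a, b]%classic = `]((a - m) / s)%R, ((b - m) / s)%R]%classic.
    apply/seteqP; split => x; rewrite /= !in_itv/= /g => /andP[].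
      by move=> ax xb; rewrite ltr_pdivrMr// ler_pdivlMr// ltrBlDl lerBrDl
        (mulrC x) ax.
    by rewrite ltr_pdivrMr// ler_pdivlMr// ltrBlDl lerBrDl (mulrC x) => -> ->.
  transitivity (s%:E * mu `]((a - m) / s)%R, ((b - m) / s)%R]); last by rewrite -Eg.
  rewrite !lebesgue_measure_itv/= !lte_fin ltr_pM2r ?invr_gt0// ltrD2r.
  case: ifPn => ab; last by rewrite mule0.
  rewrite -!EFinD -EFinM; congr EFin.
  by field; rewrite gt_eqF.
rewrite (eq_measure_integral (mscale k nu)); last by move=> A mA _; exact: E.
rewrite ge0_integral_mscale//= ge0_integral_pushforward//.
Qed.
End affine.

(** * Integrals against the normal law, and Stein's identity *)

Section real_dominated_convergence.
Context d (T : measurableType d) (R : realType).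
Variables (mu : {measure set T -> \bar R}) (f_ : nat -> T -> R) (f g : T -> R).
Hypotheses (mf_ : forall n, measurable_fun setT (f_ n))
  (f_f : forall x, f_ n x @[n --> \oo] --> f x)
  (ig : mu.-integrable setT (EFin \o g))
  (f_g : forall n x, `|f_ n x| <= g x).

Lemma Rdominated_cvg : \int[mu]_x f_ n x @[n --> \oo] --> \int[mu]_x f x.
Proof.
have cf x : [set: T] x -> (f_ n x)%:E @[n --> \oo] --> (f x)%:E.
  by move=> _; apply: cvg_EFin; [exact: nearW|exact: f_f].
have mf : measurable_fun setT (EFin \o f).
  by apply: (emeasurable_fun_cvg (fun n => EFin \o f_ n)) => // n;
    exact/measurable_EFinP.
have [intf _ cv] := @dominated_convergence _ _ _ mu setT measurableT
  (fun n => EFin \o f_ n) (EFin \o f) (EFin \o g)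
  (fun n => (measurable_EFinP _ _).2 (mf_ n)) mf
  (aeW _ cf) ig (aeW _ (fun x n _ => f_g n x)).
apply: fine_cvg; rewrite fineK//.
exact: integrable_fin_num intf.
Qed.

End real_dominated_convergence.

Section normal_integrals.
Context (R : realType).
Local Notation mu := (@lebesgue_measure R).
Implicit Types (m s c x : R) (h : R -> \bar R).

Lemma ge0_integral_normal m s h : measurable_fun setT h ->
  (forall x, 0 <= h x)%E ->
  (\int[normal_prob m s]_x h x = \int[mu]_x (h x * (normal_pdf m s x)%:E))%E.
Proof.
by move=> mh h0; rewrite (@ge0_integral_density _ _ _ mu _ (normal_pdf m s))//;
  [exact: measurable_normal_pdf|move=> x; exact: normal_pdf_ge0].
Qed.

Lemma ge0_integral_normal_affine m s h : 0 < s -> measurable_fun setT h ->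
  (forall x, 0 <= h x)%E ->
  (\int[normal_prob 0 1]_x h (m + s * x)%R = \int[normal_prob m s]_x h x)%E.
Proof.
move=> s0 mh h0.
have mg : measurable_fun setT (fun x => m + s * x).
  by apply: measurable_funD => //; exact: measurable_funM.
have mhg : measurable_fun setT (fun x => h (m + s * x)%R).
  exact: (measurableT_comp mh mg).
rewrite (ge0_integral_normal _ _ mhg (fun x => h0 (m + s * x))).
rewrite (ge0_integral_normal _ _ mh h0).
rewrite (@ge0_integral_affine _ m s (fun x => h x * (normal_pdf m s x)%:E)%E)//; first last.
- by move=> x; rewrite mule_ge0// lee_fin normal_pdf_ge0.
- by apply: emeasurable_funM => //; apply/measurable_EFinP; exact: measurable_normal_pdf.
rewrite -ge0_integralZl//=; first last.
- by rewrite lee_fin ltW.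
- by move=> x _; rewrite mule_ge0// lee_fin normal_pdf_ge0.
- apply: emeasurable_funM; first exact: mhg.
  by apply/measurable_EFinP; apply: measurableT_comp mg; exact: measurable_normal_pdf.
apply: eq_integral => x _; rewrite muleCA; congr (_ * _)%E; rewrite -EFinM.
congr EFin; rewrite !normal_pdfE ?oner_neq0 ?gt_eqF//.
rewrite /normal_peak /normal_fun mulrA; congr (_ * expR _).
  rewrite expr1n mul1r -mulrnAr sqrtrM ?sqr_ge0// sqrtr_sqr gtr0_norm// invfM.
  by rewrite mulVKf ?gt_eqF.
by field; rewrite gt_eqF.
Qed.

Lemma integrable_normal m s h : measurable_fun setT h ->
  (normal_prob m s).-integrable setT h <->
  mu.-integrable setT (fun x => h x * (normal_pdf m s x)%:E)%E.
Proof.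
move=> mh; apply: integrable_density => //; first exact: measurable_normal_pdf.
by move=> x; exact: normal_pdf_ge0.
Qed.

Lemma normal_probN m s A : normal_prob m (- s) A = normal_prob m s A.
Proof.
rewrite /normal_prob; apply: eq_integral => x _.
by rewrite /normal_pdf oppr_eq0 /normal_peak /normal_fun sqrrN.
Qed.

(** The Radon-Nikodym ratio of the normal law of mean [m] and deviation [s] to
    the standard one. *)
Definition normal_ratio m s x : R :=
  s^-1 * expR (x ^+ 2 / 2 - (x - m) ^+ 2 / (2 * s ^+ 2)).

Lemma normal_ratio_ge0 m s x : 0 < s -> 0 <= normal_ratio m s x.
Proof. by move=> s0; rewrite mulr_ge0 ?expR_ge0// invr_ge0 ltW. Qed.

Lemma normal_pdf_ratio m s x : 0 < s ->
  normal_pdf m s x = normal_ratio m s x * normal_pdf 0 1 x.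
Proof.
move=> s0; rewrite !normal_pdfE ?oner_neq0 ?gt_eqF// /normal_ratio.
rewrite /normal_peak /normal_fun mulrACA -expRD; congr (_ * expR _).
  by rewrite expr1n mul1r -mulrnAr sqrtrM ?sqr_ge0// sqrtr_sqr gtr0_norm// invfM.
by field; rewrite gt_eqF.
Qed.

Lemma measurable_normal_ratio m s : measurable_fun setT (normal_ratio m s).
Proof.
apply: measurable_funM => //; apply: measurableT_comp => //.
apply: measurable_funB; apply: measurable_funM => //.
by apply: measurable_funX; exact: measurable_funB.
Qed.

Lemma ge0_integral_normal_ratio m s h : 0 < s -> measurable_fun setT h ->
  (forall x, 0 <= h x)%E ->
  (\int[normal_prob 0 1]_x h (m + s * x)%R =
   \int[normal_prob 0 1]_x (h x * (normal_ratio m s x)%:E))%E.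
Proof.
move=> s0 mh h0; rewrite (ge0_integral_normal_affine m s0 mh h0).
have mhr : measurable_fun setT (fun x => h x * (normal_ratio m s x)%:E)%E.
  apply: emeasurable_funM; first exact: mh.
  by apply/measurable_EFinP; exact: measurable_normal_ratio.
rewrite (ge0_integral_normal _ _ mh h0) (ge0_integral_normal _ _ mhr).
  by apply: eq_integral => x _; rewrite normal_pdf_ratio// EFinM muleA.
by move=> x; rewrite mule_ge0// lee_fin normal_ratio_ge0.
Qed.

(** [exp (x^2 / 4)] times the standard density is a multiple of the normal
    density of variance 2. The exponent 1/4 leaves room for every polynomial and
    for the exponentials of small quadratic forms met below. *)
Lemma integrable_normal_expR_sqr :
  (normal_prob 0 1).-integrable setT (fun x : R => (expR (x ^+ 2 / 4))%:E).
Proof.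
have m4 : measurable_fun setT (fun x : R => expR (x ^+ 2 / 4)).
  by apply: measurableT_comp => //; apply: measurable_funM => //; exact: measurable_funX.
apply/integrableP; split; first exact/measurable_EFinP.
under eq_integral do rewrite gee0_abs ?lee_fin ?expR_ge0//.
rewrite ge0_integral_normal; [|exact/measurable_EFinP|
  by move=> x; rewrite lee_fin expR_ge0].
have s2 : 0 < Num.sqrt 2 :> R by rewrite sqrtr_gt0.
under eq_integral => x _.
  rewrite -EFinM (_ : _ * _ = Num.sqrt 2 * normal_pdf 0 (Num.sqrt 2) x).
    rewrite EFinM; over.
  rewrite (normal_pdf_ratio _ _ s2) /normal_ratio sqr_sqrtr// mulrA mulrA divff ?gt_eqF//.
  by rewrite mul1r; congr (expR _ * _); field.
rewrite integralZl//; last exact: integrable_normal_pdf.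
by rewrite integral_normal_pdf mule1 ltry.
Qed.

Lemma integrable_normal_bound c (f : R -> R) : measurable_fun setT f ->
  (forall x, `|f x| <= c * expR (x ^+ 2 / 4)) ->
  (normal_prob 0 1).-integrable setT (EFin \o f).
Proof.
move=> mf fc.
pose g (x : R) := (c%:E * (expR (x ^+ 2 / 4))%:E)%E.
apply: (@le_integrable _ _ R (normal_prob 0 1) setT measurableT _ g).
- exact/measurable_EFinP.
- by move=> x _ /=; rewrite lee_fin (le_trans (fc x))// ler_norm.
- by apply: integrableZl => //; exact: integrable_normal_expR_sqr.
Qed.

Lemma Rintegral_normal (f : R -> R) : measurable_fun setT f ->
  \int[normal_prob 0 1]_x f x = \int[mu]_x (f x * normal_pdf 0 1 x).
Proof.
move=> mf; congr fine.
rewrite (@integral_density _ _ _ mu _ (normal_pdf 0 1))//;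
  [exact: measurable_normal_pdf|move=> x; exact: normal_pdf_ge0|
   exact/measurable_EFinP].
Qed.

Lemma is_derive_normal_pdf01 x :
  is_derive x 1 (normal_pdf 0 1 : R -> R) (- (x * normal_pdf 0 1 x)).
Proof.
rewrite normal_pdfE ?oner_neq0// /normal_fun.
rewrite (_ : (fun y => _) = (normal_peak 1 : R) \*: (expR \o (fun y => - (y - 0) ^+ 2 / (1 ^+ 2 *+ 2)))); last by apply/funext.
by apply: is_derive_eq; rewrite /GRing.scale/=; field.
Qed.

Lemma norm_le_expR_sqr x : `|x| <= expR (x ^+ 2 / 4).
Proof.
apply: le_trans (expR_ge1Dx _).
have /ler_normlP[] := lexx `|x|; have := sqr_ge0 (x / 2 - 1).
by have := sqr_ge0 (x / 2 + 1); case: (ger0P x) => _; rewrite !expr2; nra.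
Qed.

Lemma sqr_le_expR_sqr x : x ^+ 2 <= 4 * expR (x ^+ 2 / 4).
Proof. by have := expR_ge1Dx (x ^+ 2 / 4); lra. Qed.

Section stein.
Variables (f f' : R -> R) (C : R).
Hypotheses (df : forall x, is_derive x 1 f (f' x)) (cf' : continuous f').
Hypotheses (fC : forall x, `|f x| <= C * expR (x ^+ 2 / 4))
  (f'C : forall x, `|f' x| <= C * expR (x ^+ 2 / 4))
  (xfC : forall x, `|x * f x| <= C * expR (x ^+ 2 / 4)).

Let cf : continuous f.
Proof.
by move=> x; apply: differentiable_continuous; apply/derivable1_diffP; have [] := df x.
Qed.

(** [(f' - x f) phi] is the derivative of [f phi], which vanishes at infinity
    because [f] grows more slowly than the inverse of the density [phi]. *)
Lemma normal_stein :
  \int[normal_prob 0 1]_x (x * f x) = \int[normal_prob 0 1]_x f' x.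
Proof.
have mf : measurable_fun setT f by exact: continuous_measurable_fun.
have mf' : measurable_fun setT f' by exact: continuous_measurable_fun.
have ixf : (normal_prob 0 1).-integrable setT (EFin \o (fun x => x * f x)).
  apply: integrable_normal_bound xfC.
  by apply: measurable_funM.
have if' : (normal_prob 0 1).-integrable setT (EFin \o f').
  exact: integrable_normal_bound f'C.
apply/eqP; rewrite eq_sym -subr_eq0 -RintegralB//; apply/eqP.
pose g x := f' x - x * f x.
pose phi : R -> R := normal_pdf 0 1.
have mg : measurable_fun setT g.
  by apply: measurable_funB => //; exact: measurable_funM.
have cphi : continuous phi by apply: continuous_normal_pdf; exact: oner_neq0.
rewrite (Rintegral_normal mg).
have dG (x : R) : is_derive x 1 (f * phi) (g x * phi x).
  have := @is_deriveM _ _ _ _ _ _ _ _ (df x) (is_derive_normal_pdf01 x).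
  by move/is_derive_eq; apply; rewrite /GRing.scale/= /g -/phi; ring.
have cgphi : continuous (fun x => g x * phi x).
  move=> x; apply: cvgM; last exact: cphi.
  apply: cvgB; first exact: cf'.
  by apply: cvgM; [exact: cvg_id|exact: cf].
have igphi : mu.-integrable setT (EFin \o (fun x => g x * phi x)).
  have mEg : measurable_fun setT (EFin \o g) by exact/measurable_EFinP.
  apply/(integrable_normal _ _ mEg).
  by have := integrableB measurableT if' ixf; apply: eq_integrable.
have mI n : measurable_fun setT (\1_(`[- n%:R, n%:R]) : R -> R).
  exact: measurable_indic.
(* The integrals over [-n, n] converge to the integral over the line; they also
   equal boundary terms, which tend to zero. *)
have lim1 : (\int[mu]_x (g x * phi x * \1_(`[- n%:R, n%:R]) x)) @[n --> \oo]
    --> \int[mu]_x (g x * phi x).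
  apply: (@Rdominated_cvg _ _ _ mu _ _ (fun x => `|g x * phi x|)).
  - by move=> n; apply: measurable_funM; [exact: continuous_measurable_fun|exact: mI].
  - move=> x; apply: cvg_near_cst; near=> n.
    rewrite indicE mem_set ?mulr1//= in_itv/= -ler_norml.
    by near: n; exact: nbhs_infty_ger.
  - by have := integrable_abse igphi; apply: eq_integrable.
  - move=> n x; rewrite normrM ler_piMr// indicE.
    by case: (_ \in _); rewrite ?normr1 ?normr0.
have lim2 : (\int[mu]_x (g x * phi x * \1_(`[- n%:R, n%:R]) x)) @[n --> \oo]
    --> (0 : R).
  have bnd y : `|f y * phi y| <= C * normal_peak 1 * expR (- (y ^+ 2 / 4)).
    rewrite normrM (ger0_norm (normal_pdf_ge0 _ _ _)) /phi.
    apply: le_trans (ler_wpM2r (normal_pdf_ge0 _ _ _) (fC y)) _.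
    rewrite normal_pdfE ?oner_neq0// /normal_fun mulrACA -expRD.
    by rewrite le_eqVlt; apply/orP; left; apply/eqP; congr (_ * expR _); field.
  have C0 : 0 <= C.
    have := le_trans (normr_ge0 _) (fC 0).
    by rewrite expr0n mul0r expR0 mulr1.
  have Cp0 : 0 <= C * normal_peak 1 by rewrite mulr_ge0 ?normal_peak_ge0.
  (* A rough rate is enough: harmonic decay of the boundary terms. *)
  have small n : expR (- (n%:R ^+ 2 / 4)) <= 4 * harmonic n :> R.
    rewrite expRN /harmonic -[leRHS]invrK invfM invrK lef_pV2 ?posrE ?expR_gt0//.
    apply: le_trans (expR_ge1Dx _); rewrite -[n.+1%:R]natr1.
    by have := sqr_ge0 (n%:R - 1 / 2 : R); rewrite !expr2; nra.
  have intE n : (0 < n)%N -> \int[mu]_x (g x * phi x * \1_(`[- n%:R, n%:R]) x) =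
      f n%:R * phi n%:R - f (- n%:R) * phi (- n%:R).
    move=> n0; have nn : - n%:R < n%:R :> R by apply: gtrN; rewrite ltr0n.
    transitivity (\int[mu]_(x in `[- n%:R, n%:R]) (g x * phi x)).
      rewrite [RHS]Rintegral_mkcond; apply: eq_Rintegral => x _.
      by rewrite patchE indicE; case: ifP => _; rewrite ?mulr1 ?mulr0.
    rewrite /Rintegral (@continuous_FTC2 _ _ (f * phi) _ _ nn)//.
    - exact: continuous_subspaceT.
    - have cG : continuous (f * phi).
        by move=> x; apply: cvgM; [exact: cf|exact: cphi].
      split.
      + by move=> x _; have [] := dG x.
      + exact/cvg_at_right_filter/cG.
      + exact/cvg_at_left_filter/cG.
    - by move=> x _; rewrite derive1E; have [_ ->] := dG x.
  apply: (@squeeze_cvgr _ _ _ _ (fun n => - (C * normal_peak 1 * (4 * harmonic n) * 2))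
     (fun n => C * normal_peak 1 * (4 * harmonic n) * 2)).
  - near=> n; rewrite -ler_norml intE; last by near: n; exact: nbhs_infty_gt.
    apply: le_trans (ler_normB _ _) _; rewrite mulr_natr mulr2n lerD//.
      by apply: le_trans (bnd _) _; rewrite ler_wpM2l.
    by apply: le_trans (bnd _) _; rewrite sqrrN ler_wpM2l.
  - rewrite -oppr0; apply: cvgN; rewrite -(mul0r 2); apply: cvgMl.
    rewrite -(mulr0 (C * normal_peak 1)); apply: cvgMr; rewrite -(mulr0 4).
    by apply: cvgMr; exact: cvg_harmonic.
  - rewrite -(mul0r 2); apply: cvgMl.
    rewrite -(mulr0 (C * normal_peak 1)); apply: cvgMr; rewrite -(mulr0 4).
    by apply: cvgMr; exact: cvg_harmonic.
exact: (cvg_unique _ lim1 lim2).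
Unshelve. all: by end_near. Qed.

End stein.

End normal_integrals.

(** * Moments and characteristic function of the standard normal law *)

Section normal_moments.
Context (R : realType).
Local Notation mu := (@lebesgue_measure R).
Implicit Types (m s c x : R).

Lemma normal_mean : \int[normal_prob 0 1]_x x = 0 :> R.
Proof.
transitivity (\int[normal_prob 0 1]_x (x * 1 : R)).
  by apply: eq_Rintegral => x _; rewrite mulr1.
have e1 x : 1 <= expR (x ^+ 2 / 4).
  by rewrite -expR0 ler_expR mulr_ge0 ?sqr_ge0.
rewrite (@normal_stein R (fun=> 1) (fun=> 0) 1)//.
- by rewrite Rintegral_cst//= mul0r.
- by move=> x; exact: cvg_cst.
- by move=> x; rewrite /= normr1 mul1r.
- by move=> x; rewrite /= normr0 mul1r (le_trans _ (e1 x)).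
- by move=> x; rewrite /= mulr1 mul1r norm_le_expR_sqr.
Qed.

Lemma normal_second_moment : \int[normal_prob 0 1]_x (x ^+ 2) = 1 :> R.
Proof.
transitivity (\int[normal_prob 0 1]_x (x * x : R)).
  by apply: eq_Rintegral => x _; rewrite expr2.
have e1 x : 1 <= expR (x ^+ 2 / 4).
  by rewrite -expR0 ler_expR mulr_ge0 ?sqr_ge0.
rewrite (@normal_stein R id (fun=> 1) 4)//.
- by rewrite Rintegral_cst//= probability_setT mul1r.
- by move=> x; exact: cvg_cst.
- by move=> x; have := norm_le_expR_sqr x; have := e1 x; lra.
- by move=> x; rewrite /= normr1; have := e1 x; lra.
- by move=> x; rewrite /= -expr2 ger0_norm ?sqr_ge0// sqr_le_expR_sqr.
Qed.

(** The quotient of [F] by the Gaussian has derivative zero. *)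
Lemma gaussian_ode (F : R -> R) : (forall t : R, is_derive t (1 : R) F (- (t * F t))) ->
  forall t, F t = F 0 * expR (- (t ^+ 2 / 2)).
Proof.
move=> dF t.
pose K t := F t * expR (t ^+ 2 / 2).
have dK x : is_derive x 1 K 0.
  have de : is_derive x 1 (expR \o (fun t => t ^+ 2 / 2)) (x * expR (x ^+ 2 / 2)).
    by apply: is_derive_eq; rewrite /GRing.scale/=; field.
  have := @is_deriveM _ _ _ _ _ _ _ _ (dF x) de.
  by move/is_derive_eq; apply; rewrite /GRing.scale/=; ring.
have := is_derive_0_is_cst t 0 dK.
rewrite /K expr0n/= mul0r expR0 mulr1 => <-.
by rewrite -mulrA -expRD subrr expR0 mulr1.
Qed.

Section char_derive.
Variables (f f' : R -> R).
Hypotheses (df : forall x, is_derive x 1 f (f' x)) (f'1 : forall x, `|f' x| <= 1)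
  (f1 : forall x, `|f x| <= 1).

Let d1 (s x : R) : is_derive s 1 (fun t => f (t * x)) (x * f' (s * x)).
Proof.
have dl : is_derive s 1 (fun t => t * x) x.
  apply: is_derive_eq (is_deriveM (is_derive_id s 1) (is_derive_cst x s 1)) _.
  by rewrite /GRing.scale/= mulr0 add0r mulr1.
by have := @is_derive1_comp R f (fun t => t * x) s _ _ (df (s * x)) dl; rewrite mulrC.
Qed.

Let e1 (x : R) : 1 <= expR (x ^+ 2 / 4).
Proof. by rewrite -expR0 ler_expR mulr_ge0 ?sqr_ge0. Qed.

(** Stein's identity for [x |-> f (t x)]: combined with differentiation under the
    integral it turns the characteristic function into a solution of
    [F' = - t F]. *)
Lemma normal_stein_scale t : continuous f' ->
  \int[normal_prob 0 1]_x (x * f (t * x)) = t * \int[normal_prob 0 1]_x f' (t * x).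
Proof.
move=> cf'.
have cft : continuous (fun x => f' (t * x)).
  move=> x; apply: continuous_comp; last exact: cf'.
  by apply: cvgM; [exact: cvg_cst|exact: cvg_id].
rewrite -RintegralZl//; last first.
  apply: (@integrable_normal_bound R 1); first exact: continuous_measurable_fun.
  by move=> x; rewrite mul1r (le_trans (f'1 _)).
have dft (x : R) : is_derive x 1 (fun x => f (t * x)) (t * f' (t * x)).
  have := d1 x t; rewrite (mulrC x).
  by under eq_fun do rewrite mulrC.
rewrite (@normal_stein R (fun x => f (t * x)) (fun x => t * f' (t * x)) (1 + `|t|))//.
- by move=> x; apply: cvgM; [exact: cvg_cst|exact: cft].
- move=> x; apply: le_trans (f1 _) _; have := e1 x; have := normr_ge0 t; nra.
- move=> x; rewrite normrM; have := f'1 (t * x); have := e1 x.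
  by have := normr_ge0 t; have := normr_ge0 (f' (t * x)); nra.
- move=> x; rewrite normrM; have := f1 (t * x); have := norm_le_expR_sqr x.
  have := normr_ge0 t; have := normr_ge0 (f (t * x)); have := normr_ge0 x.
  have := e1 x; nra.
Qed.

Lemma normal_char_derive (t : R) :
  is_derive t (1 : R) (fun t => \int[normal_prob 0 1]_x f (t * x))
    (\int[normal_prob 0 1]_x (x * f' (t * x))).
Proof.
have cf : continuous f.
  by move=> x; apply: differentiable_continuous; apply/derivable1_diffP; have [] := df x.
have It : `]t - 1, t + 1[%classic t by rewrite /= in_itv/=; lra.
have intf s : `]t - 1, t + 1[%classic s -> (normal_prob 0 1).-integrable setT (EFin \o (fun x => f (s * x))).
  move=> _; apply: (@integrable_normal_bound R 1).
    apply: measurableT_comp; first exact: continuous_measurable_fun.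
    exact: measurable_funM.
  by move=> x; rewrite mul1r (le_trans (f1 _)).
have intG : (normal_prob 0 1).-integrable setT (EFin \o (fun x : R => `|x|)).
  apply: (@integrable_normal_bound R 1); first exact: measurableT_comp.
  by move=> x; rewrite normr_id mul1r norm_le_expR_sqr.
have Hd (s x : R) : `]t - 1, t + 1[%classic s -> [set: R] x -> derivable (fun t : R => f (t * x)) s (1 : R).
  by move=> _ _; have [] := d1 s x.
have ub s (x : R) : `]t - 1, t + 1[%classic s -> [set: R] x -> `|partial1of2 (fun t x => f (t * x)) s x| <= `|x|.
  move=> _ _; rewrite partial1of2E; have [_ ->] := d1 s x.
  by rewrite normrM ler_piMr.
apply: DeriveDef.
  exact: (derivable_under_integral measurableT It intf Hd (@normr_ge0 _ _) intG ub).
rewrite -derive1E (differentiation_under_integral measurableT It intf Hd (@normr_ge0 _ _) intG ub).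
apply: eq_Rintegral => x _.
by rewrite partial1of2E; have [_ ->] := d1 t x.
Qed.

End char_derive.

Let cb (x : R) : `|cos x| <= 1.
Proof. by rewrite ler_norml cos_geN1 cos_le1. Qed.

Let sb (x : R) : `|sin x| <= 1.
Proof. by rewrite ler_norml sin_geN1 sin_le1. Qed.

Let Nsb (x : R) : `|- sin x| <= 1.
Proof. by rewrite normrN. Qed.

Let csin : continuous (fun x : R => - sin x).
Proof. by move=> x; apply: cvgN; exact: continuous_sin. Qed.

Lemma normal_char_cos (t : R) :
  \int[normal_prob 0 1]_x cos (t * x) = expR (- (t ^+ 2 / 2)).
Proof.
pose F (t : R) := \int[normal_prob 0 1]_x cos (t * x).
suff /gaussian_ode/(_ t) : forall t : R, is_derive t (1 : R) F (- (t * F t)).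
  rewrite {2}/F; under eq_Rintegral do rewrite mul0r cos0.
  by move=> e; transitivity (F t) => //; rewrite e Rintegral_cst//= probability_setT !mul1r.
move=> {}t; rewrite /F.
apply: is_derive_eq (normal_char_derive (@is_derive_cos R) Nsb cb t) _.
rewrite -(normal_stein_scale (@is_derive_sin R) cb sb t (@continuous_cos R)).
rewrite -[RHS]mulN1r -RintegralZl//.
  by apply: eq_Rintegral => x _; rewrite mulrN mulN1r.
apply: (@integrable_normal_bound R 1).
  apply: measurable_funM => //; apply: measurableT_comp.
    by apply: continuous_measurable_fun; exact: continuous_sin.
  exact: measurable_funM.
move=> x; rewrite mul1r (le_trans _ (norm_le_expR_sqr x))//.
by rewrite normrM ler_piMr.
Qed.

Lemma normal_char_sin (t : R) : \int[normal_prob 0 1]_x sin (t * x) = 0.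
Proof.
pose F (t : R) := \int[normal_prob 0 1]_x sin (t * x).
suff /gaussian_ode/(_ t) : forall t : R, is_derive t (1 : R) F (- (t * F t)).
  rewrite {2}/F; under eq_Rintegral do rewrite mul0r sin0.
  by move=> e; transitivity (F t) => //; rewrite e Rintegral_cst//= mul0r mul0r.
move=> {}t; rewrite /F.
apply: is_derive_eq (normal_char_derive (@is_derive_sin R) cb sb t) _.
rewrite (normal_stein_scale (@is_derive_cos R) Nsb cb t csin) -mulrN.
rewrite -[X in _ = _ * X]mulN1r -[X in _ = _ * X]RintegralZl//.
  by congr (_ * _); apply: eq_Rintegral => x _; rewrite mulN1r.
apply: (@integrable_normal_bound R 1).
  apply: measurableT_comp.
    by apply: continuous_measurable_fun; exact: continuous_sin.
  exact: measurable_funM.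
move=> x; rewrite mul1r (le_trans (sb _))//.
by rewrite -expR0 ler_expR mulr_ge0 ?sqr_ge0.
Qed.

End normal_moments.

(** * Bounded random variables, product probabilities, uniqueness of measures *)

Section bounded_measurable.
Context d (T : measurableType d) (R : realType).
Implicit Types f g : T -> R.

(** Bounded measurable functions: the class on which expectation is linear
    without further integrability conditions. *)
Definition bmfun f := measurable_fun setT f /\ exists c, forall w, `|f w| <= c.

Lemma bmfun_measurable f : bmfun f -> measurable_fun setT f.
Proof. by case. Qed.

Lemma bmfun_cst c : bmfun (fun=> c).
Proof. by split; [exact: measurable_cst|exists `|c|]. Qed.

Lemma bmfunD f g : bmfun f -> bmfun g -> bmfun (fun w => f w + g w).
Proof.
move=> [mf [a fa]] [mg [b gb]]; split; first exact: measurable_funD.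
by exists (a + b) => w; rewrite (le_trans (ler_normD _ _))// lerD.
Qed.

Lemma bmfunN f : bmfun f -> bmfun (fun w => - f w).
Proof.
move=> [mf [a fa]]; split; first exact: measurableT_comp.
by exists a => w; rewrite normrN.
Qed.

Lemma bmfunB f g : bmfun f -> bmfun g -> bmfun (fun w => f w - g w).
Proof. by move=> bf /bmfunN; exact: bmfunD. Qed.

Lemma bmfunM f g : bmfun f -> bmfun g -> bmfun (fun w => f w * g w).
Proof.
move=> [mf [a fa]] [mg [b gb]]; split; first exact: measurable_funM.
by exists (a * b) => w; rewrite normrM ler_pM.
Qed.

Lemma bmfunZ c f : bmfun f -> bmfun (fun w => c * f w).
Proof. by move=> bf; apply: bmfunM => //; exact: bmfun_cst. Qed.

Lemma bmfun_cos f : measurable_fun setT f -> bmfun (fun w => cos (f w)).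
Proof.
move=> mf; split; last by exists 1 => w; rewrite ler_norml cos_geN1 cos_le1.
apply: measurableT_comp mf; apply: continuous_measurable_fun.
exact: continuous_cos.
Qed.

Lemma bmfun_sin f : measurable_fun setT f -> bmfun (fun w => sin (f w)).
Proof.
move=> mf; split; last by exists 1 => w; rewrite ler_norml sin_geN1 sin_le1.
apply: measurableT_comp mf; apply: continuous_measurable_fun.
exact: continuous_sin.
Qed.

Lemma bmfun_indic A : measurable A -> bmfun (\1_A : T -> R).
Proof.
move=> mA; split; first exact: measurable_indic.
by exists 1 => w; rewrite indicE; case: (_ \in _); rewrite ?normr1 ?normr0.
Qed.

Context (P : probability T R).

Lemma bmfun_integrable f : bmfun f -> P.-integrable setT (EFin \o f).
Proof.
move=> [mf [c fc]].
apply: (@le_integrable _ _ R P setT measurableT _ (EFin \o cst c)).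
- exact/measurable_EFinP.
- by move=> w _ /=; rewrite lee_fin (le_trans (fc w))// ler_norm.
- exact: finite_measure_integrable_cst.
Qed.

Lemma expectD f g : bmfun f -> bmfun g ->
  \int[P]_w (f w + g w) = \int[P]_w f w + \int[P]_w g w.
Proof. by move=> bf bg; rewrite RintegralD//; exact: bmfun_integrable. Qed.

Lemma expectB f g : bmfun f -> bmfun g ->
  \int[P]_w (f w - g w) = \int[P]_w f w - \int[P]_w g w.
Proof. by move=> bf bg; rewrite RintegralB//; exact: bmfun_integrable. Qed.

Lemma expectZ c f : bmfun f -> \int[P]_w (c * f w) = c * \int[P]_w f w.
Proof. by move=> bf; rewrite RintegralZl//; exact: bmfun_integrable. Qed.

Lemma expect_cst c : \int[P]_w c = c.
Proof.
rewrite Rintegral_cst// -[RHS]mulr1; congr (_ * _).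
by rewrite [X in fine X]probability_setT.
Qed.

Lemma expect_indic A : measurable A -> \int[P]_w \1_A w = fine (P A).
Proof. by move=> mA; rewrite /Rintegral integral_indic// setIT. Qed.

End bounded_measurable.

Section product_probability.
Context d1 d2 (T1 : measurableType d1) (T2 : measurableType d2) (R : realType).
Variables (P1 : probability T1 R) (P2 : probability T2 R).

Definition prod_probability : set (T1 * T2) -> \bar R := (P1 \x P2)%E.

HB.instance Definition _ := Measure.on prod_probability.

Let prod_probability_setT : prod_probability setT = 1%E.
Proof.
rewrite -setXTT [LHS]product_measure1E// [X in (X * _)%E]probability_setT mul1e.
exact: probability_setT.
Qed.

HB.instance Definition _ :=
  Measure_isProbability.Build _ _ _ prod_probability prod_probability_setT.

Lemma Rintegral_prod_probability (f : T1 * T2 -> R) : bmfun f ->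
  \int[prod_probability]_z f z = \int[P1]_x \int[P2]_y f (x, y) /\
  \int[prod_probability]_z f z = \int[P2]_y \int[P1]_x f (x, y).
Proof.
move=> bf; have if_ := bmfun_integrable prod_probability bf.
have [mf [c fc]] := bf.
have bf1 x : bmfun (fun y => f (x, y)).
  by split; [exact: measurableT_comp mf (pair1_measurable x)|exists c].
have bf2 y : bmfun (fun x => f (x, y)).
  by split; [exact: measurableT_comp mf (pair2_measurable y)|exists c].
split; congr fine; symmetry.
  transitivity (\int[P1]_x \int[P2]_y (f (x, y))%:E)%E.
    apply: eq_integral => x _; rewrite fineK//.
    exact: integrable_fin_num (bmfun_integrable P2 (bf1 x)).
  exact: integral12_prod_meas1 if_.
transitivity (\int[P2]_y \int[P1]_x (f (x, y))%:E)%E.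
  apply: eq_integral => x _; rewrite fineK//.
  exact: integrable_fin_num (bmfun_integrable P1 (bf2 x)).
exact: integral21_prod_meas1 if_.
Qed.

Lemma Rfubini (f : T1 * T2 -> R) : bmfun f ->
  \int[P1]_x \int[P2]_y f (x, y) = \int[P2]_y \int[P1]_x f (x, y).
Proof. by move=> /Rintegral_prod_probability[<- <-]. Qed.

Lemma bmfun_Rintegral (f : T1 * T2 -> R) : bmfun f ->
  bmfun (fun x => \int[P2]_y f (x, y)).
Proof.
move=> bf; have [mf [c fc]] := bf; split.
  apply: (measurableT_comp (@fine_measurable R setT measurableT)).
  exact: (measurable_fubini_F (bmfun_integrable prod_probability bf)).
exists c => x.
have bfx : bmfun (fun y => f (x, y)).
  by split; [exact: measurableT_comp mf (pair1_measurable x)|exists c].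
apply: le_trans (le_normr_Rintegral measurableT (bmfun_integrable P2 bfx)) _.
rewrite -[leRHS](expect_cst P2); apply: le_Rintegral => //.
  have [mfx [c' fc']] := bfx; apply: (@bmfun_integrable _ _ _ P2 (fun y => `|f (x, y)|)).
  by split; [exact: measurableT_comp|exists c' => y; rewrite normr_id].
exact/bmfun_integrable/bmfun_cst.
Qed.

End product_probability.

Section pi_system_uniqueness.
Context (R : realType).

Lemma eq_finite_measure_rays (m1 m2 : {measure set (measurableTypeR R) -> \bar R}) :
  (m1 setT < +oo)%E -> (forall a : R, m1 `]-oo, a[%classic = m2 `]-oo, a[%classic) ->
  forall A, measurable A -> m1 A = m2 A.
Proof.
move=> m1oo m12.
pose G := [set A : set (measurableTypeR R) | exists x, A = `]-oo, x[%classic].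
apply: (measure_unique G (fun n => `]-oo, n%:R[%classic)).
- exact: RGenInftyO.measurableE.
- move=> _ _ [x ->] [y ->]; exists (Num.min x y).
  by apply/seteqP; split => z; rewrite /= !in_itv/= lt_min => /andP.
- by move=> n; exists n%:R.
- apply/seteqP; split => // x _; exists (Num.truncn `|x|).+1 => //=.
  by rewrite in_itv/= (le_lt_trans (ler_norm x))// truncnS_gt.
- by move=> _ [x ->].
- move=> k; apply: le_lt_trans m1oo; apply: le_measure => //; rewrite inE//.
Qed.

Context d1 d2 (T1 : measurableType d1) (T2 : measurableType d2).

Lemma eq_finite_measure_rectangles (m1 m2 : {measure set (T1 * T2) -> \bar R}) :
  (m1 setT < +oo)%E ->
  (forall A B, measurable A -> measurable B -> m1 (A `*` B) = m2 (A `*` B)) ->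
  forall X, measurable X -> m1 X = m2 X.
Proof.
move=> m1oo m12.
pose G : set (set (T1 * T2)) :=
  [set C | exists A, measurable A /\ exists B, measurable B /\ C = A `*` B].
apply: (measure_unique G (fun=> setT)).
- rewrite measurable_prod_measurableType //; congr (<<s _ >>).
  rewrite predeqE; split => [[A mA [B mB <-]]|[A [mA [B [mB ->]]]]].
    by exists A; split => //; exists B.
  by exists A => //; exists B.
- move=> _ _ [X1 [mX1 [X2 [mX2 ->]]]] [Y1 [mY1 [Y2 [mY2 ->]]]].
  rewrite -setXI; exists (X1 `&` Y1); split; first exact: measurableI.
  by exists (X2 `&` Y2); split => //; exact: measurableI.
- by move=> n; exists setT; split => //; exists setT; split => //; rewrite setXTT.
- by rewrite bigcup_const//; exists 0%N.
- by move=> _ [A [mA [B [mB ->]]]]; exact: m12.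
- by [].
Qed.

End pi_system_uniqueness.

(** * From characteristic functions to laws by Gaussian smoothing *)

Section normal_cdf.
Context (R : realType).
Local Notation phi := (normal_pdf 0 1 : R -> R).
Local Notation N := (normal_prob 0 1 : probability (measurableTypeR R) R).

(** The normal density is its own Fourier transform: this replaces an inversion
    formula in the identification of laws below. *)
Lemma normal_pdf01_cos (s : R) : phi s = normal_peak 1 * \int[N]_x cos (x * s).
Proof.
under eq_Rintegral do rewrite mulrC.
rewrite normal_char_cos normal_pdfE ?oner_neq0// /normal_fun.
by congr (_ * expR _); field.
Qed.

Definition normal_cdf (c : R) : R := fine (N `]-oo, c]%classic).

(** [normal_cdf (n (a - x))] is the indicator of the ray up to [a], smoothed by a
    normal density of deviation [1 / n]. *)
Lemma normal_cdf_scale (n a x : R) : 0 < n ->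
  (normal_cdf (n * (a - x)))%:E =
  (\int[lebesgue_measure]_y (\1_(`]-oo, a]%classic : set R) y * n * phi (n * (x - y)))%:E)%E.
Proof.
move=> n0; rewrite /normal_cdf fineK; last exact: fin_num_measure.
rewrite (@ge0_integral_affine R x n^-1); first last.
- by move=> y; rewrite lee_fin !mulr_ge0 ?normal_pdf_ge0 ?(ltW n0) ?indicE ?ler0n//.
- apply/measurable_EFinP; apply: measurable_funM.
    by apply: measurable_funM => //; exact: measurable_indic.
  apply: measurableT_comp; first exact: measurable_normal_pdf.
  by apply: measurable_funM => //; exact: measurable_funB.
- by rewrite invr_gt0.
rewrite -ge0_integralZl//=; first last.
- by rewrite lee_fin invr_ge0 ltW.
- by move=> y _; rewrite lee_fin !mulr_ge0 ?normal_pdf_ge0 ?(ltW n0) ?indicE ?ler0n//.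
- apply/measurable_EFinP; apply: measurable_funM.
    apply: measurable_funM => //; apply: measurableT_comp; first exact: measurable_indic.
    by apply: measurable_funD => //; exact: measurable_funM.
  apply: measurableT_comp; first exact: measurable_normal_pdf.
  apply: measurable_funM => //; apply: measurable_funB => //.
  by apply: measurable_funD => //; exact: measurable_funM.
rewrite /normal_prob integral_mkcond; apply: eq_integral => y _.
rewrite patchE -EFinM.
have -> : n * (x - (x + n^-1 * y)) = - y by field; rewrite gt_eqF.
have -> : phi (- y) = phi y.
  by rewrite normal_pdfE ?oner_neq0// /normal_fun !subr0 sqrrN.
have -> : \1_(`]-oo, a]%classic : set R) (x + n^-1 * y) =
    (y \in `]-oo, (n * (a - x))]%classic)%:R :> R.
  rewrite indicE; congr (_%:R); rewrite !mem_setE !in_itv/=.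
  by rewrite -lerBrDl mulrC ler_pdivrMr// mulrC.
case: ifPn => _; last by rewrite !(mul0r, mulr0).
by congr EFin; rewrite mul1r mulKf ?gt_eqF.
Qed.

Lemma measurable_normal_cdf : measurable_fun setT normal_cdf.
Proof.
apply: nondecreasing_measurable => // x y xy.
rewrite fine_le ?fin_num_measure// le_measure ?inE//.
by move=> z; rewrite /= !in_itv/= => /le_trans; exact.
Qed.

Lemma normal_cdf_le1 c : 0 <= normal_cdf c <= 1.
Proof.
rewrite fine_ge0//= -lee_fin fineK ?fin_num_measure//.
exact: probability_le1.
Qed.

Let idM : {mfun measurableTypeR R >-> R} :=
  HB.pack (fun x : measurableTypeR R => x : R)
    (isMeasurableFun.Build _ _ _ _ (fun x : measurableTypeR R => x : R)
      (@measurable_id _ _ setT)).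

Lemma cvg_normal_cdfy : normal_cdf x @[x --> +oo] --> (1 : R).
Proof. exact: (fine_cvg (@cvg_cdfy1 _ _ R N idM)). Qed.

Lemma cvg_normal_cdfNy : normal_cdf x @[x --> -oo] --> (0 : R).
Proof. exact: (fine_cvg (@cvg_cdfNy0 _ _ R N idM)). Qed.

End normal_cdf.

Section smoothing.
Context d (T : measurableType d) (R : realType) (P : probability T R).
Variables (W M : T -> R).
Hypotheses (mW : measurable_fun setT W) (bM : bmfun M) (M0 : forall w, 0 <= M w).
Hypotheses
  (Hcos : forall t, \int[P]_w (M w * cos (t * W w)) =
     expR (- (t ^+ 2 / 2)) * \int[P]_w M w)
  (Hsin : forall t, \int[P]_w (M w * sin (t * W w)) = 0).

Local Notation phi := (normal_pdf 0 1 : R -> R).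
Local Notation N := (normal_prob 0 1 : probability (measurableTypeR R) R).

(** Expanding [phi] by its Fourier representation and exchanging integrals, only
    the weighted characteristic function of [W] enters; hence the value depends
    on [M] and [W] through the mass of [M] alone. *)
Lemma smoothed_char (n y : R) : \int[P]_w (M w * phi (n * (W w - y))) =
  \int[P]_w M w * (normal_peak 1 *
    \int[N]_x (cos (n * x * y) * expR (- ((n * x) ^+ 2 / 2)))).
Proof.
have mW' : measurable_fun setT (fun z : T * measurableTypeR R => W z.1).
  exact: measurableT_comp.
have bM' : bmfun (fun z : T * measurableTypeR R => M z.1).
  have [mM [c Mc]] := bM; split; last by exists c.
  exact: measurableT_comp mM measurable_fst.
have mx : measurable_fun setT (fun z : T * measurableTypeR R => z.2 * (n * (W z.1 - y))).
  apply: measurable_funM; first exact: measurable_snd.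
  by apply: measurable_funM => //; exact: measurable_funB.
have bF : bmfun (fun z : T * measurableTypeR R => M z.1 * cos (z.2 * (n * (W z.1 - y)))).
  by apply: bmfunM => //; exact: bmfun_cos.
have bc (w : T) : bmfun (fun x : measurableTypeR R => cos (x * (n * (W w - y)))).
  by apply: bmfun_cos; exact: measurable_funM.
transitivity (normal_peak 1 * \int[P]_w \int[N]_x (M w * cos (x * (n * (W w - y))))).
  rewrite -expectZ; last exact: (bmfun_Rintegral P N bF).
  apply: eq_Rintegral => w _; rewrite expectZ// normal_pdf01_cos; ring.
rewrite (Rfubini P N bF) mulrCA; congr (_ * _).
rewrite -expectZ; last first.
  apply: bmfunM; first by apply: bmfun_cos; do 2 apply: measurable_funM => //.
  split; last first.
    exists 1 => x; rewrite ger0_norm ?expR_ge0// -expR0 ler_expR oppr_le0.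
    by rewrite mulr_ge0 ?sqr_ge0.
  apply: measurableT_comp => //; apply: measurableT_comp => //.
  by apply: measurable_funM => //; apply: measurable_funX.
apply: eq_Rintegral => x _.
have mtW t : measurable_fun setT (fun w => t * W w) by exact: measurable_funM.
transitivity (\int[P]_w (cos (n * x * y) * (M w * cos (n * x * W w)) +
    sin (n * x * y) * (M w * sin (n * x * W w)))).
  apply: eq_Rintegral => w _.
  rewrite (_ : x * _ = n * x * W w - n * x * y); last by ring.
  rewrite cosB; ring.
rewrite expectD ?expectZ; try by repeat (apply: bmfunM || apply: bmfun_cst ||
  apply: bmfun_cos || apply: bmfun_sin).
rewrite Hcos Hsin; ring.
Qed.

Lemma tonelli_smoothed (n a : R) : 0 < n ->
  (\int[P]_w (M w * normal_cdf (n * (a - W w)))%:E =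
   \int[lebesgue_measure]_y ((\1_(`]-oo, a]%classic : set R) y * n)%:E *
     (\int[P]_w (M w * phi (n * (W w - y)))%:E)))%E.
Proof.
move=> n0.
pose F (z : T * measurableTypeR R) : R :=
  M z.1 * (\1_(`]-oo, a]%classic : set R) z.2 * n * phi (n * (W z.1 - z.2))).
have F0 z : 0 <= F z.
  by rewrite !mulr_ge0 ?normal_pdf_ge0 ?(ltW n0) ?indicE ?ler0n//.
have mF : measurable_fun setT (fun z => (F z)%:E).
  apply/measurable_EFinP; apply: measurable_funM.
    by have [mM _] := bM; exact: measurableT_comp mM measurable_fst.
  apply: measurable_funM.
    apply: measurable_funM => //.
    by apply: measurableT_comp measurable_snd; exact: measurable_indic.
  apply: measurableT_comp; first exact: measurable_normal_pdf.
  apply: measurable_funM => //; apply: measurable_funB => //.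
  exact: measurableT_comp mW measurable_fst.
have := @fubini_tonelli _ _ _ _ _ P (@lebesgue_measure R) (fun z => (F z)%:E) mF
  (fun z => F0 z).
move=> H; transitivity (\int[P]_w \int[lebesgue_measure]_y (F (w, y))%:E)%E.
  apply: eq_integral => w _; rewrite EFinM normal_cdf_scale// -ge0_integralZl//=.
  - apply/measurable_EFinP; apply: measurable_funM.
      by apply: measurable_funM => //; exact: measurable_indic.
    apply: measurableT_comp; first exact: measurable_normal_pdf.
    by apply: measurable_funM => //; exact: measurable_funB.
  - by move=> y _; rewrite lee_fin !mulr_ge0 ?normal_pdf_ge0 ?(ltW n0) ?indicE ?ler0n//.
  - by rewrite lee_fin.
rewrite H; apply: eq_integral => y _.
rewrite -ge0_integralZl//=.
- by apply: eq_integral => w _; rewrite -EFinM /F/=; congr EFin; ring.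
- apply/measurable_EFinP; apply: measurable_funM; first by have [] := bM.
  apply: measurableT_comp; first exact: measurable_normal_pdf.
  by apply: measurable_funM => //; exact: measurable_funB.
- by move=> w _; rewrite lee_fin mulr_ge0 ?normal_pdf_ge0.
- by rewrite lee_fin mulr_ge0 ?(ltW n0) ?indicE ?ler0n.
Qed.

End smoothing.

Section ray_limit.
Context d (T : measurableType d) (R : realType) (P : probability T R).
Variables (W M : T -> R).
Hypotheses (mW : measurable_fun setT W) (bM : bmfun M) (M0 : forall w, 0 <= M w).
Local Notation N := (normal_prob 0 1 : probability (measurableTypeR R) R).

(** The centre is shifted by [1 / k] so that the limit at [x = a] is 0, which gives
    the open ray exactly; the scale [k^2] outgrows this shift. *)
Lemma cvg_normal_cdf_ray (a x : R) :
  normal_cdf (k.+1%:R ^+ 2 * (a - k.+1%:R^-1 - x)) @[k --> \oo] -->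
  (\1_(`]-oo, a[%classic) x : R).
Proof.
have E (k : nat) : k.+1%:R ^+ 2 * (a - k.+1%:R^-1 - x) =
    k.+1%:R * (k.+1%:R * (a - x) - 1) :> R.
  have : k.+1%:R != 0 :> R by rewrite pnatr_eq0.
  by move: (k.+1%:R : R) => n n0; field.
under eq_fun do rewrite E.
rewrite indicE mem_setE in_itv/=; have [xa|ax] := ltP x a.
  apply: (cvg_comp _ _ _ (@cvg_normal_cdfy R)).
  apply/cvgryPge => A; near=> k.
  have k2 : 2 <= k.+1%:R * (a - x).
    rewrite -ler_pdivrMr ?subr_gt0//.
    apply: (@le_trans _ _ k%:R); last by rewrite ler_nat.
    by near: k; exact: nbhs_infty_ger.
  have kA : A <= k.+1%:R.
    apply: (@le_trans _ _ k%:R); last by rewrite ler_nat.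
    by near: k; exact: nbhs_infty_ger.
  apply: (le_trans kA); rewrite ler_peMr//; lra.
apply: (cvg_comp _ _ _ (@cvg_normal_cdfNy R)).
apply/cvgrNyPle => A; near=> k.
have kA : - A <= k.+1%:R.
  apply: (@le_trans _ _ k%:R); last by rewrite ler_nat.
  by near: k; exact: nbhs_infty_ger.
have k0 : 0 <= k.+1%:R :> R by [].
have : k.+1%:R * (a - x) <= 0 by rewrite mulr_ge0_le0// subr_le0.
nra.
Unshelve. all: by end_near. Qed.

Lemma cvg_smoothed_ray (a : R) :
  \int[P]_w (M w * normal_cdf (k.+1%:R ^+ 2 * (a - k.+1%:R^-1 - W w))) @[k --> \oo]
  --> \int[P]_w (M w * \1_(`]-oo, a[%classic) (W w)).
Proof.
apply: (@Rdominated_cvg _ _ _ P _ _ M).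
- move=> k; apply: measurable_funM; first by have [] := bM.
  apply: measurableT_comp; first exact: measurable_normal_cdf.
  by apply: measurable_funM => //; exact: measurable_funB.
- by move=> w; apply: cvgM; [exact: cvg_cst|exact: cvg_normal_cdf_ray].
- exact: bmfun_integrable.
- move=> k w; rewrite normrM (ger0_norm (M0 w)) ler_piMr//.
  by have /andP[K0 K1] := normal_cdf_le1 (k.+1%:R ^+ 2 * (a - k.+1%:R^-1 - W w));
    rewrite ger0_norm.
Qed.

End ray_limit.

Section characteristic_function_rays.
Context d (T : measurableType d) (R : realType) (P : probability T R).
Variables (W M : T -> R).
Hypotheses (mW : measurable_fun setT W) (bM : bmfun M) (M0 : forall w, 0 <= M w).
Hypotheses
  (Hcos : forall t, \int[P]_w (M w * cos (t * W w)) =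
     expR (- (t ^+ 2 / 2)) * \int[P]_w M w)
  (Hsin : forall t, \int[P]_w (M w * sin (t * W w)) = 0).
Local Notation N := (normal_prob 0 1 : probability (measurableTypeR R) R).
Local Notation phi := (normal_pdf 0 1 : R -> R).

(** By [smoothed_char] the left side does not change when [(P, W, M)] is replaced
    by a standard normal variable with constant weight of the same mass. *)
Lemma smoothed_ray_independent (n a : R) : 0 < n ->
  \int[P]_w (M w * normal_cdf (n * (a - W w))) =
  \int[P]_w M w * \int[N]_x (1 * normal_cdf (n * (a - x))).
Proof.
move=> n0.
have b1 : bmfun (fun _ : measurableTypeR R => 1 : R) by exact: bmfun_cst.
have id_cos t : \int[N]_x (1 * cos (t * x)) = expR (- (t ^+ 2 / 2)) * \int[N]_x (1 : R).
  under eq_Rintegral do rewrite mul1r.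
  by rewrite normal_char_cos expect_cst mulr1.
have id_sin t : \int[N]_x (1 * sin (t * x)) = 0 :> R.
  by under eq_Rintegral do rewrite mul1r; rewrite normal_char_sin.
pose psi y := normal_peak 1 *
    \int[N]_x (cos (n * x * y) * expR (- ((n * x) ^+ 2 / 2))).
have ephi (d' : measure_display) (T' : measurableType d') (P' : probability T' R)
    (W' M' : T' -> R) : measurable_fun setT W' -> bmfun M' ->
    (forall t, \int[P']_w (M' w * cos (t * W' w)) =
     expR (- (t ^+ 2 / 2)) * \int[P']_w M' w) ->
    (forall t, \int[P']_w (M' w * sin (t * W' w)) = 0) ->
  forall y, (\int[P']_w (M' w * phi (n * (W' w - y)))%:E =
    (\int[P']_w M' w)%:E * (psi y)%:E)%E.
  move=> mW' bM' hc hs y; rewrite -EFinM -(smoothed_char mW' bM' hc hs) /Rintegral fineK//.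
  apply/(integrable_fin_num measurableT)/bmfun_integrable/bmfunM => //.
  split.
    apply: measurableT_comp; first exact: measurable_normal_pdf.
    by apply: measurable_funM => //; exact: measurable_funB.
  exists (normal_peak 1) => w; rewrite ger0_norm ?normal_pdf_ge0//.
  by apply: normal_pdf_ub; exact: oner_neq0.
have psi0 y : 0 <= psi y.
  have := ephi _ _ N id (fun=> 1) (@measurable_id _ _ setT) b1 id_cos id_sin y.
  rewrite expect_cst mul1e -lee_fin => <-; apply: integral_ge0 => x _.
  by rewrite lee_fin mul1r normal_pdf_ge0.
have mpsi : measurable_fun setT psi.
  have b2 : bmfun (fun z : measurableTypeR R * measurableTypeR R =>
      cos (n * z.2 * z.1) * expR (- ((n * z.2) ^+ 2 / 2))).
    apply: bmfunM.
      apply: bmfun_cos; apply: measurable_funM; last exact: measurable_fst.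
      by apply: measurable_funM => //; exact: measurable_snd.
    split; last first.
      exists 1 => x; rewrite ger0_norm ?expR_ge0// -expR0 ler_expR oppr_le0.
      by rewrite mulr_ge0 ?sqr_ge0.
    apply: measurableT_comp => //; apply: measurableT_comp => //.
    apply: measurable_funM => //; apply: measurable_funX => //.
    by apply: measurable_funM => //; exact: measurable_snd.
  by apply: measurable_funM => //; have [] := bmfun_Rintegral N N b2.
have K0 x : 0 <= normal_cdf (n * (a - x)) by case/andP: (normal_cdf_le1 (n * (a - x))).
have E0 : 0 <= \int[P]_w M w by apply: Rintegral_ge0 => w _.
transitivity (fine (\int[P]_w (M w * normal_cdf (n * (a - W w)))%:E)) => //.
rewrite (tonelli_smoothed P mW bM M0 a n0).
under eq_integral do rewrite (ephi _ _ P W M mW bM Hcos Hsin) muleCA.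
rewrite ge0_integralZl//=; first last.
- move=> y _; apply: mule_ge0; rewrite lee_fin; last exact: psi0.
  by rewrite mulr_ge0 ?(ltW n0) ?indicE ?ler0n.
- apply: emeasurable_funM; apply/measurable_EFinP => //.
  by apply: measurable_funM => //; exact: measurable_indic.
have := tonelli_smoothed N (@measurable_id _ _ setT) b1 (fun=> ler01) a n0.
under [in RHS]eq_integral do
  rewrite (ephi _ _ N id (fun=> 1) (@measurable_id _ _ setT) b1 id_cos id_sin) expect_cst mul1e.
move=> <-; rewrite fineM//.
apply/(integrable_fin_num measurableT)/bmfun_integrable/bmfunM => //; split.
  apply: measurableT_comp; first exact: measurable_normal_cdf.
  by apply: measurable_funM => //; exact: measurable_funB.
exists 1 => x; rewrite ger0_norm//.
by case/andP: (normal_cdf_le1 (n * (a - x))).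
Qed.

(** If the [M]-weighted characteristic function of [W] is Gaussian, then under the
    weight [M] the variable [W] is standard normal, on rays. *)
Lemma ray_independent (a : R) :
  \int[P]_w (M w * \1_(`]-oo, a[%classic) (W w)) =
  \int[P]_w M w * fine (N `]-oo, a[%classic).
Proof.
have b1 : bmfun (fun _ : measurableTypeR R => 1 : R) by exact: bmfun_cst.
have l1 := @cvg_smoothed_ray _ _ _ P _ _ mW bM M0 a.
have l2 := @cvg_smoothed_ray _ _ _ N _ _ (@measurable_id _ _ setT) b1 (fun=> ler01) a.
have E : \int[N]_x (1 * \1_(`]-oo, a[%classic) x) = fine (N `]-oo, a[%classic).
  under eq_Rintegral do rewrite mul1r.
  by rewrite expect_indic.
have {}l2 : \int[P]_w M w * \int[N]_x (1 * normal_cdf (k.+1%:R ^+ 2 * (a - k.+1%:R^-1 - x)))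
    @[k --> \oo] --> \int[P]_w M w * fine (N `]-oo, a[%classic).
  by rewrite -E; apply: cvgM; [exact: cvg_cst|exact: l2].
have e : (fun k => \int[P]_w (M w * normal_cdf (k.+1%:R ^+ 2 * (a - k.+1%:R^-1 - W w)))) =
    (fun k => \int[P]_w M w * \int[N]_x (1 * normal_cdf (k.+1%:R ^+ 2 * (a - k.+1%:R^-1 - x)))).
  by apply/funext => k; rewrite smoothed_ray_independent ?exprn_gt0.
rewrite e in l1; exact: (cvg_unique (@Rhausdorff R) l1 l2).
Qed.

End characteristic_function_rays.

(** * The law of a standard Gaussian vector *)

Ltac bmf := repeat first [assumption | exact: bmfun_cst | apply: bmfun_cos | apply: bmfun_sin
  | apply: bmfunB | apply: bmfunD | apply: bmfunM | apply: measurable_funD | apply: measurable_funM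
  | exact: measurable_cst | by []].

Section conditioning_step.
Context d (T : measurableType d) (R : realType) (P : probability T R).
Variables (W S D : T -> R) (cS c0 : R).
Hypotheses (mW : measurable_fun setT W) (mS : measurable_fun setT S)
  (bD : bmfun D) (D0 : forall w, 0 <= D w).
Hypotheses
  (hc : forall t, \int[P]_w (D w * cos (t * W w + S w)) = expR (- (t ^+ 2 / 2)) * cS)
  (hs : forall t, \int[P]_w (D w * sin (t * W w + S w)) = 0)
  (hc0 : forall t, \int[P]_w (D w * cos (t * W w)) = expR (- (t ^+ 2 / 2)) * c0)
  (hs0 : forall t, \int[P]_w (D w * sin (t * W w)) = 0).
Local Notation N := (normal_prob 0 1 : probability (measurableTypeR R) R).

Let e0 : expR (- (0 ^+ 2 / 2)) = 1 :> R.
Proof. by rewrite expr0n/= mul0r oppr0 expR0. Qed.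

Let ED : \int[P]_w D w = c0.
Proof.
rewrite -[RHS]mul1r -e0 -hc0; apply: eq_Rintegral => w _.
by rewrite mul0r cos0 mulr1.
Qed.

Let EDcos : \int[P]_w (D w * cos (S w)) = cS.
Proof.
rewrite -[RHS]mul1r -e0 -hc; apply: eq_Rintegral => w _.
by rewrite mul0r add0r.
Qed.

Let EDsin : \int[P]_w (D w * sin (S w)) = 0.
Proof. by rewrite -(hs 0); apply: eq_Rintegral => w _; rewrite mul0r add0r. Qed.

Let base (a : R) : \int[P]_w (D w * \1_(`]-oo, a[%classic) (W w)) =
   c0 * fine (N `]-oo, a[%classic).
Proof. by rewrite (ray_independent mW bD D0)// ED. Qed.

Let bI (a : R) : bmfun (fun w => \1_(`]-oo, a[%classic) (W w) : R).
Proof.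
have [mI [c Ic]] := @bmfun_indic _ _ R `]-oo, a[%classic (measurable_itv _).
by split; [exact: measurableT_comp mI mW|exists c].
Qed.

(** One coordinate [W] is replaced by an event, while the factor [cos S] carries
    the other coordinates. As [D cos S] may be negative, the weights used are
    [D (1 + cos S)] and [D], both nonnegative, and the results are subtracted.
    The product formulas for cosines check the Gaussian hypothesis for the first
    of these weights. *)
Lemma conditioning_cos (a : R) :
  \int[P]_w (D w * \1_(`]-oo, a[%classic) (W w) * cos (S w)) =
  cS * fine (N `]-oo, a[%classic).
Proof.
pose M w := D w * (1 + cos (S w)).
have bM : bmfun M by rewrite /M; bmf.
have M0 w : 0 <= M w by rewrite mulr_ge0// -lerBlDl sub0r cos_geN1.
have EM : \int[P]_w M w = c0 + cS.
  rewrite -ED -EDcos -expectD; [|by bmf|by bmf].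
  by apply: eq_Rintegral => w _; rewrite /M; ring.
have H := @ray_independent _ _ _ P W M mW bM M0 _ _ a.
transitivity (\int[P]_w (M w * \1_(`]-oo, a[%classic) (W w)) -
   \int[P]_w (D w * \1_(`]-oo, a[%classic) (W w))).
  rewrite -expectB; [|by have := bI a; bmf|by have := bI a; bmf].
  by apply: eq_Rintegral => w _; rewrite /M; ring.
rewrite base H ?EM; first by ring.
- move=> t; transitivity (\int[P]_w (D w * cos (t * W w) +
    2^-1 * (D w * cos (t * W w + S w) + D w * cos (- t * W w + S w)))).
    by apply: eq_Rintegral => w _; rewrite /M mulNr !cosD cosN sinN; field.
  rewrite expectD ?expectZ ?expectD; try by bmf.
  by rewrite hc0 !hc sqrrN; field.
- move=> t; transitivity (\int[P]_w (D w * sin (t * W w) +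
    2^-1 * (D w * sin (t * W w + S w) - D w * sin (- t * W w + S w)))).
    by apply: eq_Rintegral => w _; rewrite /M mulNr !sinD cosN sinN; field.
  rewrite expectD ?expectZ ?expectB; try by bmf.
  by rewrite hs0 !hs; ring.
Qed.

Lemma conditioning_sin (a : R) :
  \int[P]_w (D w * \1_(`]-oo, a[%classic) (W w) * sin (S w)) = 0.
Proof.
pose M w := D w * (1 + sin (S w)).
have bM : bmfun M by rewrite /M; bmf.
have M0 w : 0 <= M w by rewrite mulr_ge0// -lerBlDl sub0r sin_geN1.
have EM : \int[P]_w M w = c0.
  rewrite -[RHS]addr0 -EDsin -ED -expectD; [|by bmf|by bmf].
  by apply: eq_Rintegral => w _; rewrite /M; ring.
have H := @ray_independent _ _ _ P W M mW bM M0 _ _ a.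
transitivity (\int[P]_w (M w * \1_(`]-oo, a[%classic) (W w)) -
   \int[P]_w (D w * \1_(`]-oo, a[%classic) (W w))).
  rewrite -expectB; [|by have := bI a; bmf|by have := bI a; bmf].
  by apply: eq_Rintegral => w _; rewrite /M; ring.
rewrite base H ?EM; first by ring.
- move=> t; transitivity (\int[P]_w (D w * cos (t * W w) +
    2^-1 * (D w * sin (t * W w + S w) + D w * sin (- t * W w + S w)))).
    by apply: eq_Rintegral => w _; rewrite /M mulNr !sinD cosN sinN; field.
  rewrite expectD ?expectZ ?expectD; try by bmf.
  by rewrite hc0 !hs; ring.
- move=> t; transitivity (\int[P]_w (D w * sin (t * W w) +
    2^-1 * (D w * cos (- t * W w + S w) - D w * cos (t * W w + S w)))).
    by apply: eq_Rintegral => w _; rewrite /M mulNr !cosD cosN sinN; field.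
  rewrite expectD ?expectZ ?expectB; try by bmf.
  by rewrite hs0 !hc sqrrN; ring.
Qed.

End conditioning_step.

Section gaussian_vector_law.
Context d (T : measurableType d) (R : realType) (P : probability T R).
Local Notation N := (normal_prob 0 1 : probability (measurableTypeR R) R).
Local Notation N2 := (prod_probability N N).
Local Notation N4 := (prod_probability N2 N2).
Local Notation gchar t := (expR (- (t ^+ 2 / 2))).

Lemma law_from_rays (W : T -> R) (D : set T) (c : R) : measurable_fun setT W ->
  measurable D -> 0 <= c ->
  (forall a : R, P (W @^-1` `]-oo, a[%classic `&` D) =
     (c%:E * N `]-oo, a[%classic)%E) ->
  forall A, measurable A -> P (W @^-1` A `&` D) = (c%:E * N A)%E.
Proof.
move=> mW mD c0 H A mA.
pose k : {nonneg R} := NngNum c0.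
have mW' : measurable_fun setT (W : T -> measurableTypeR R) by [].
apply: (@eq_finite_measure_rays R (image_measure (mrestr P mD) mW') (mscale k N)) => //.
rewrite /= /pushforward /mrestr.
apply: le_lt_trans (probability_le1 _ _) _; last exact: ltry.
by apply: measurableI => //; rewrite preimage_setT.
Qed.

Lemma law_from_rectangles d1 d2 (T1 : measurableType d1) (T2 : measurableType d2)
    (P1 : probability T1 R) (P2 : probability T2 R)
    (W1 : T -> T1) (W2 : T -> T2) (D : set T) (c : R) :
  measurable_fun setT W1 -> measurable_fun setT W2 -> measurable D -> 0 <= c ->
  (forall A B, measurable A -> measurable B ->
     P (W1 @^-1` A `&` (W2 @^-1` B `&` D)) = (c%:E * (P1 A * P2 B))%E) ->
  forall X, measurable X ->
    P ((fun w => (W1 w, W2 w)) @^-1` X `&` D) = (c%:E * prod_probability P1 P2 X)%E.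
Proof.
move=> mW1 mW2 mD c0 H X mX.
pose k : {nonneg R} := NngNum c0.
have mW : measurable_fun setT (fun w => (W1 w, W2 w)) by exact: measurable_fun_pair.
apply: (@eq_finite_measure_rectangles R _ _ _ _ (image_measure (mrestr P mD) mW)
  (mscale k (prod_probability P1 P2))) => //.
  rewrite /= /pushforward /mrestr.
  apply: le_lt_trans (probability_le1 _ _) _; last exact: ltry.
  by apply: measurableI => //; rewrite preimage_setT.
move=> A B mA mB; rewrite /= /mscale/= /prod_probability product_measure1E//.
by rewrite -H// setIA.
Qed.

Variables W1 W2 W3 W4 : T -> R.
Hypotheses (m1 : measurable_fun setT W1) (m2 : measurable_fun setT W2)
  (m3 : measurable_fun setT W3) (m4 : measurable_fun setT W4).
Hypothesis Hc : forall t1 t2 t3 t4,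
  \int[P]_w cos (t1 * W1 w + (t2 * W2 w + (t3 * W3 w + t4 * W4 w))) =
  gchar t1 * (gchar t2 * (gchar t3 * gchar t4)).
Hypothesis Hs : forall t1 t2 t3 t4,
  \int[P]_w sin (t1 * W1 w + (t2 * W2 w + (t3 * W3 w + t4 * W4 w))) = 0.

Let e0 : gchar (0 : R) = 1.
Proof. by rewrite expr0n/= mul0r oppr0 expR0. Qed.

Let ray (a : R) (W : T -> R) (w : T) : R := \1_(`]-oo, a[%classic) (W w).

Let bray a W : measurable_fun setT W -> bmfun (ray a W).
Proof.
move=> mW.
have [mI [c Ic]] := @bmfun_indic _ _ R `]-oo, a[%classic (measurable_itv _).
split; first exact: measurableT_comp mI mW.
by exists c => w; exact: Ic.
Qed.

Let ray0 a W w : 0 <= ray a W w.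
Proof. by rewrite /ray indicE ler0n. Qed.

Let p (a : R) : R := fine (N `]-oo, a[%classic).

Let step (I : Type) (i0 : I) (S : I -> T -> R) (cS : I -> R) (D W : T -> R) (a : R) :
  measurable_fun setT W -> bmfun D -> (forall w, 0 <= D w) ->
  (forall i, measurable_fun setT (S i)) -> (forall w, S i0 w = 0) ->
  (forall i t, \int[P]_w (D w * cos (t * W w + S i w)) = gchar t * cS i) ->
  (forall i t, \int[P]_w (D w * sin (t * W w + S i w)) = 0) ->
  (forall i, \int[P]_w (D w * ray a W w * cos (S i w)) = cS i * p a) /\
  (forall i, \int[P]_w (D w * ray a W w * sin (S i w)) = 0).
Proof.
move=> mW bD D0 mS S0 hc hs.
have hc0 t : \int[P]_w (D w * cos (t * W w)) = gchar t * cS i0.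
  by rewrite -hc; apply: eq_Rintegral => w _; rewrite S0 addr0.
have hs0 t : \int[P]_w (D w * sin (t * W w)) = 0.
  by rewrite -[RHS](hs i0 t); apply: eq_Rintegral => w _; rewrite S0 addr0.
split=> i; first exact: (conditioning_cos mW (mS i) bD D0 (hc i) (hs i) hc0 hs0).
exact: (conditioning_sin mW (mS i) bD D0 (hc i) (hs i) hc0 hs0).
Qed.

(** Four rounds: after each the coordinate treated has moved from the phase into
    the weight. *)
Let joint_rays (a1 a2 a3 a4 : R) :
  \int[P]_w (ray a1 W1 w * ray a2 W2 w * ray a3 W3 w * ray a4 W4 w) =
  p a1 * (p a2 * (p a3 * p a4)).
Proof.
have b1 := bray a1 m1; have b2 := bray a2 m2; have b3 := bray a3 m3.
have b12 : bmfun (fun w => ray a1 W1 w * ray a2 W2 w) by exact: bmfunM.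
have b123 : bmfun (fun w => ray a1 W1 w * ray a2 W2 w * ray a3 W3 w) by exact: bmfunM.
have [c1 s1] := @step (R * R * R) (0, 0, 0)
  (fun t w => t.1.1 * W2 w + (t.1.2 * W3 w + t.2 * W4 w))
  (fun t => gchar t.1.1 * (gchar t.1.2 * gchar t.2)) (fun=> 1) W1 a1
  m1 (bmfun_cst _ 1) (fun=> ler01)
  (fun i => ltac:(by bmf)) (fun w => ltac:(by rewrite /= !mul0r !addr0))
  (fun i t => ltac:(by under eq_Rintegral do rewrite mul1r; exact: Hc))
  (fun i t => ltac:(by under eq_Rintegral do rewrite mul1r; exact: Hs)).
have [c2 s2] := @step (R * R) (0, 0)
  (fun t w => t.1 * W3 w + t.2 * W4 w)
  (fun t => gchar t.1 * gchar t.2 * p a1) (ray a1 W1) W2 a2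
  m2 b1 (ray0 a1 W1)
  (fun i => ltac:(by bmf)) (fun w => ltac:(by rewrite /= !mul0r !addr0))
  (fun i t => ltac:(by have := c1 (t, i.1, i.2); under eq_Rintegral do rewrite mul1r; move=> -> /=; ring))
  (fun i t => ltac:(by have := s1 (t, i.1, i.2); under eq_Rintegral do rewrite mul1r)).
have [c3 s3] := @step R 0 (fun t w => t * W4 w)
  (fun t => gchar t * p a1 * p a2) _ W3 a3
  m3 b12 (fun w => mulr_ge0 (ray0 a1 W1 w) (ray0 a2 W2 w))
  (fun i => ltac:(by bmf)) (fun w => ltac:(by rewrite /= !mul0r))
  (fun i t => ltac:(by rewrite (c2 (t, i))/=; ring))
  (fun i t => ltac:(by rewrite (s2 (t, i)))).
have [c4 _] := @step unit tt (fun _ _ => 0)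
  (fun _ => p a1 * p a2 * p a3) _ W4 a4
  m4 b123 (fun w => mulr_ge0 (mulr_ge0 (ray0 a1 W1 w) (ray0 a2 W2 w)) (ray0 a3 W3 w))
  (fun i => ltac:(by bmf)) (fun w => erefl)
  (fun i t => ltac:(by under eq_Rintegral do rewrite addr0; rewrite (c3 t)/=; ring))
  (fun i t => ltac:(by under eq_Rintegral do rewrite addr0; rewrite (s3 t))).
have := c4 tt; under eq_Rintegral do rewrite cos0 mulr1; move=> ->; ring.
Qed.

Let mpre (W : T -> R) A : measurable_fun setT W -> measurable A -> measurable (W @^-1` A).
Proof. by move=> mW mA; rewrite -[X in measurable X]setTI; exact: mW. Qed.

Let q (A : set R) : R := fine (N A).

Let q0 A : 0 <= q A.
Proof. exact: fine_ge0. Qed.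

Let qE (A : set R) : measurable A -> N A = (q A)%:E.
Proof. by move=> mA; rewrite /q fineK// fin_num_measure. Qed.

Let sets0 (a1 a2 a3 a4 : R) :
  P (W1 @^-1` `]-oo, a1[%classic `&` (W2 @^-1` `]-oo, a2[%classic `&`
    (W3 @^-1` `]-oo, a3[%classic `&` W4 @^-1` `]-oo, a4[%classic))) =
  (q `]-oo, a1[%classic * (q `]-oo, a2[%classic *
    (q `]-oo, a3[%classic * q `]-oo, a4[%classic)))%:E.
Proof.
set S := (X in P X).
have mS : measurable S by repeat (apply: measurableI); exact: mpre.
rewrite -[LHS]fineK ?fin_num_measure// -expect_indic// -joint_rays; congr EFin.
apply: eq_Rintegral => w _; have Em (A B : set T) : \1_(A `&` B) w = \1_A w * \1_B w :> R.
  by rewrite !indicE in_setI -natrM mulnb.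
have E W a : \1_(W @^-1` `]-oo, a[%classic) w = ray a W w :> R.
  by rewrite /ray !indicE; congr (_%:R); apply/idP/idP; rewrite !inE.
by rewrite /S !Em !E !mulrA.
Qed.

(** The rays are now replaced by measurable sets one coordinate at a time, by
    uniqueness of measures, the other three events being kept as the set [D] of
    [law_from_rays]. *)
Let sets1 A1 (a2 a3 a4 : R) : measurable A1 ->
  P (W1 @^-1` A1 `&` (W2 @^-1` `]-oo, a2[%classic `&`
    (W3 @^-1` `]-oo, a3[%classic `&` W4 @^-1` `]-oo, a4[%classic))) =
  (q A1 * (q `]-oo, a2[%classic *
    (q `]-oo, a3[%classic * q `]-oo, a4[%classic)))%:E.
Proof.
move=> mA1; rewrite mulrC EFinM -qE//; apply: law_from_rays => //.
- by repeat (apply: measurableI); exact: mpre.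
- by rewrite !mulr_ge0.
- by move=> a; rewrite sets0 qE// -EFinM mulrC.
Qed.

Let sets2 A1 A2 (a3 a4 : R) : measurable A1 -> measurable A2 ->
  P (W1 @^-1` A1 `&` (W2 @^-1` A2 `&`
    (W3 @^-1` `]-oo, a3[%classic `&` W4 @^-1` `]-oo, a4[%classic))) =
  (q A1 * (q A2 * (q `]-oo, a3[%classic * q `]-oo, a4[%classic)))%:E.
Proof.
move=> mA1 mA2; rewrite setICA mulrCA mulrC EFinM -qE//; apply: law_from_rays => //.
- by repeat (apply: measurableI); exact: mpre.
- by rewrite !mulr_ge0.
- by move=> a; rewrite setICA sets1// qE// -EFinM; congr EFin; ring.
Qed.

Let sets3 A1 A2 A3 (a4 : R) : measurable A1 -> measurable A2 -> measurable A3 ->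
  P (W3 @^-1` A3 `&` (W1 @^-1` A1 `&` (W2 @^-1` A2 `&`
     W4 @^-1` `]-oo, a4[%classic))) =
  (q A3 * (q A1 * (q A2 * q `]-oo, a4[%classic)))%:E.
Proof.
move=> mA1 mA2 mA3; rewrite mulrC EFinM -qE//; apply: law_from_rays => //.
- by repeat (apply: measurableI); exact: mpre.
- by rewrite !mulr_ge0.
- move=> a; have := sets2 a a4 mA1 mA2.
  rewrite (setICA (W2 @^-1` A2)) (setICA (W1 @^-1` A1)) => ->.
  by rewrite qE// -EFinM; congr EFin; ring.
Qed.

Let sets4 A1 A2 A3 A4 : measurable A1 -> measurable A2 -> measurable A3 -> measurable A4 ->
  P (W1 @^-1` A1 `&` (W2 @^-1` A2 `&` (W3 @^-1` A3 `&` W4 @^-1` A4))) =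
  ((q A3 * q A4)%:E * (N A1 * N A2))%E.
Proof.
move=> mA1 mA2 mA3 mA4.
have -> : W1 @^-1` A1 `&` (W2 @^-1` A2 `&` (W3 @^-1` A3 `&` W4 @^-1` A4)) =
    W4 @^-1` A4 `&` (W3 @^-1` A3 `&` (W1 @^-1` A1 `&` W2 @^-1` A2)).
  by rewrite setIA setIC -setIA setICA.
have -> : ((q A3 * q A4)%:E * (N A1 * N A2))%E = ((q A3 * (q A1 * q A2))%:E * N A4)%E.
  by rewrite !qE// -!EFinM; congr EFin; ring.
apply: law_from_rays => //.
- by repeat (apply: measurableI); exact: mpre.
- by rewrite !mulr_ge0.
- move=> a; rewrite qE// -EFinM setIC -!setIA sets3//.
  by congr EFin; ring.
Qed.

Lemma standard_gaussian_law X : measurable X ->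
  P ((fun w => ((W1 w, W2 w), (W3 w, W4 w))) @^-1` X) = N4 X.
Proof.
move=> mX.
have m12 : measurable_fun setT (fun w => (W1 w, W2 w)) by exact: measurable_fun_pair.
have m34 : measurable_fun setT (fun w => (W3 w, W4 w)) by exact: measurable_fun_pair.
have H12 A3 A4 Z : measurable A3 -> measurable A4 -> measurable Z ->
    P ((fun w => (W1 w, W2 w)) @^-1` Z `&` (W3 @^-1` A3 `&` W4 @^-1` A4)) =
    ((q A3 * q A4)%:E * N2 Z)%E.
  move=> mA3 mA4 mZ; apply: (@law_from_rectangles _ _ _ _ N N) => //.
  - by apply: measurableI; exact: mpre.
  - by rewrite mulr_ge0.
  - by move=> A B mA mB; rewrite sets4.
have N2E Z : measurable Z -> N2 Z = (fine (N2 Z))%:E.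
  by move=> mZ; rewrite fineK// fin_num_measure.
have mpre2 (W W' : T -> R) Z : measurable_fun setT W -> measurable_fun setT W' ->
    measurable Z -> measurable ((fun w => (W w, W' w)) @^-1` Z).
  move=> mW mW' mZ; rewrite -[X in measurable X]setTI.
  exact: (measurable_fun_pair mW mW').
have H34 Z1 Z2 : measurable Z1 -> measurable Z2 ->
    P ((fun w => (W3 w, W4 w)) @^-1` Z2 `&` (fun w => (W1 w, W2 w)) @^-1` Z1) =
    ((fine (N2 Z1))%:E * N2 Z2)%E.
  move=> mZ1 mZ2; apply: (@law_from_rectangles _ _ _ _ N N) => //.
  - exact: mpre2.
  - exact: fine_ge0.
  - move=> A B mA mB; rewrite setIA setIC H12// N2E// !qE// -!EFinM.
    by congr EFin; ring.
have := @law_from_rectangles _ _ _ _ N2 N2 (fun w => (W1 w, W2 w)) (fun w => (W3 w, W4 w))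
  setT 1 m12 m34 measurableT ler01.
move=> H; have := H _ X mX; rewrite setIT mul1e; apply.
by move=> A B mA mB; rewrite setIT mul1e setIC H34// -N2E.
Qed.

End gaussian_vector_law.

(** * The density of two correlated Gaussian pairs *)

Ltac msr := repeat first [assumption
  | exact: measurable_cst | exact: measurable_id
  | exact: measurable_fst | exact: measurable_snd
  | apply: measurable_funM | apply: measurable_funB | apply: measurable_funD
  | apply: measurable_funX
  | exact: measurableT_comp measurable_fst measurable_fst
  | exact: measurableT_comp measurable_fst measurable_snd
  | exact: measurableT_comp measurable_snd measurable_fst
  | exact: measurableT_comp measurable_snd measurable_snd].

Section correlated_pairs.
Context (R : realType).
Variables (al be ga de : R).
Local Notation N := (normal_prob 0 1 : probability (measurableTypeR R) R).
Local Notation N2 := (prod_probability N N).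
Local Notation N4 := (prod_probability N2 N2).
Local Notation plane := (measurableTypeR R * measurableTypeR R)%type.

(** The joint characteristic function of two standard Gaussian pairs [(U, V)]
    and [(U', V')] with cross-covariances [al] (of U, U'), [be] (of V, U'),
    [ga] (of U, V') and [de] (of V, V'). *)
Definition gaussian_pairs d (T : measurableType d) (P : probability T R)
    (U V U' V' : T -> R) :=
  (forall a b c e,
    \int[P]_w cos (a * U w + b * V w + c * U' w + e * V' w) =
    expR (- ((a ^+ 2 + b ^+ 2 + c ^+ 2 + e ^+ 2 + 2 * (al * a * c + be * b * c +
                    ga * a * e + de * b * e)) / 2))) /\
  (forall a b c e,
    \int[P]_w sin (a * U w + b * V w + c * U' w + e * V' w) = 0).

(** Conditioning in the order [U, V, U', V']. Given [(U, V)], the variable [U'] is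
    normal with mean [cond_mean3] and deviation [cond_sd3]; given [(U, V, U')],
    [V'] is normal with mean [cond_mean4] and deviation [cond_sd4]. The number
    [resid_cov] is the covariance of [V'] with the standardised residual of [U']. *)
Definition cond_sd3 := Num.sqrt (1 - al ^+ 2 - be ^+ 2).
Definition resid_cov := - (al * ga + be * de) / cond_sd3.
Definition cond_sd4 := Num.sqrt (1 - ga ^+ 2 - de ^+ 2 - resid_cov ^+ 2).

Definition cond_mean3 (z : plane) := al * z.1 + be * z.2.
Definition cond_mean4 (z : plane) (u' : R) := ga * z.1 + de * z.2 + resid_cov * ((u' - cond_mean3 z) / cond_sd3).

(** The density of the two pairs with respect to two independent pairs, as the
    product of the two conditional densities. *)
Definition pair_ratio (x : plane * plane) :=
  normal_ratio (cond_mean3 x.1) cond_sd3 x.2.1 * normal_ratio (cond_mean4 x.1 x.2.1) cond_sd4 x.2.2.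

Hypotheses (s3_gt0 : 0 < cond_sd3) (s4_gt0 : 0 < cond_sd4).

Let s3E : cond_sd3 ^+ 2 = 1 - al ^+ 2 - be ^+ 2.
Proof. by rewrite sqr_sqrtr// ltW// -sqrtr_gt0. Qed.

Let s4E : cond_sd4 ^+ 2 = 1 - ga ^+ 2 - de ^+ 2 - resid_cov ^+ 2.
Proof. by rewrite sqr_sqrtr// ltW// -sqrtr_gt0. Qed.

Let s3eps : cond_sd3 * resid_cov = - (al * ga + be * de).
Proof. by rewrite /resid_cov mulrC divfK// gt_eqF. Qed.

Lemma measurable_normal_ratio3 d (T : measurableType d) (m x : T -> R) (s : R) :
  measurable_fun setT m -> measurable_fun setT x ->
  measurable_fun setT (fun t => normal_ratio (m t) s (x t)).
Proof.
move=> mm mx; apply: measurable_funM => //; apply: measurableT_comp => //.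
by msr.
Qed.

Lemma measurable_pair_ratio : measurable_fun setT pair_ratio.
Proof.
have mu' : measurable_fun setT (fun x : plane * plane => x.2.1 : R).
  exact: measurableT_comp measurable_fst measurable_snd.
have mv' : measurable_fun setT (fun x : plane * plane => x.2.2 : R).
  exact: measurableT_comp measurable_snd measurable_snd.
have mu : measurable_fun setT (fun x : plane * plane => x.1.1 : R).
  exact: measurableT_comp measurable_fst measurable_fst.
have mv : measurable_fun setT (fun x : plane * plane => x.1.2 : R).
  exact: measurableT_comp measurable_snd measurable_fst.
by apply: measurable_funM; apply: measurable_normal_ratio3; rewrite /cond_mean4 /cond_mean3; msr.
Qed.

Lemma pair_ratio_ge0 x : 0 <= pair_ratio x.
Proof. by rewrite mulr_ge0 ?normal_ratio_ge0. Qed.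

Context d (T : measurableType d) (P : probability T R) (U V U' V' : T -> R).
Hypotheses (mU : measurable_fun setT U) (mV : measurable_fun setT V)
  (mU' : measurable_fun setT U') (mV' : measurable_fun setT V').
Hypothesis (HG : gaussian_pairs P U V U' V').

Let W3 w := (U' w - cond_mean3 (U w, V w)) / cond_sd3.
Let W4 w := (V' w - ga * U w - de * V w - resid_cov * W3 w) / cond_sd4.

Let mW3 : measurable_fun setT W3.
Proof. by rewrite /W3 /cond_mean3/=; msr. Qed.

Let mW4 : measurable_fun setT W4.
Proof. by rewrite /W4; msr. Qed.

(** The quadratic form of the correlation matrix becomes a sum of squares in the
    coordinates [U, V, W3, W4]. *)
Let WE t1 t2 t3 t4 : let e := t4 / cond_sd4 in let c := (t3 - resid_cov * e) / cond_sd3 in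
  let a := t1 - al * c - ga * e in let b := t2 - be * c - de * e in
  (forall w, t1 * U w + (t2 * V w + (t3 * W3 w + t4 * W4 w)) =
     a * U w + b * V w + c * U' w + e * V' w) /\
  a ^+ 2 + b ^+ 2 + c ^+ 2 + e ^+ 2 + 2 * (al * a * c + be * b * c +
                    ga * a * e + de * b * e) = t1 ^+ 2 + t2 ^+ 2 + t3 ^+ 2 + t4 ^+ 2.
Proof.
move=> e c a b; split=> [w|].
  rewrite /W4 /W3 /cond_mean3 /a /b /c /e/=; field.
  by rewrite !gt_eqF.
have ec : c * cond_sd3 = t3 - resid_cov * e by rewrite /c divfK// gt_eqF.
have ee : e * cond_sd4 = t4 by rewrite /e divfK// gt_eqF.
transitivity ((a + al * c + ga * e) ^+ 2 + (b + be * c + de * e) ^+ 2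
   + c ^+ 2 * (1 - al ^+ 2 - be ^+ 2) + e ^+ 2 * (1 - ga ^+ 2 - de ^+ 2)
   + 2 * c * e * - (al * ga + be * de)); first by ring.
rewrite -s3E (_ : 1 - ga ^+ 2 - de ^+ 2 = cond_sd4 ^+ 2 + resid_cov ^+ 2); last by rewrite s4E; ring.
rewrite -s3eps -ee (_ : t3 = c * cond_sd3 + resid_cov * e); last by rewrite ec; ring.
by rewrite /a /b; ring.
Qed.

Let law X : measurable X ->
  P ((fun w => ((U w, V w), (W3 w, W4 w))) @^-1` X) = N4 X.
Proof.
have [Hc Hs] := HG.
apply: standard_gaussian_law => // t1 t2 t3 t4; have [E1 E2] := WE t1 t2 t3 t4.
  under eq_Rintegral do rewrite E1.
  by rewrite Hc E2 -!expRD; congr expR; field.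
by under eq_Rintegral do rewrite E1; rewrite Hs.
Qed.

(** [U'] and [V'] are standardised given the preceding variables: the residuals
    [W3], [W4] together with [U], [V] form a standard Gaussian vector. Integrating
    over [W4] and then over [W3], each affine change of variable contributes one
    factor of [pair_ratio]. *)
Lemma pair_density (f g : plane -> R) :
  measurable_fun setT f -> measurable_fun setT g ->
  (forall z, 0 <= f z) -> (forall z, 0 <= g z) ->
  (\int[P]_w (f (U w, V w) * g (U' w, V' w))%:E =
   \int[N4]_x (f x.1 * g x.2 * pair_ratio x)%:E)%E.
Proof.
move=> mf mg f0 g0.
pose g' (z w : plane) := g (cond_mean3 z + cond_sd3 * w.1, ga * z.1 + de * z.2 + resid_cov * w.1 + cond_sd4 * w.2).
pose F (x : plane * plane) := f x.1 * g' x.1 x.2.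
have F0 x : 0 <= F x by apply: mulr_ge0; [exact: f0|exact: g0].
have mg' : measurable_fun setT (fun x => g' x.1 x.2).
  apply: measurableT_comp mg _.
  by apply: measurable_fun_pair; rewrite /cond_mean3; msr.
have mF : measurable_fun setT F.
  by apply: measurable_funM => //; exact: measurableT_comp mf measurable_fst.
have R0 x : 0 <= f x.1 * g x.2 * pair_ratio x.
  exact: (mulr_ge0 (mulr_ge0 (f0 _) (g0 _)) (pair_ratio_ge0 x)).
have H0' z w : 0 <= f z * g w * normal_ratio (cond_mean4 z w.1) cond_sd4 w.2.
  exact: (mulr_ge0 (mulr_ge0 (f0 _) (g0 _)) (normal_ratio_ge0 _ _ s4_gt0)).
have mR : measurable_fun setT (fun x => f x.1 * g x.2 * pair_ratio x).
  apply: measurable_funM; last exact: measurable_pair_ratio.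
  by apply: measurable_funM;
    [exact: measurableT_comp mf measurable_fst|exact: measurableT_comp mg measurable_snd].
pose Wm w := ((U w, V w), (W3 w, W4 w)) : plane * plane.
have mWm : measurable_fun setT Wm.
  by apply: measurable_fun_pair; exact: measurable_fun_pair.
transitivity (\int[P]_w (F (Wm w))%:E)%E.
  apply: eq_integral => w _; congr EFin; rewrite /F /Wm /g'/=; congr (_ * g (_, _)).
    by rewrite /W3; field; rewrite gt_eqF.
  by rewrite /W4; field; rewrite gt_eqF.
transitivity (\int[N4]_x (F x)%:E)%E.
  rewrite -(@ge0_integral_pushforward _ _ _ _ R Wm mWm P setT (fun x => (F x)%:E))//; first last.
  - by move=> x _; rewrite lee_fin; exact: F0.
  - exact/measurable_EFinP.
  - by apply: eq_measure_integral => A mA _; exact: law.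
rewrite /prod_probability fubini_tonelli1; last 2 first.
- exact/measurable_EFinP.
- by move=> x; rewrite lee_fin; exact: F0.
rewrite [RHS]fubini_tonelli1; last 2 first.
- exact/measurable_EFinP.
- by move=> x; rewrite lee_fin; exact: R0.
apply: eq_integral => z _; rewrite /fubini_F.
rewrite fubini_tonelli1; last 2 first.
- by apply/measurable_EFinP; exact: measurableT_comp mF (pair1_measurable z).
- by move=> w; rewrite lee_fin; exact: F0.
rewrite [RHS]fubini_tonelli1; last 2 first.
- by apply/measurable_EFinP; exact: measurableT_comp mR (pair1_measurable z).
- by move=> w; rewrite lee_fin; exact: R0.
rewrite /fubini_F/=.
pose H (u' : R) := (\int[N]_v' (f z * g (u', v') * normal_ratio (cond_mean4 z u') cond_sd4 v')%:E)%E.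
have H0 u' : (0 <= H u')%E.
  by apply: integral_ge0 => v' _; rewrite lee_fin; exact: (H0' z (u', v')).
have mh : measurable_fun setT
    (fun w : plane => f z * g w * normal_ratio (cond_mean4 z w.1) cond_sd4 w.2).
  apply: measurable_funM; first by apply: measurable_funM.
  by apply: measurable_normal_ratio3; rewrite /cond_mean4; msr.
have mH : measurable_fun setT H.
  apply: (measurable_fun_fubini_tonelli_F
    (fun w : plane => (f z * g w * normal_ratio (cond_mean4 z w.1) cond_sd4 w.2)%:E)).
    by apply/measurable_EFinP.
  by move=> w; rewrite lee_fin; exact: H0'.
have mg1 u' : measurable_fun setT (fun v' : measurableTypeR R => g (u', v')).
  exact: measurableT_comp mg (pair1_measurable u').
transitivity (\int[N]_w H (cond_mean3 z + cond_sd3 * w)%R)%E.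
  apply: eq_integral => w3 _; rewrite /H.
  have -> : cond_mean4 z (cond_mean3 z + cond_sd3 * w3) = ga * z.1 + de * z.2 + resid_cov * w3.
    by rewrite /cond_mean4; congr (_ + resid_cov * _); field; rewrite gt_eqF.
  have := @ge0_integral_normal_ratio R (ga * z.1 + de * z.2 + resid_cov * w3) cond_sd4
    (fun v' => (f z * g (cond_mean3 z + cond_sd3 * w3, v'))%:E) s4_gt0.
  move=> -> //; last 2 first.
  - by apply/measurable_EFinP; apply: measurable_funM => //; exact: mg1.
  - by move=> v'; rewrite lee_fin mulr_ge0.
rewrite (ge0_integral_normal_ratio (cond_mean3 z) s3_gt0 mH H0).
apply: eq_integral => u' _; rewrite /H -ge0_integralZr//; last 3 first.
- by apply/measurable_EFinP; exact: measurableT_comp mh (pair1_measurable u').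
- by move=> v' _; rewrite lee_fin; exact: (H0' z (u', v')).
- by rewrite lee_fin normal_ratio_ge0.
by apply: eq_integral => v' _; rewrite -EFinM /pair_ratio/=; congr EFin; ring.
Qed.

End correlated_pairs.

(** * Second-order expansion under the integral sign *)

Lemma Rdominated_cvg_near d (T : measurableType d) (R : realType)
    (mu : {measure set T -> \bar R}) (f_ : nat -> T -> R) (f g : T -> R) :
  (forall n, measurable_fun setT (f_ n)) ->
  (forall x, f_ n x @[n --> \oo] --> f x) ->
  mu.-integrable setT (EFin \o g) ->
  (\forall n \near \oo, forall x, `|f_ n x| <= g x) ->
  \int[mu]_x f_ n x @[n --> \oo] --> \int[mu]_x f x.
Proof.
move=> mf ff ig [N _ HN]; rewrite -(cvg_shiftn N).
apply: (Rdominated_cvg _ _ ig) => [n|x|n x]; first exact: mf.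
  by rewrite (cvg_shiftn N (fun n => f_ n x)).
by apply: HN => /=; exact: leq_addl.
Qed.

Section exponential_expansion.
Context (R : realType).

Lemma expRm1_le (y : R) : y <= expR y - 1 <= y * expR y.
Proof.
have h1 := expR_ge1Dx y; have h2 := expR_ge1Dx (- y).
apply/andP; split; first by lra.
have : (1 - y) * expR y <= 1.
  rewrite -[leRHS](_ : expR (- y) * expR y = 1); last by rewrite -expRD addNr expR0.
  by rewrite ler_wpM2r ?expR_ge0.
by rewrite mulrBl mul1r; lra.
Qed.

Lemma norm_expRm1_le (y : R) : `|expR y - 1| <= `|y| * expR `|y|.
Proof.
have /andP[h1 h2] := expRm1_le y.
have e1 : 1 <= expR `|y| by rewrite -expR0 ler_expR.
have e2 : expR y <= expR `|y| by rewrite ler_expR ler_norm.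
have [y0|y0] := leP 0 y.
  by rewrite ger0_norm; [rewrite (ger0_norm y0) in e2 *|lra].
rewrite ler0_norm; last by apply: le_trans h2 _; rewrite nmulr_rle0 ?expR_ge0.
rewrite (ltr0_norm y0) in e1 *; nra.
Qed.

Lemma cvg_expRm1 (k y : nat -> R) (l : R) : (forall n, 0 < k n) ->
  k n @[n --> \oo] --> 0 -> y n / k n @[n --> \oo] --> l ->
  (expR (y n) - 1) / k n @[n --> \oo] --> l.
Proof.
move=> k0 kcv ycv.
have y0 : y n @[n --> \oo] --> 0.
  rewrite (_ : y = fun n => k n * (y n / k n)); last first.
    by apply/funext => n; rewrite mulrC divfK// gt_eqF.
  by rewrite -(mul0r l); exact: cvgM.
have ey : expR (y n) @[n --> \oo] --> (1 : R).
  by rewrite -[X in _ --> X]expR0; apply: continuous_cvg => //; exact: continuous_expR.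
apply: (@squeeze_cvgr _ _ _ _ (fun n => y n / k n) (fun n => y n / k n * expR (y n))).
- apply: nearW => n; have /andP[h1 h2] := expRm1_le (y n).
  by rewrite ler_pM2r ?invr_gt0// h1/= mulrAC ler_pM2r ?invr_gt0.
- exact: ycv.
- by rewrite -[X in _ --> X]mulr1; exact: cvgM.
Qed.

(** This is [cosh B - 1], written as a square divided by 2 so that its sign and
    its order at zero are visible. *)
Definition coshm1 (B : R) := (expR (B / 2) - expR (- (B / 2))) ^+ 2 / 2.

(** The average over the sign of [B] leaves no term linear in [B]. *)
Lemma coshm1E (D B : R) : (expR (D + B) + expR (D - B)) / 2 - 1 =
  expR D * coshm1 B + (expR D - 1).
Proof.
have e1 : expR (B / 2) * expR (- (B / 2)) = 1 by rewrite -expRD subrr expR0.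
have e2 : expR B = expR (B / 2) ^+ 2 by rewrite expr2 -expRD; congr expR; field.
have e3 : expR (- B) = expR (- (B / 2)) ^+ 2 by rewrite expr2 -expRD; congr expR; field.
rewrite !expRD e2 e3 /coshm1.
rewrite (_ : (expR (B / 2) - expR (- (B / 2))) ^+ 2 =
  expR (B / 2) ^+ 2 + expR (- (B / 2)) ^+ 2 - 2 * (expR (B / 2) * expR (- (B / 2)))).
  by rewrite e1; field.
by ring.
Qed.

Let sinhE (B : R) : expR (B / 2) - expR (- (B / 2)) = expR (- (B / 2)) * (expR B - 1).
Proof.
rewrite mulrBr mulr1 -expRD; congr (expR _ - _); by field.
Qed.

Lemma coshm1_ge0 B : 0 <= coshm1 B.
Proof. by rewrite divr_ge0// sqr_ge0. Qed.

Lemma coshm1_le B : coshm1 B <= B ^+ 2 * expR (3 * `|B|).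
Proof.
rewrite /coshm1 sinhE exprMn.
have h : (expR B - 1) ^+ 2 <= B ^+ 2 * expR (2 * `|B|).
  rewrite -[leLHS]real_normK ?num_real// -[B ^+ 2]real_normK ?num_real//.
  rewrite (_ : expR (2 * `|B|) = expR `|B| ^+ 2); last first.
    by rewrite expr2 -expRD; congr expR; ring.
  by rewrite -exprMn ler_pXn2r ?nnegrE ?mulr_ge0 ?expR_ge0// norm_expRm1_le.
have g : expR (- (B / 2)) ^+ 2 <= expR `|B|.
  rewrite expr2 -expRD ler_expR.
  by have := ler_norm (- B); rewrite normrN; lra.
apply: (@le_trans _ _ (expR `|B| * (B ^+ 2 * expR (2 * `|B|)))).
  apply: (@le_trans _ _ (expR (- (B / 2)) ^+ 2 * (expR B - 1) ^+ 2)).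
    by have := mulr_ge0 (sqr_ge0 (expR (- (B / 2)))) (sqr_ge0 (expR B - 1)); lra.
  by rewrite ler_pM ?sqr_ge0.
by rewrite mulrCA -expRD ler_wpM2l ?sqr_ge0// ler_expR; lra.
Qed.

Lemma cvg_coshm1 (k b : nat -> R) (l : R) : (forall n, 0 < k n) ->
  k n @[n --> \oo] --> 0 -> b n @[n --> \oo] --> l ->
  coshm1 (k n * b n) / k n ^+ 2 @[n --> \oo] --> l ^+ 2 / 2.
Proof.
move=> k0 kcv bcv.
have B0 : k n * b n @[n --> \oo] --> 0 by rewrite -(mul0r l); exact: cvgM.
have h1 : (expR (k n * b n) - 1) / k n @[n --> \oo] --> l.
  apply: cvg_expRm1 => //; rewrite (_ : (fun n => _) = b)//.
  by apply/funext => n; rewrite mulrAC divff ?mul1r// gt_eqF.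
have h2 : expR (- (k n * b n / 2)) @[n --> \oo] --> (1 : R).
  rewrite -[X in _ --> X]expR0; apply: continuous_cvg; first exact: continuous_expR.
  rewrite -[X in _ --> X]oppr0 -[X in _ --> - X](mul0r 2^-1).
  by apply: cvgN; apply: cvgM => //; exact: cvg_cst.
have h : expR (- (k n * b n / 2)) * ((expR (k n * b n) - 1) / k n) @[n --> \oo] --> l.
  by rewrite -[X in _ --> X]mul1r; exact: cvgM.
rewrite (_ : (fun n => _) = fun n => (expR (- (k n * b n / 2)) * ((expR (k n * b n) - 1) / k n)) ^+ 2 / 2); last first.
  apply/funext => n; rewrite /coshm1 sinhE !exprMn exprVn; field.
  by rewrite gt_eqF.
by apply: cvgM; [rewrite expr2; under eq_fun do rewrite expr2; exact: cvgM|exact: cvg_cst].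
Qed.

Context d (X : measurableType d) (Q : probability X R).
Variables (S : X -> R) (k : nat -> R) (b d_ : nat -> X -> R) (binf dinf : X -> R) (C : R).
Hypotheses (S1 : forall x, 1 <= S x)
  (iS : Q.-integrable setT (EFin \o (fun x => expR (S x / 8))))
  (k0 : forall n, 0 < k n) (kcv : k n @[n --> \oo] --> 0)
  (mb : forall n, measurable_fun setT (b n)) (md : forall n, measurable_fun setT (d_ n))
  (bC : forall n x, `|b n x| <= C * S x) (dC : forall n x, `|d_ n x| <= C * S x)
  (bcv : forall x, b n x @[n --> \oo] --> binf x)
  (dcv : forall x, d_ n x @[n --> \oo] --> dinf x).

Let rem n x := ((expR (k n ^+ 2 * d_ n x + k n * b n x) +
     expR (k n ^+ 2 * d_ n x - k n * b n x)) / 2 - 1) / k n ^+ 2.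

Let C0 (x : X) : 0 <= C.
Proof.
have := le_trans (normr_ge0 _) (bC 0%N x).
by rewrite pmulr_lge0// (lt_le_trans _ (S1 x)).
Qed.

Let rem_cvg x : rem n x @[n --> \oo] --> dinf x + binf x ^+ 2 / 2.
Proof.
have k20 n : 0 < k n ^+ 2 by rewrite exprn_gt0.
have k2cv : k n ^+ 2 @[n --> \oo] --> 0.
  by rewrite -(mul0r 0); under eq_fun do rewrite expr2; exact: cvgM.
have D0 : k n ^+ 2 * d_ n x @[n --> \oo] --> 0 by rewrite -(mul0r (dinf x)); exact: cvgM.
have eD : expR (k n ^+ 2 * d_ n x) @[n --> \oo] --> (1 : R).
  by rewrite -[X in _ --> X]expR0; apply: continuous_cvg => //; exact: continuous_expR.
rewrite (_ : (fun n => _) = fun n => expR (k n ^+ 2 * d_ n x) * (coshm1 (k n * b n x) / k n ^+ 2)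
   + (expR (k n ^+ 2 * d_ n x) - 1) / k n ^+ 2); last first.
  by apply/funext => n; rewrite /rem coshm1E mulrDl mulrA.
rewrite addrC -[binf x ^+ 2 / 2]mul1r; apply: cvgD.
  by apply: cvgM => //; exact: cvg_coshm1.
apply: cvg_expRm1 => //; rewrite (_ : (fun n => _) = d_ ^~ x)//.
by apply/funext => n; rewrite mulrAC divff ?mul1r// gt_eqF.
Qed.

(** Each of [|k b|] and [|k^2 d|] is at most [S / 64]: the exponentials of [D] and of
    [3 |B|] then multiply to [exp (S / 16)]. *)
Let rem_bound n x : k n <= 1 -> k n * C <= 1 / 64 ->
  `|rem n x| <= (C ^+ 2 + C) * 1024 * expR (S x / 8).
Proof.
move=> kn1 knC.
have S0 : 0 <= S x by rewrite (le_trans _ (S1 x)).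
have CS0 : 0 <= C * S x by rewrite mulr_ge0 ?(C0 x).
have k20 : 0 < k n ^+ 2 by rewrite exprn_gt0.
have kb : `|k n * b n x| <= S x / 64.
  rewrite normrM gtr0_norm//; apply: (@le_trans _ _ (k n * (C * S x))).
    by rewrite ler_pM2l.
  by rewrite mulrA [leRHS]mulrC ler_wpM2r//; lra.
have kd : `|k n ^+ 2 * d_ n x| <= S x / 64.
  rewrite normrM gtr0_norm//; apply: (@le_trans _ _ (k n * (C * S x))).
    apply: ler_pM => //; first exact: ltW.
    by rewrite expr2 ler_piMr// ltW.
  by rewrite mulrA [leRHS]mulrC ler_wpM2r//; lra.
(* From [y <= 32 exp (y / 32)]: a square of [S] costs the constant 32^2 and half of
   the exponent [S / 8] available for the domination. *)
have S2 : S x ^+ 2 <= 1024 * expR (S x / 16).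
  rewrite (_ : expR (S x / 16) = expR (S x / 32) ^+ 2); last first.
    by rewrite expr2 -expRD; congr expR; field.
  rewrite (_ : 1024 = 32 ^+ 2); last by ring.
  rewrite -exprMn ler_pXn2r ?nnegrE ?mulr_ge0 ?expR_ge0//.
  by have := expR_ge1Dx (S x / 32); lra.
have eD : expR (k n ^+ 2 * d_ n x) <= expR (S x / 64).
  by rewrite ler_expR (le_trans (ler_norm _)).
rewrite /rem coshm1E mulrDl; apply: le_trans (ler_normD _ _) _.
rewrite (_ : (C ^+ 2 + C) * 1024 * expR (S x / 8) = C ^+ 2 * (1024 * expR (S x / 8)) + C * (1024 * expR (S x / 8))); last by ring.
have e8 : 1024 * expR (S x / 8) = 1024 * expR (S x / 16) * expR (S x / 16).
  by rewrite -mulrA -expRD; congr (_ * expR _); field.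
apply: lerD.
  rewrite ger0_norm; last first.
    exact: (divr_ge0 (mulr_ge0 (expR_ge0 _) (coshm1_ge0 _)) (ltW k20)).
  rewrite ler_pdivrMr//.
  apply: (@le_trans _ _ (expR (S x / 64) * ((k n * (C * S x)) ^+ 2 * expR (3 * (S x / 64))))).
    apply: ler_pM => //; first exact: coshm1_ge0.
    apply: le_trans (coshm1_le _) _; apply: ler_pM; [exact: sqr_ge0|exact: expR_ge0| |].
      rewrite -real_normK ?num_real// ler_pXn2r ?nnegrE ?mulr_ge0 ?(C0 x) ?(ltW (k0 n))//.
      by rewrite normrM gtr0_norm// ler_pM2l.
    by rewrite ler_expR ler_pM2l.
  rewrite mulrCA -expRD (_ : S x / 64 + 3 * (S x / 64) = S x / 16); last by field.
  rewrite e8 -subr_ge0.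
  rewrite (_ : _ - _ = C ^+ 2 * k n ^+ 2 * expR (S x / 16) *
    (1024 * expR (S x / 16) - S x ^+ 2)); last by ring.
  apply: mulr_ge0; last by rewrite subr_ge0.
  by apply: mulr_ge0; [rewrite mulr_ge0 ?sqr_ge0|exact: expR_ge0].
rewrite normrM [X in _ * X]gtr0_norm ?invr_gt0// ler_pdivrMr//.
apply: le_trans (norm_expRm1_le _) _.
apply: (@le_trans _ _ (k n ^+ 2 * (C * S x) * expR (S x / 16))).
  apply: ler_pM => //.
    by rewrite normrM gtr0_norm// ler_pM2l.
  by rewrite ler_expR (le_trans kd)//; lra.
rewrite e8 -subr_ge0.
rewrite (_ : _ - _ = k n ^+ 2 * C * expR (S x / 16) *
  (1024 * expR (S x / 16) - S x)); last by ring.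
apply: mulr_ge0.
  by apply: mulr_ge0; [rewrite mulr_ge0 ?(ltW k20) ?(C0 x)|exact: expR_ge0].
by rewrite subr_ge0; apply: le_trans S2; rewrite expr2 ler_peMr.
Qed.

Let mrem n : measurable_fun setT (rem n).
Proof.
have mE s : measurable_fun setT (fun x => expR (k n ^+ 2 * d_ n x + s * b n x)).
  apply: measurableT_comp => //; apply: measurable_funD; exact: measurable_funM.
apply: measurable_funM => //; apply: measurable_funB => //.
apply: measurable_funM => //; apply: measurable_funD; first exact: mE.
by under eq_fun do rewrite -mulNr; exact: mE.
Qed.

(** With [B = k b] and [D = k^2 d], the average of [exp (D + B)] and [exp (D - B)]
    is [1 + k^2 (d + b^2 / 2)] to second order. [S] bounds the quadratic forms [b]
    and [d] and has a finite exponential moment, which provides the dominating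
    function once [k] is small. *)
Lemma cvg_exponential_expansion (phi : X -> R) : bmfun phi ->
  \int[Q]_x (phi x * rem n x) @[n --> \oo] -->
  \int[Q]_x (phi x * (dinf x + binf x ^+ 2 / 2)).
Proof.
move=> [mphi [c phic]].
pose g x := (`|c| * ((C ^+ 2 + C) * 1024)) * expR (S x / 8).
apply: (@Rdominated_cvg_near _ _ _ Q _ _ g).
- by move=> n; exact: measurable_funM.
- by move=> x; apply: cvgM; [exact: cvg_cst|exact: rem_cvg].
- have := integrableZl measurableT (`|c| * ((C ^+ 2 + C) * 1024)) iS.
  by apply: eq_integrable.
- have kC : k n * C @[n --> \oo] --> 0 by rewrite -(mul0r C); apply: cvgM => //; exact: cvg_cst.
  near=> n => x; rewrite normrM /g -mulrA; apply: ler_pM => //.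
    by rewrite (le_trans (phic x))// ler_norm.
  apply: rem_bound.
    by near: n; apply: (cvgr_le _ kcv); exact: ltr01.
  by near: n; apply: (cvgr_le _ kC); lra.
Unshelve. all: by end_near. Qed.

End exponential_expansion.

(** * Expansion of the density for small correlations *)

Section integrable_products.
Context d1 d2 (T1 : measurableType d1) (T2 : measurableType d2) (R : realType).
Variables (P1 : probability T1 R) (P2 : probability T2 R) (F : T1 -> R) (G : T2 -> R).
Hypotheses (iF : P1.-integrable setT (EFin \o F)) (iG : P2.-integrable setT (EFin \o G)).

Lemma integrable_prod_probability :
  (prod_probability P1 P2).-integrable setT (EFin \o (fun x => F x.1 * G x.2)).
Proof.
have [/measurable_EFinP mF Foo] := integrableP _ _ _ iF.
have [/measurable_EFinP mG Goo] := integrableP _ _ _ iG.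
have mFG : measurable_fun setT (EFin \o (fun x : T1 * T2 => F x.1 * G x.2)).
  by apply/measurable_EFinP; apply: measurable_funM;
    [exact: measurableT_comp mF measurable_fst|exact: measurableT_comp mG measurable_snd].
apply/(@integrable12ltyP _ _ _ _ _ P1 P2 _ mFG).
under eq_integral => x _.
  under eq_integral do rewrite /= normrM EFinM.
  rewrite ge0_integralZl//; last first.
    by apply/measurable_EFinP; exact: measurableT_comp.
  over.
rewrite /= ge0_integralZr//.
- by apply: lte_mul_pinfty => //; [exact: integral_ge0|rewrite ge0_fin_numE// integral_ge0].
- by apply/measurable_EFinP; exact: measurableT_comp.
- exact: integral_ge0.
Qed.

Lemma Rintegral_prod_probabilityM :
  \int[prod_probability P1 P2]_x (F x.1 * G x.2) = \int[P1]_x F x * \int[P2]_y G y.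
Proof.
rewrite /Rintegral -[RHS]fineM; [|exact: integrable_fin_num iF|exact: integrable_fin_num iG].
congr fine; rewrite -(integral12_prod_meas1 integrable_prod_probability).
rewrite -[X in (_ * X)%E]fineK; last exact: integrable_fin_num iG.
rewrite -integralZr//; apply: eq_integral => x _.
rewrite /fubini_F/=; under eq_integral do rewrite EFinM.
by rewrite integralZl// fineK//; exact: integrable_fin_num iG.
Qed.

End integrable_products.

Lemma cvg_bounded_seq (R : realType) (u : nat -> R) (l : R) :
  u n @[n --> \oo] --> l -> exists M, forall n, `|u n| <= M.
Proof.
move=> /cvgP/cvg_seq_bounded[M [_ HM]]; exists (M + 1) => n.
by apply: HM => //; lra.
Qed.

Section pair_expansion.
Context (R : realType).
Local Notation N := (normal_prob 0 1 : probability (measurableTypeR R) R).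
Local Notation N2 := (prod_probability N N).
Local Notation N4 := (prod_probability N2 N2).
Local Notation plane := (measurableTypeR R * measurableTypeR R)%type.
Variables (al be ga de k : nat -> R) (A : R).
Hypotheses (k0 : forall n, 0 < k n) (kcv : k n @[n --> \oo] --> 0)
  (acv : al n / k n @[n --> \oo] --> A) (bcv : be n / k n @[n --> \oo] --> 0)
  (ccv : ga n / k n @[n --> \oo] --> 0) (ecv : de n / k n @[n --> \oo] --> 0).
Hypotheses (s3p : forall n, 0 < cond_sd3 (al n) (be n))
  (s4p : forall n, 0 < cond_sd4 (al n) (be n) (ga n) (de n)).

(** [a, b, c, e] are the correlations in units of [k]; [v3], [v4] are the conditional
    variances; [T], in units of [k^2], is the coefficient of [U'] in the conditional
    mean of [V'], and [p], [r], in units of [k], are those of [U] and [V]. *)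
Let a n : R := al n / k n.
Let b n : R := be n / k n.
Let c n : R := ga n / k n.
Let e n : R := de n / k n.
Let v3 n : R := cond_sd3 (al n) (be n) ^+ 2.
Let v4 n : R := cond_sd4 (al n) (be n) (ga n) (de n) ^+ 2.
Let T n : R := - (a n * c n + b n * e n) / v3 n.
Let p n : R := c n - T n * k n ^+ 2 * a n.
Let r n : R := e n - T n * k n ^+ 2 * b n.

Let kn0 n : k n != 0. Proof. by rewrite gt_eqF. Qed.
Let v30 n : v3 n != 0. Proof. by rewrite gt_eqF// exprn_gt0. Qed.
Let v40 n : v4 n != 0. Proof. by rewrite gt_eqF// exprn_gt0. Qed.

Let v3E n : v3 n = 1 - k n ^+ 2 * (a n ^+ 2 + b n ^+ 2).
Proof.
rewrite /v3 /cond_sd3 sqr_sqrtr; last by rewrite ltW// -sqrtr_gt0; exact: s3p.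
by rewrite /a /b; field.
Qed.

Let v4E n : v4 n = 1 - k n ^+ 2 * (c n ^+ 2 + e n ^+ 2) - T n ^+ 2 * k n ^+ 4 * v3 n.
Proof.
rewrite /v4 /cond_sd4 sqr_sqrtr; last by rewrite ltW// -sqrtr_gt0; exact: s4p.
rewrite (_ : resid_cov _ _ _ _ ^+ 2 = T n ^+ 2 * k n ^+ 4 * v3 n).
  by rewrite /c /e; field.
have s30 : cond_sd3 (al n) (be n) != 0 by rewrite gt_eqF.
by rewrite /T /v3 /resid_cov /a /b /c /e; field; rewrite s30 kn0.
Qed.

Ltac cv := repeat match goal with
  | |- cvg_to (nbhs (fmap (fun n => GRing.mul _ _) _)) _ => apply: cvgM
  | |- cvg_to (nbhs (fmap (fun n => GRing.add _ _) _)) _ => apply: cvgD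
  | |- cvg_to (nbhs (fmap (fun n => GRing.opp _) _)) _ => apply: cvgN
  | |- cvg_to (nbhs (fmap (fun n => ?c) _)) _ => exact: cvg_cst
  | |- _ => assumption
  end.

Let k2cv : k n ^+ 2 @[n --> \oo] --> (0 : R).
Proof. by rewrite -(mulr0 0); under eq_fun do rewrite expr2; exact: cvgM. Qed.

Let v3cv : v3 n @[n --> \oo] --> (1 : R).
Proof.
have : 1 - k n ^+ 2 * (a n * a n + b n * b n) @[n --> \oo] --> (1 - 0 * (A * A + 0 * 0) : R).
  by cv.
by rewrite mul0r subr0; apply: cvg_trans; apply: near_eq_cvg; apply: nearW => n; rewrite v3E !expr2.
Qed.

Let i3cv : (v3 n)^-1 @[n --> \oo] --> (1 : R).
Proof. by rewrite -[X in _ --> X]invr1; apply: cvgV => //; exact: oner_neq0. Qed.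

Let Tcv : T n @[n --> \oo] --> (0 : R).
Proof.
rewrite (_ : 0 = - (A * 0 + 0 * 0) * 1); last by ring.
by rewrite /T; cv.
Qed.

Let v4cv : v4 n @[n --> \oo] --> (1 : R).
Proof.
have : 1 - k n ^+ 2 * (c n * c n + e n * e n) - T n * T n * (k n ^+ 2 * k n ^+ 2) * v3 n @[n --> \oo] -->
    (1 - 0 * (0 * 0 + 0 * 0) - 0 * 0 * (0 * 0) * 1 : R) by cv.
rewrite !mul0r !subr0; apply: cvg_trans; apply: near_eq_cvg; apply: nearW => n.
by rewrite v4E; ring.
Qed.

Let i4cv : (v4 n)^-1 @[n --> \oo] --> (1 : R).
Proof. by rewrite -[X in _ --> X]invr1; apply: cvgV => //; exact: oner_neq0. Qed.

Let pcv : p n @[n --> \oo] --> (0 : R).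
Proof. by rewrite (_ : 0 = 0 - 0 * 0 * A); [rewrite /p; cv|ring]. Qed.

Let rcv : r n @[n --> \oo] --> (0 : R).
Proof. by rewrite (_ : 0 = 0 - 0 * 0 * 0); [rewrite /r; cv|ring]. Qed.

Let ln_bounds (x : R) : 0 < x -> 1 - x^-1 <= ln x <= x - 1.
Proof.
move=> x0; have := expR_ge1Dx (ln x); have := expR_ge1Dx (- ln x).
by rewrite expRN lnK ?posrE//; lra.
Qed.

(** [1 - 1 / v <= ln v <= v - 1], so [ln v] and [v - 1] are equivalent at [v = 1]. *)
Let cvg_ln (v : nat -> R) (l : R) : (forall n, 0 < v n) -> v n @[n --> \oo] --> (1 : R) ->
  (v n - 1) / k n ^+ 2 @[n --> \oo] --> l -> ln (v n) / k n ^+ 2 @[n --> \oo] --> l.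
Proof.
move=> v0 vcv h.
have k20 n : 0 < k n ^+ 2 by rewrite exprn_gt0.
have icv : (v n)^-1 @[n --> \oo] --> (1 : R).
  by rewrite -[X in _ --> X]invr1; apply: cvgV => //; exact: oner_neq0.
apply: (@squeeze_cvgr _ _ _ _ (fun n => (v n - 1) / k n ^+ 2 * (v n)^-1)
  (fun n => (v n - 1) / k n ^+ 2)) => //.
  apply: nearW => n; have /andP[h1 h2] := ln_bounds (v0 n).
  rewrite ler_pM2r ?invr_gt0// h2 andbT mulrAC ler_pM2r ?invr_gt0//.
  by rewrite mulrBl divff ?gt_eqF// mul1r.
by rewrite -[X in _ --> X]mulr1; exact: cvgM.
Qed.

Let L n : R := (ln (v3 n) + ln (v4 n)) / k n ^+ 2.

Let Lcv : L n @[n --> \oo] --> - A ^+ 2.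
Proof.
rewrite (_ : L = fun n => ln (v3 n) / k n ^+ 2 + ln (v4 n) / k n ^+ 2); last first.
  by apply/funext => n; rewrite /L mulrDl.
rewrite -[X in _ --> X]addr0; apply: cvgD; apply: cvg_ln => //.
- by move=> n; rewrite exprn_gt0.
- have : - (a n * a n + b n * b n) @[n --> \oo] --> (- (A * A + 0 * 0) : R) by cv.
  rewrite mul0r addr0 -expr2; apply: cvg_trans; apply: near_eq_cvg; apply: nearW => n.
  by rewrite v3E; field.
- by move=> n; rewrite exprn_gt0.
- have : - (c n * c n + e n * e n) - T n * T n * k n ^+ 2 * v3 n @[n --> \oo] -->
      (- (0 * 0 + 0 * 0) - 0 * 0 * 0 * 1 : R) by cv.
  rewrite !(mul0r, addr0, oppr0); apply: cvg_trans; apply: near_eq_cvg; apply: nearW => n.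
  by rewrite v4E; field.
Qed.

(** The coefficients of the forms [B] and [D] in [pair_ratio = exp (k^2 D + k B)]. *)
Let b1 n : R := a n / v3 n - p n * (T n * k n ^+ 2) / v4 n.
Let b2 n : R := b n / v3 n - r n * (T n * k n ^+ 2) / v4 n.
Let b3 n : R := p n / v4 n.
Let b4 n : R := r n / v4 n.
Let d0 n : R := - (L n / 2).
Let d1 n : R := - ((a n * a n + b n * b n) / v3 n + T n * T n * k n ^+ 2 / v4 n) / 2.
Let d2 n : R := - (a n * a n / v3 n + p n * p n / v4 n) / 2.
Let d3 n : R := - (a n * b n / v3 n + p n * r n / v4 n).
Let d4 n : R := - (b n * b n / v3 n + r n * r n / v4 n) / 2.
Let d5 n : R := - ((c n * c n + e n * e n + T n * T n * k n ^+ 2 * v3 n) / v4 n) / 2.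
Let d6 n : R := T n / v4 n.

Let B n (x : plane * plane) : R := b1 n * (x.1.1 * x.2.1) + b2 n * (x.1.2 * x.2.1) +
  b3 n * (x.1.1 * x.2.2) + b4 n * (x.1.2 * x.2.2).
Let D n (x : plane * plane) : R := d0 n * 1 + d1 n * (x.2.1 * x.2.1) + d2 n * (x.1.1 * x.1.1) +
  d3 n * (x.1.1 * x.1.2) + d4 n * (x.1.2 * x.1.2) + d5 n * (x.2.2 * x.2.2) +
  d6 n * (x.2.1 * x.2.2).

Let ratioE (s m y : R) : 0 < s -> normal_ratio m s y =
  expR (- (ln (s ^+ 2) / 2) + (y ^+ 2 / 2 - (y - m) ^+ 2 / (2 * s ^+ 2))).
Proof.
move=> s0; rewrite expRD /normal_ratio; congr (_ * _).
have -> : ln (s ^+ 2) / 2 = ln s by rewrite lnXn//; field.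
by rewrite expRN lnK.
Qed.

(** Both conditional densities are exponentials of quadratic forms; the
    normalisations [1 / cond_sd] enter through their logarithms. Separating the
    products of a coordinate of the first pair with one of the second gives [B];
    all else is [D]. The rescaled coefficients converge, which is why [B] and [D]
    carry the prefactors [k] and [k^2]. *)
Lemma pair_ratio_expand n x : pair_ratio (al n) (be n) (ga n) (de n) x =
  expR (k n ^+ 2 * D n x + k n * B n x).
Proof.
rewrite /pair_ratio !ratioE// -expRD; congr expR.
have v3n := v30 n; have v4n := v40 n; have kn := kn0 n.
rewrite -/(v3 n) -/(v4 n).
have s3n : cond_sd3 (al n) (be n) != 0 by rewrite gt_eqF.
have -> : cond_mean4 (al n) (be n) (ga n) (de n) x.1 x.2.1 =
    k n * (p n * x.1.1 + r n * x.1.2) + T n * k n ^+ 2 * x.2.1.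
  rewrite /cond_mean4 /cond_mean3 /p /r /T /v3 /resid_cov /a /b /c /e; field.
  by rewrite s3n kn.
have -> : cond_mean3 (al n) (be n) x.1 = k n * (a n * x.1.1 + b n * x.1.2).
  by rewrite /cond_mean3 /a /b; field.
rewrite /D /B /d0 /L.
(* The pure squares [u'^2] and [v'^2] have to be rewritten by the formulas for
   the conditional variances, since [1 - 1 / v3] alone hides its factor [k^2]. *)
have z3 : v3 n - 1 + k n ^+ 2 * (a n ^+ 2 + b n ^+ 2) = 0.
  by rewrite [X in X - _]v3E; ring.
have z4 : v4 n - 1 + k n ^+ 2 * (c n ^+ 2 + e n ^+ 2) + T n ^+ 2 * k n ^+ 4 * v3 n = 0.
  by rewrite [X in X - _]v4E; ring.
apply/eqP; rewrite -subr_eq0; apply/eqP.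
transitivity (x.2.1 ^+ 2 / 2 * ((v3 n - 1 + k n ^+ 2 * (a n ^+ 2 + b n ^+ 2)) / v3 n) +
  x.2.2 ^+ 2 / 2 * ((v4 n - 1 + k n ^+ 2 * (c n ^+ 2 + e n ^+ 2) +
     T n ^+ 2 * k n ^+ 4 * v3 n) / v4 n)).
  rewrite /b1 /b2 /b3 /b4 /d1 /d2 /d3 /d4 /d5 /d6; field.
  by rewrite v3n v4n kn.
by rewrite z3 z4 !mul0r !mulr0 addr0.
Qed.

(** Reversing all cross-covariances amounts to reversing the sign of the first
    pair; the form [B] is odd and [D] even under this. *)
Lemma pair_ratio_expandN n x :
  pair_ratio (- al n) (- be n) (- ga n) (- de n) x =
  expR (k n ^+ 2 * D n x - k n * B n x).
Proof.
have -> : pair_ratio (- al n) (- be n) (- ga n) (- de n) x =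
    pair_ratio (al n) (be n) (ga n) (de n) ((- x.1.1, - x.1.2), x.2).
  by rewrite /pair_ratio /cond_mean4 /cond_mean3 /cond_sd4 /resid_cov /cond_sd3/= !sqrrN !mulrNN !mulNr !mulrN.
by rewrite pair_ratio_expand /D /B/=; congr expR; ring.
Qed.

Let S (x : plane * plane) : R :=
  1 + x.1.1 ^+ 2 + x.1.2 ^+ 2 + x.2.1 ^+ 2 + x.2.2 ^+ 2.

Let S1 x : 1 <= S x.
Proof.
rewrite /S; have := sqr_ge0 x.1.1; have := sqr_ge0 x.1.2.
by have := sqr_ge0 x.2.1; have := sqr_ge0 x.2.2; lra.
Qed.

Let iS : N4.-integrable setT (EFin \o (fun x => expR (S x / 8))).
Proof.
have i1 : N.-integrable setT (EFin \o (fun y : R => expR (y ^+ 2 / 8))).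
  apply: (@integrable_normal_bound R 1) => [|y].
    by apply: measurableT_comp => //; apply: measurable_funM => //; exact: measurable_funX.
  by rewrite ger0_norm ?expR_ge0// mul1r ler_expR; have := sqr_ge0 y; lra.
have i2 := integrable_prod_probability i1 i1.
have i4 := integrable_prod_probability i2 i2.
have := integrableZl measurableT (expR (1 / 8)) i4.
apply: eq_integrable => // x _; rewrite /= -EFinM -!expRD; congr (expR _)%:E.
by rewrite /S; field.
Qed.

Let mono (M y z : R) (u : nat -> R) n x : (forall n, `|u n| <= M) ->
  2 * `|y * z| <= y ^+ 2 + z ^+ 2 -> y ^+ 2 + z ^+ 2 <= 2 * S x ->
  `|u n * (y * z)| <= M * S x.
Proof.
move=> uM yz yS; rewrite normrM; apply: ler_pM => //; lra.
Qed.

Let yz2 (y z : R) : 2 * `|y * z| <= y ^+ 2 + z ^+ 2.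
Proof.
have [_|_] := ger0P (y * z).
  by have := sqr_ge0 (y - z); rewrite !expr2; lra.
by have := sqr_ge0 (y + z); rewrite !expr2; lra.
Qed.

Let b1cv : b1 n @[n --> \oo] --> A.
Proof. by rewrite (_ : A = A * 1 - 0 * (0 * 0) * 1); [rewrite /b1; cv|ring]. Qed.

Let b2cv : b2 n @[n --> \oo] --> (0 : R).
Proof. by rewrite (_ : 0 = 0 * 1 - 0 * (0 * 0) * 1); [rewrite /b2; cv|ring]. Qed.

Let b3cv : b3 n @[n --> \oo] --> (0 : R).
Proof. by rewrite (_ : 0 = 0 * 1); [rewrite /b3; cv|ring]. Qed.

Let b4cv : b4 n @[n --> \oo] --> (0 : R).
Proof. by rewrite (_ : 0 = 0 * 1); [rewrite /b4; cv|ring]. Qed.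

Let d0cv : d0 n @[n --> \oo] --> A ^+ 2 / 2.
Proof.
by rewrite (_ : A ^+ 2 / 2 = - (- A ^+ 2 * 2^-1)); [rewrite /d0; cv|ring].
Qed.

Let d1cv : d1 n @[n --> \oo] --> - (A ^+ 2) / 2.
Proof.
rewrite (_ : - A ^+ 2 / 2 = - ((A * A + 0 * 0) * 1 + 0 * 0 * 0 * 1) * 2^-1); last by ring.
by rewrite /d1; cv.
Qed.

Let d2cv : d2 n @[n --> \oo] --> - (A ^+ 2) / 2.
Proof.
rewrite (_ : - A ^+ 2 / 2 = - (A * A * 1 + 0 * 0 * 1) * 2^-1); last by ring.
by rewrite /d2; cv.
Qed.

Let d3cv : d3 n @[n --> \oo] --> (0 : R).
Proof. by rewrite (_ : 0 = - (A * 0 * 1 + 0 * 0 * 1)); [rewrite /d3; cv|ring]. Qed.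

Let d4cv : d4 n @[n --> \oo] --> (0 : R).
Proof.
by rewrite (_ : 0 = - (0 * 0 * 1 + 0 * 0 * 1) * 2^-1); [rewrite /d4; cv|ring].
Qed.

Let d5cv : d5 n @[n --> \oo] --> (0 : R).
Proof.
rewrite (_ : 0 = - ((0 * 0 + 0 * 0 + 0 * 0 * 0 * 1) * 1) * 2^-1); last by ring.
by rewrite /d5; cv.
Qed.

Let d6cv : d6 n @[n --> \oo] --> (0 : R).
Proof. by rewrite (_ : 0 = 0 * 1); [rewrite /d6; cv|ring]. Qed.

Let S_pair (i j : R) x : (i ^+ 2 + j ^+ 2 <= 2 * S x) ->
  forall (u : nat -> R) M n, (forall n, `|u n| <= M) -> `|u n * (i * j)| <= M * S x.
Proof. by move=> h u M n uM; apply: mono => //; exact: yz2. Qed.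

Let quadratic_bounds : exists C, (forall n x, `|B n x| <= C * S x) /\
  (forall n x, `|D n x| <= C * S x).
Proof.
have [M1 H1] := cvg_bounded_seq b1cv; have [M2 H2] := cvg_bounded_seq b2cv.
have [M3 H3] := cvg_bounded_seq b3cv; have [M4 H4] := cvg_bounded_seq b4cv.
have [K0 J0] := cvg_bounded_seq d0cv; have [K1 J1] := cvg_bounded_seq d1cv.
have [K2 J2] := cvg_bounded_seq d2cv; have [K3 J3] := cvg_bounded_seq d3cv.
have [K4 J4] := cvg_bounded_seq d4cv; have [K5 J5] := cvg_bounded_seq d5cv.
have [K6 J6] := cvg_bounded_seq d6cv.
have sq (x : plane * plane) : [/\ 0 <= x.1.1 ^+ 2, 0 <= x.1.2 ^+ 2, 0 <= x.2.1 ^+ 2 & 0 <= x.2.2 ^+ 2].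
  by split; exact: sqr_ge0.
have pos (u : nat -> R) M : (forall n, `|u n| <= M) -> 0 <= M.
  by move=> uM; apply: le_trans (uM 0%N).
exists (M1 + M2 + M3 + M4 + (K0 + K1 + K2 + K3 + K4 + K5 + K6)); split=> n x.
  have [q1 q2 q3 q4] := sq x; have := S1 x => Sx.
  apply: (@le_trans _ _ ((M1 + M2 + M3 + M4) * S x)); last first.
    rewrite ler_wpM2r ?(le_trans ler01)// lerDl.
    by rewrite !addr_ge0 ?(pos _ _ J0) ?(pos _ _ J1) ?(pos _ _ J2) ?(pos _ _ J3)
      ?(pos _ _ J4) ?(pos _ _ J5) ?(pos _ _ J6).
  rewrite /B ![in leRHS]mulrDl; do ?[apply: le_trans (ler_normD _ _) _; apply: lerD];
    by apply: S_pair => //; rewrite /S; lra.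
have [q1 q2 q3 q4] := sq x; have := S1 x => Sx.
apply: (@le_trans _ _ ((K0 + K1 + K2 + K3 + K4 + K5 + K6) * S x)); last first.
  rewrite ler_wpM2r ?(le_trans ler01)// lerDr.
  by rewrite !addr_ge0 ?(pos _ _ H1) ?(pos _ _ H2) ?(pos _ _ H3) ?(pos _ _ H4).
rewrite /D ![in leRHS]mulrDl; do ?[apply: le_trans (ler_normD _ _) _; apply: lerD];
  try by apply: S_pair => //; rewrite /S; lra.
by rewrite mulr1 (le_trans (J0 n))// ler_peMr// (pos _ _ J0).
Qed.

Let mplane : [/\ measurable_fun setT (fun x : plane * plane => x.1.1 : R),
  measurable_fun setT (fun x : plane * plane => x.1.2 : R),
  measurable_fun setT (fun x : plane * plane => x.2.1 : R) &
  measurable_fun setT (fun x : plane * plane => x.2.2 : R)].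
Proof.
split; [exact: measurableT_comp measurable_fst measurable_fst|
  exact: measurableT_comp measurable_snd measurable_fst|
  exact: measurableT_comp measurable_fst measurable_snd|
  exact: measurableT_comp measurable_snd measurable_snd].
Qed.

Lemma integrable_hermite2 (f : plane -> R) : bmfun f ->
  N2.-integrable setT (EFin \o (fun z => f z * (z.1 ^+ 2 - 1))).
Proof.
move=> [mf [M fM]].
have i1 : N.-integrable setT (EFin \o (fun y : R => y ^+ 2 - 1)).
  apply: (@integrable_normal_bound R 5) => [|y].
    by apply: measurable_funB => //; exact: measurable_funX.
  have e1 : 1 <= expR (y ^+ 2 / 4) by rewrite -expR0 ler_expR mulr_ge0 ?sqr_ge0.
  have := sqr_le_expR_sqr y; have := sqr_ge0 y.
  by rewrite ler_norml => h1 h2; apply/andP; split; lra.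
have i0 : N.-integrable setT (EFin \o (fun _ : R => 1 : R)).
  exact: bmfun_integrable (bmfun_cst _ 1).
have i2 := integrableZl measurableT `|M| (integrable_abse (integrable_prod_probability i1 i0)).
apply: (le_integrable measurableT _ _ i2).
  apply/measurable_EFinP; apply: measurable_funM => //.
  by apply: measurable_funB => //; apply: measurable_funX; exact: measurable_fst.
move=> z _ /=; rewrite mulr1 lee_fin normrM [leRHS]normrM !normr_id.
by rewrite ler_wpM2r// (le_trans (fM z))// ler_norm.
Qed.

(** In the limit [d + b^2 / 2] is [A^2 / 2 * (u^2 - 1) (u'^2 - 1)]: the first Hermite
    polynomials have been cancelled by the averaging, and the mixed terms carry
    the limits zero of the other three correlations. *)
Lemma cvg_pair_expansion (f g : plane -> R) : bmfun f -> bmfun g ->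
  \int[N4]_x (f x.1 * g x.2 *
    (((pair_ratio (al n) (be n) (ga n) (de n) x +
       pair_ratio (- al n) (- be n) (- ga n) (- de n) x) / 2 - 1) / k n ^+ 2))
   @[n --> \oo] -->
  A ^+ 2 / 2 * (\int[N2]_z (f z * (z.1 ^+ 2 - 1)) * \int[N2]_z (g z * (z.1 ^+ 2 - 1))).
Proof.
move=> bf bg; have [mx1 mx2 mx3 mx4] := mplane.
have [C [BC DC]] := quadratic_bounds.
have mB n : measurable_fun setT (B n) by rewrite /B; msr.
have mD n : measurable_fun setT (D n) by rewrite /D; msr.
(* The limits of the coefficients, term by term; the terms with coefficient 0 are
   kept so that the convergence is structural. *)
pose Binf (x : plane * plane) : R := A * (x.1.1 * x.2.1) + 0 * (x.1.2 * x.2.1) +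
  0 * (x.1.1 * x.2.2) + 0 * (x.1.2 * x.2.2).
pose Dinf (x : plane * plane) : R := A ^+ 2 / 2 * 1 + - A ^+ 2 / 2 * (x.2.1 * x.2.1)
  + - A ^+ 2 / 2 * (x.1.1 * x.1.1) +
  0 * (x.1.1 * x.1.2) + 0 * (x.1.2 * x.1.2) + 0 * (x.2.2 * x.2.2) +
  0 * (x.2.1 * x.2.2).
have Bcv x : B n x @[n --> \oo] --> Binf x by rewrite /B /Binf; cv.
have Dcv x : D n x @[n --> \oo] --> Dinf x by rewrite /D /Dinf; cv.
have bfg : bmfun (fun x : plane * plane => f x.1 * g x.2).
  have [mf [cf fc]] := bf; have [mg [cg gc]] := bg.
  apply: (@bmfunM _ _ _ (fun x : plane * plane => f x.1) (fun x => g x.2)).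
    by split; [exact: measurableT_comp mf measurable_fst|exists cf].
  by split; [exact: measurableT_comp mg measurable_snd|exists cg].
have := @cvg_exponential_expansion R _ _ N4 S k B D Binf Dinf C S1 iS k0 kcv mB mD BC DC Bcv Dcv _ bfg.
rewrite (_ : \int[N4]_x _ = A ^+ 2 / 2 *
  (\int[N2]_z (f z * (z.1 ^+ 2 - 1)) * \int[N2]_z (g z * (z.1 ^+ 2 - 1)))); last first.
  rewrite -(Rintegral_prod_probabilityM (integrable_hermite2 bf) (integrable_hermite2 bg)).
  rewrite -RintegralZl//; last exact: integrable_prod_probability (integrable_hermite2 bf) (integrable_hermite2 bg).
  by apply: eq_Rintegral => x _; rewrite /Dinf /Binf; field.
apply: cvg_trans; apply: near_eq_cvg; apply: nearW => n.
by apply: eq_Rintegral => x _; rewrite pair_ratio_expand pair_ratio_expandN.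
Qed.

End pair_expansion.

(** * The second Hermite coefficient of a double cone *)

Section hermite_cone.
Context (R : realType).
Local Notation mu := (@lebesgue_measure R).
Local Notation phi := (normal_pdf 0 1 : R -> R).
Local Notation N := (normal_prob 0 1 : probability (measurableTypeR R) R).
Local Notation N2 := (prod_probability N N).
Local Notation plane := (measurableTypeR R * measurableTypeR R)%type.
Variables (p q : R).
Hypotheses (p0 : 0 < p) (q0 : 0 < q).

Definition cone : set plane := [set z | (p * z.1) ^+ 2 < (q * z.2) ^+ 2].

Lemma measurable_cone : measurable cone.
Proof.
have m1 : measurable_fun setT (fun z : plane => (p * z.1) ^+ 2 : R) by msr.
have m2 : measurable_fun setT (fun z : plane => (q * z.2) ^+ 2 : R) by msr.
have -> : cone = setT `&` (fun z => (p * z.1) ^+ 2 < (q * z.2) ^+ 2) @^-1` [set true].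
  by rewrite setTI; apply/seteqP; split => z.
exact: measurable_fun_ltr m1 m2 measurableT _ _.
Qed.

Lemma normal_pdf01E (x : R) : phi x = normal_peak 1 * expR (- (x ^+ 2 / 2)).
Proof.
rewrite normal_pdfE ?oner_neq0// /normal_fun; congr (_ * expR _); by field.
Qed.

Lemma normal_peak1_sqr : (normal_peak 1 : R) ^+ 2 = (2 * pi)^-1.
Proof.
rewrite /normal_peak exprVn sqr_sqrtr; first by congr (_^-1); ring.
by rewrite expr1n mul1r mulrn_wge0// pi_ge0.
Qed.

(** [- u phi u] is a primitive of [(u^2 - 1) phi u]. *)
Lemma normal_hermite2_itv (x : R) : 0 <= x ->
  \int[N]_u (\1_(`]-x, x[%classic) u * (u ^+ 2 - 1)) = - (2 * x * phi x).
Proof.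
move=> x0.
have cphi : continuous phi by apply: continuous_normal_pdf; exact: oner_neq0.
have cg : continuous (fun u : R => (u ^+ 2 - 1) * phi u).
  move=> u; apply: cvgM; last exact: cphi.
  apply: cvgB; last exact: cvg_cst.
  exact: sqr_continuous.
have mI : measurable_fun setT (\1_(`]-x, x[%classic) : R -> R).
  by apply: measurable_indic; exact: measurable_itv.
rewrite Rintegral_normal; last first.
  by apply: measurable_funM => //; apply: measurable_funB => //; exact: measurable_funX.
transitivity (\int[mu]_(u in `]-x, x[) ((u ^+ 2 - 1) * phi u)).
  rewrite [RHS]Rintegral_mkcond; apply: eq_Rintegral => u _.
  by rewrite patchE indicE; case: ifP => _; rewrite ?mul1r ?mul0r.
have mgS (A : set R) : measurable A -> measurable_fun A (fun u : R => ((u ^+ 2 - 1) * phi u)%:E).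
  move=> mA; apply: (@measurable_funS _ _ _ _ setT) => //.
  by apply/measurable_EFinP; exact: continuous_measurable_fun.
rewrite /Rintegral integral_itv_bndo_bndc; last by apply: mgS; exact: measurable_itv.
rewrite integral_itv_obnd_cbnd; last by apply: mgS; exact: measurable_itv.
move: x0; rewrite le_eqVlt => /predU1P[<-|x0].
  by rewrite oppr0 set_itv1 integral_set1 mulr0 mul0r oppr0.
have dG (u : R) : is_derive u 1 (fun u : R => - u * phi u) ((u ^+ 2 - 1) * phi u).
  have dN : is_derive u 1 (fun u : R => - u) (- 1) := is_deriveN (is_derive_id u (1 : R)).
  have := @is_deriveM _ _ _ _ _ _ _ _ dN (is_derive_normal_pdf01 u).
  by move/is_derive_eq; apply; rewrite /GRing.scale/=; ring.
have cG : continuous (fun u : R => - u * phi u).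
  by move=> u; apply: cvgM; [apply: cvgN; exact: cvg_id|exact: cphi].
rewrite (@continuous_FTC2 _ _ (fun u : R => - u * phi u))//.
- by rewrite /= opprK !normal_pdf01E sqrrN; ring.
- by apply: gtrN.
- exact: continuous_subspaceT.
- split.
  + by move=> u _; have [] := dG u.
  + exact/cvg_at_right_filter/cG.
  + exact/cvg_at_left_filter/cG.
- by move=> u _; rewrite derive1E; have [_ ->] := dG u.
Qed.

Lemma integral_abs_gauss (s : R) : 0 < s ->
  (\int[mu]_v (`|v| * expR (- (s * v ^+ 2 / 2)))%:E = (2 / s)%:E)%E.
Proof.
move=> s0.
have ce : continuous (fun v : R => expR (- (s * v ^+ 2 / 2))).
  move=> v; apply: (continuous_comp (f := fun v : R => - (s * v ^+ 2 / 2))).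
    apply: cvgN; apply: cvgM; last exact: cvg_cst.
    by apply: cvgM; [exact: cvg_cst|exact: sqr_continuous].
  exact: continuous_expR.
have cf : continuous (fun v : R => `|v| * expR (- (s * v ^+ 2 / 2))).
  by move=> v; apply: cvgM; [exact: norm_continuous|exact: ce].
rewrite ge0_symfun_integralT//; last first.
  by move=> v /=; rewrite normrN sqrrN.
have -> : [set x : R | 0 <= x] = `[0, +oo[%classic.
  by apply/seteqP; split => v; rewrite /= in_itv/= andbT.
pose F (v : R) := - (expR (- (s * v ^+ 2 / 2)) / s).
have dF (v : R) : is_derive v 1 F (v * expR (- (s * v ^+ 2 / 2))).
  by rewrite /F; apply: is_derive_eq; rewrite /GRing.scale/=; field; rewrite gt_eqF.
rewrite (@ge0_continuous_FTC2y _ _ F 0 0)//.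
- by rewrite /F expr0n/= mulr0 mul0r oppr0 expR0 -EFinB -EFinM; congr EFin; field; rewrite gt_eqF.
- exact: continuous_subspaceT.
- rewrite /F -oppr0; apply: cvgN; rewrite -(mul0r s^-1); apply: cvgM; last exact: cvg_cst.
  apply: (cvg_comp (fun v : R => s * v ^+ 2 / 2) (fun y => expR (- y)) _ (@cvgr_expR R)).
  apply/cvgryPge => M; near=> v.
  have v1 : 1 <= v by near: v; apply: nbhs_pinfty_ge; exact: num_real.
  have vM : 2 * M / s <= v by near: v; apply: nbhs_pinfty_ge; exact: num_real.
  rewrite ler_pdivrMr// in vM.
  have h : 0 <= s * v * (v - 1).
    by apply: mulr_ge0; [apply: mulr_ge0; [exact: ltW|lra]|rewrite subr_ge0].
  by rewrite expr2; lra.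
- apply: cvg_at_right_filter; apply: differentiable_continuous.
  by apply/derivable1_diffP; have [] := dF 0.
- move=> v; rewrite in_itv/= andbT => v0; rewrite derive1E; have [_ ->] := dF v.
  by rewrite gtr0_norm.
Unshelve. all: by end_near. Qed.

(** For fixed [v] the section of the cone is the interval [|u| < (q / p) |v|], whose
    contribution is explicit; the remaining integral in [v] is that of [|v|]
    against a Gaussian. *)
Lemma hermite2_cone :
  \int[N2]_z (\1_cone z * (z.1 ^+ 2 - 1)) = - (2 / pi * (p * q / (p ^+ 2 + q ^+ 2))).
Proof.
have bc : bmfun (\1_cone : plane -> R) by apply: bmfun_indic; exact: measurable_cone.
have [rr rrE] : {rr : R | rr = q / p} by exists (q / p).
have coneE (u v : R) : ((p * u) ^+ 2 < (q * v) ^+ 2) = (`|u| < rr * `|v|).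
  rewrite -(real_normK (num_real (p * u))) -(real_normK (num_real (q * v))).
  rewrite ltr_pXn2r ?nnegrE// !normrM (gtr0_norm p0) (gtr0_norm q0).
  by rewrite rrE mulrAC ltr_pdivlMr// mulrC.
have rr0 : 0 < rr by rewrite rrE divr_gt0.
transitivity (\int[N]_v \int[N]_u (\1_(`]-(rr * `|v|), rr * `|v|[%classic) u * (u ^+ 2 - 1))).
  rewrite /Rintegral -(integral21_prod_meas1 (integrable_hermite2 bc)); congr fine.
  apply: eq_integral => v _; rewrite /fubini_G fineK; last first.
    apply: (integrable_fin_num measurableT).
    apply: (@integrable_normal_bound R 5) => [|u].
      apply: measurable_funM; last by apply: measurable_funB => //; exact: measurable_funX.
      by apply: measurable_indic; exact: measurable_itv.
    have e1 : 1 <= expR (u ^+ 2 / 4) by rewrite -expR0 ler_expR mulr_ge0 ?sqr_ge0.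
    have := sqr_le_expR_sqr u; have := sqr_ge0 u => h1 h2.
    rewrite indicE; case: (_ \in _); rewrite ?mul1r ?mul0r ?normr0; last by lra.
    by rewrite ler_norml; apply/andP; split; lra.
  apply: eq_integral => u _; congr EFin; congr (_ * _).
  rewrite !indicE; suff -> : ((u, v) \in cone) = (u \in `]-(rr * `|v|), rr * `|v|[%classic) by [].
  by apply/idP/idP => /set_mem h; apply/mem_set; move: h; rewrite /cone/= in_itv/= -ltr_norml coneE.
transitivity (\int[N]_v (- (2 * (rr * `|v|) * phi (rr * `|v|)))).
  by apply: eq_Rintegral => v _; rewrite normal_hermite2_itv//; apply: mulr_ge0; first exact: ltW.
rewrite Rintegral_normal; last first.
  apply: measurableT_comp => //; apply: measurable_funM.
    by apply: measurable_funM => //; apply: measurable_funM => //; exact: measurableT_comp.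
  apply: measurableT_comp; first exact: measurable_normal_pdf.
  by apply: measurable_funM => //; exact: measurableT_comp.
transitivity (\int[mu]_v (- (2 * rr * normal_peak 1 ^+ 2) * (`|v| * expR (- ((1 + rr ^+ 2) * v ^+ 2 / 2))))).
  apply: eq_Rintegral => v _; rewrite !normal_pdf01E.
  rewrite (_ : (1 + rr ^+ 2) * v ^+ 2 / 2 = (rr * `|v|) ^+ 2 / 2 + v ^+ 2 / 2); last first.
    by rewrite exprMn (real_normK (num_real v)); ring.
  by rewrite opprD expRD; ring.
have s0 : 0 < 1 + rr ^+ 2 by rewrite ltr_pwDl// sqr_ge0.
have I := integral_abs_gauss s0.
rewrite RintegralZl//; last first.
  apply/integrableP; split.
    apply/measurable_EFinP; apply: (measurable_funM (f := fun v : R => `|v|)); first exact: measurableT_comp.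
    apply: measurableT_comp => //; apply: measurableT_comp => //.
    by apply: measurable_funM => //; apply: measurable_funM => //; exact: measurable_funX.
  under eq_integral do rewrite gee0_abs ?lee_fin ?mulr_ge0 ?expR_ge0//.
  by rewrite I ltry.
rewrite /Rintegral I/=.
rewrite normal_peak1_sqr rrE; have := pi_gt0 R; move: (pi) => w w0; field.
by rewrite !gt_eqF// addr_gt0// exprn_gt0.
Qed.

End hermite_cone.

(** * Gaussian families and fractional Gaussian noise *)

Section gaussian_law_moments.
Context (R : realType) d (T : measurableType d) (P : probability T R).
Variables (Z : T -> measurableTypeR R) (m s : R).
Hypothesis mZ : measurable_fun setT Z.
Hypothesis lawZ : forall A : set R, measurable A -> P (Z @^-1` A) = gaussian_law m s A.

Let N : probability (measurableTypeR R) R := normal_prob 0 1.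
Let aff (x : measurableTypeR R) : measurableTypeR R := m + `|s| * x.

Let maff : measurable_fun setT aff.
Proof. by apply: measurable_funD => //; exact: measurable_funM. Qed.

(** In the degenerate case too, the law is that of [m + |s| G] with [G] standard
    normal; all moments become integrals against one measure. *)
Lemma gaussian_law_affine (A : set R) : measurable A ->
  P (Z @^-1` A) = N (aff @^-1` A).
Proof.
move=> mA; rewrite lawZ// /gaussian_law.
have mI : measurable (aff @^-1` A) by rewrite -[X in measurable X]setTI; exact: maff.
case: eqVneq => [s0|s0].
  have [mA'|mA'] := pselect (A m).
    rewrite diracE mem_set//.
    rewrite (_ : _ @^-1` _ = setT) ?probability_setT//.
    by apply/seteqP; split => x //= _; rewrite /aff s0 normr0 mul0r addr0.
  rewrite diracE memNset//.
  rewrite (_ : _ @^-1` _ = set0) ?measure0//.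
  by apply/seteqP; split => x //=; rewrite /aff s0 normr0 mul0r addr0.
have s1 : 0 < `|s| by rewrite normr_gt0.
have -> : normal_prob m s A = normal_prob m `|s| A.
  by case: (ger0P s) => _; [reflexivity|exact/esym/normal_probN].
transitivity (\int[normal_prob m `|s| : probability (measurableTypeR R) R]_x (\1_A x)%:E)%E.
  by rewrite integral_indic// setIT.
rewrite -(ge0_integral_normal_affine m s1); first last.
- by move=> x; rewrite lee_fin.
- by apply/measurable_EFinP; exact: measurable_indic.
transitivity (\int[N]_x (\1_(aff @^-1` A) x)%:E)%E; first by [].
by rewrite integral_indic// setIT.
Qed.

Lemma gaussian_law_expect (f : measurableTypeR R -> R) : measurable_fun setT f ->
  N.-integrable setT (EFin \o (fun x => f (aff x))) ->
  P.-integrable setT (EFin \o (fun w => f (Z w))) /\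
  \int[P]_w f (Z w) = \int[N]_x f (aff x).
Proof.
move=> mf iN.
have mEf : measurable_fun setT (EFin \o f) by exact/measurable_EFinP.
have eqm A : measurable A -> pushforward P Z A = pushforward N aff A.
  exact: gaussian_law_affine.
have iP : P.-integrable setT (EFin \o (fun w => f (Z w))).
  apply/integrableP; split; first by apply/measurable_EFinP; exact: measurableT_comp.
  have [_] := integrableP _ _ _ iN; apply: le_lt_trans.
  have mabs : measurable_fun setT (fun x : R => `|(f x)%:E|)%E.
    exact: measurableT_comp.
  have -> : (\int[P]_x `|(EFin \o (fun w => f (Z w))) x| =
             \int[pushforward P Z]_x `|(f x)%:E|)%E.
    by rewrite ge0_integral_pushforward.
  have -> : (\int[N]_x `|(EFin \o (fun w => f (aff w))) x| =
             \int[pushforward N aff]_x `|(f x)%:E|)%E.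
    by rewrite ge0_integral_pushforward.
  by rewrite le_eqVlt; apply/orP; left; apply/eqP; apply: eq_measure_integral => A mA _; exact: eqm.
split => //; rewrite /Rintegral; congr fine.
transitivity (\int[image_measure P mZ]_x (EFin \o f) x)%E.
  exact/esym/(integral_pushforward mZ mEf iP measurableT).
transitivity (\int[image_measure N maff]_x (EFin \o f) x)%E; last first.
  exact: (integral_pushforward maff mEf iN measurableT).
by apply: eq_measure_integral => A mA _; exact: eqm.
Qed.

Lemma gaussian_law_mean :
  P.-integrable setT (EFin \o Z) /\ \int[P]_w Z w = m.
Proof.
have i1 : N.-integrable setT (EFin \o (fun x : R => x)).
  apply: (@integrable_normal_bound R 1) => // x; rewrite mul1r; exact: norm_le_expR_sqr.
have i0 : N.-integrable setT (EFin \o (fun _ : R => m)).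
  exact: bmfun_integrable (bmfun_cst _ m).
have i2 : N.-integrable setT (EFin \o (fun x => aff x)).
  exact: integrableD i0 (integrableZl measurableT `|s| i1).
have [h1 h2] := gaussian_law_expect (@measurable_id _ _ setT) i2; split => //.
rewrite [LHS]h2 RintegralD//; last exact: (integrableZl measurableT `|s| i1).
by rewrite RintegralZl// normal_mean expect_cst mulr0 addr0.
Qed.

Lemma gaussian_law_second_moment : m = 0 ->
  P.-integrable setT (EFin \o (fun w => Z w ^+ 2)) /\ \int[P]_w (Z w ^+ 2) = s ^+ 2.
Proof.
move=> m0.
have i1 : N.-integrable setT (EFin \o (fun x : R => x ^+ 2)).
  apply: (@integrable_normal_bound R 4) => [|x]; first exact: measurable_funX.
  by rewrite ger0_norm ?sqr_ge0//; exact: sqr_le_expR_sqr.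
have affE : (fun x => aff x ^+ 2) = (fun x => s ^+ 2 * x ^+ 2).
  by apply/funext => x; rewrite /aff m0 add0r exprMn real_normK ?num_real.
have i2 : N.-integrable setT (EFin \o (fun x => aff x ^+ 2)).
  by rewrite affE; exact: (integrableZl measurableT (s ^+ 2) i1).
have msq : measurable_fun setT (fun x : R => x ^+ 2) by exact: measurable_funX.
have [h1 h2] := gaussian_law_expect msq i2; split => //.
by rewrite [LHS]h2 affE RintegralZl// normal_second_moment mulr1.
Qed.

Lemma gaussian_law_cos : m = 0 -> \int[P]_w cos (Z w) = expR (- (s ^+ 2 / 2)).
Proof.
move=> m0.
have bc : bmfun (fun x => cos (aff x)) by exact: bmfun_cos.
have mc : measurable_fun setT (@cos R) by apply: continuous_measurable_fun; exact: continuous_cos.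
have [_ ->] := gaussian_law_expect mc (bmfun_integrable _ bc).
rewrite -(real_normK (num_real s)) -normal_char_cos.
by congr fine; apply: eq_integral => x _; rewrite /aff m0 add0r.
Qed.

Lemma gaussian_law_sin : m = 0 -> \int[P]_w sin (Z w) = 0.
Proof.
move=> m0.
have bc : bmfun (fun x => sin (aff x)) by exact: bmfun_sin.
have mc : measurable_fun setT (@sin R) by apply: continuous_measurable_fun; exact: continuous_sin.
have [_ ->] := gaussian_law_expect mc (bmfun_integrable _ bc).
rewrite -[RHS](normal_char_sin `|s|).
by congr fine; apply: eq_integral => x _; rewrite /aff m0 add0r.
Qed.

End gaussian_law_moments.

Section gaussian_family.
Context (R : realType) d (T : measurableType d) (P : probability T R).

Lemma Rintegral_sum (I : finType) (f : I -> T -> R) :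
  (forall i, P.-integrable setT (EFin \o f i)) ->
  \int[P]_w (\sum_i f i w) = \sum_i \int[P]_w f i w.
Proof.
move=> fi.
have E : (\int[P]_w (\sum_i f i w)%:E = \sum_i \int[P]_w (f i w)%:E)%E.
  by under eq_integral do rewrite -sumEFin; exact: integral_sum.
rewrite /Rintegral E; transitivity (fine (\sum_i ((\int[P]_w f i w)%R)%:E)%E).
  congr fine; apply: eq_bigr => i _; rewrite fineK//.
  exact: (integrable_fin_num measurableT (fi i)).
by rewrite sumEFin.
Qed.

(** The condition on the means presupposes no integrability: that, and square
    integrability, follow from normality. *)
Definition centered_gaussian_family (I : Type) (Z : I -> T -> R) : Prop :=
  [/\ forall i, measurable_fun setT (Z i),
      forall i, \int[P]_w Z i w = 0 &
      forall n (t : 'I_n -> I) (a : 'I_n -> R), exists m s : R,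
      forall A : set R, measurable A ->
      P ((fun w => \sum_(i < n) a i * Z (t i) w) @^-1` A) = gaussian_law m s A].

Context (I : Type) (Z : I -> T -> R).
Hypothesis GZ : centered_gaussian_family Z.

Let mZ i : measurable_fun setT (Z i). Proof. by case: GZ. Qed.

Let law1 i : exists m s : R, forall A : set R, measurable A ->
  P (Z i @^-1` A) = gaussian_law m s A.
Proof.
have [_ _ /(_ 1%N (fun=> i) (fun=> 1)) [m [s h]]] := GZ.
exists m, s => A mA; rewrite -h//; congr (P (_ @^-1` A)).
by apply/funext => w; rewrite big_ord1 mul1r.
Qed.

Lemma family_integrable i : P.-integrable setT (EFin \o Z i).
Proof. by have [m [s h]] := law1 i; have [] := gaussian_law_mean (mZ i) h. Qed.

Lemma family_sqr_integrable i : P.-integrable setT (EFin \o (fun w => Z i w ^+ 2)).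
Proof.
have [m [s h]] := law1 i; have [_ mE] := gaussian_law_mean (mZ i) h.
have m0 : m = 0 by rewrite -mE; case: GZ.
by have [] := gaussian_law_second_moment (mZ i) h m0.
Qed.

Lemma family_prod_integrable i j : P.-integrable setT (EFin \o (fun w => Z i w * Z j w)).
Proof.
have h := integrableD measurableT (family_sqr_integrable i) (family_sqr_integrable j).
apply: (le_integrable measurableT _ _ h).
  by apply/measurable_EFinP; exact: measurable_funM.
move=> w _ /=; rewrite lee_fin ler_norml.
have := sqr_ge0 (Z i w + Z j w); have := sqr_ge0 (Z i w - Z j w).
have := sqr_ge0 (Z i w); have := sqr_ge0 (Z j w) => h1 h2.
rewrite ger0_norm ?addr_ge0// => h3 h4.
have e1 : (Z i w - Z j w) ^+ 2 = Z i w ^+ 2 + Z j w ^+ 2 - 2 * (Z i w * Z j w) by ring.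
have e2 : (Z i w + Z j w) ^+ 2 = Z i w ^+ 2 + Z j w ^+ 2 + 2 * (Z i w * Z j w) by ring.
by rewrite e1 in h3; rewrite e2 in h4; apply/andP; split; lra.
Qed.

Section combination.
Variables (n : nat) (t : 'I_n -> I) (a : 'I_n -> R).
Let S w := \sum_(i < n) a i * Z (t i) w.

Let mS : measurable_fun setT S.
Proof. by apply: measurable_sum => i; exact: measurable_funM. Qed.

Definition combination_variance :=
  \sum_(i < n) \sum_(j < n) a i * a j * \int[P]_w (Z (t i) w * Z (t j) w).

(** The mean of the law is zero because the mean of each coordinate is; its second
    moment identifies [s ^+ 2]. The sign of [s] is left open, since a law does
    not determine it. *)
Lemma combination_law : exists2 s : R, s ^+ 2 = combination_variance &
  forall A : set R, measurable A -> P (S @^-1` A) = gaussian_law 0 s A.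
Proof.
have [_ Z0 /(_ n t a) [m [s h]]] := GZ.
have [_ mE] := gaussian_law_mean mS h.
have m0 : m = 0.
  rewrite -mE Rintegral_sum => [|i]; last first.
    exact: (integrableZl measurableT (a i) (family_integrable (t i))).
  rewrite big1// => i _.
  by rewrite RintegralZl//; [rewrite Z0 mulr0|exact: family_integrable].
exists s; last by rewrite -m0.
have [_ <-] := gaussian_law_second_moment mS h m0.
transitivity (\int[P]_w (\sum_(i < n) \sum_(j < n) a i * a j * (Z (t i) w * Z (t j) w))).
  apply: eq_Rintegral => w _; rewrite expr2 /S big_distrl/=; apply: eq_bigr => i _.
  by rewrite big_distrr/=; apply: eq_bigr => j _; ring.
have ij i j := integrableZl measurableT (a i * a j) (family_prod_integrable (t i) (t j)).
rewrite Rintegral_sum => [|i]; last first.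
  rewrite (_ : _ \o _ = (fun w => \sum_(j < n) (a i * a j)%:E * (Z (t i) w * Z (t j) w)%:E)%E).
    by apply: integrable_sum => // j _; exact: ij.
  by apply/funext => w /=; rewrite -sumEFin.
apply: eq_bigr => i _; rewrite Rintegral_sum => [|j]; last exact: ij.
by apply: eq_bigr => j _; rewrite RintegralZl//; exact: family_prod_integrable.
Qed.

Lemma combination_cos : \int[P]_w cos (S w) = expR (- (combination_variance / 2)).
Proof. by have [s <- h] := combination_law; exact: (gaussian_law_cos mS h). Qed.

Lemma combination_sin : \int[P]_w sin (S w) = 0.
Proof. by have [s _ h] := combination_law; exact: (gaussian_law_sin mS h). Qed.

End combination.
End gaussian_family.

Section fractional_increments.
Context (R : realType) (H : R) d (T : measurableType d) (P : probability T R).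
Context (B : {nonneg R} -> {RV P >-> R}).
Hypotheses (H_gt0 : 0 < H) (fBm_B : is_fBm H B).

Lemma fbm_family : centered_gaussian_family P (fun t => B t : T -> R).
Proof.
have [G E0 _] := fBm_B; split => //.
  by move=> t; have := E0 t; rewrite expectation.unlock /Rintegral => ->.
Qed.

Lemma fbm_prod s t : \int[P]_w (B t w * B s w) =
  2^-1 * (t%:num `^ (2 * H) + s%:num `^ (2 * H) - `|t%:num - s%:num| `^ (2 * H)).
Proof.
have [_ E0 /(_ s t)] := fBm_B; rewrite covariance.unlock !E0 expectation.unlock.
rewrite /Rintegral => h; rewrite -[RHS]/(fine (_)%:E) -h; congr fine.
apply: eq_integral => w _; rewrite -[RHS]/(((B t w - 0) * (B s w - 0))%:E).
by rewrite !subr0.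
Qed.

Let D (i : nat) : T -> R := Y B i.+1.
Let b (k : nat) : {nonneg R} := (k%:R)%:nng.

(** A combination of [n] increments is a combination of [2 n] values of the
    process. *)
Lemma increments_family : centered_gaussian_family P D.
Proof.
have [mB EB0 GB] := fbm_family.
have iB := family_integrable fbm_family.
split.
- by move=> i; apply: measurable_funB; exact: mB.
- move=> i; rewrite /D /Y /X/= RintegralB//; try exact: iB.
  by rewrite !EB0 subrr.
- move=> n t a.
  pose t2 (i : 'I_(n + n)) : {nonneg R} :=
    match fintype.split i with inl j => b (t j).+1 | inr j => b (t j) end.
  pose a2 (i : 'I_(n + n)) : R := match fintype.split i with inl j => a j | inr j => - a j end.
  have [m [s h]] := GB (n + n)%N t2 a2; exists m, s => A mA; rewrite -h//.
  congr (P (_ @^-1` A)); apply/funext => w.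
  rewrite big_split_ord/= -big_split/=; apply: eq_bigr => i _.
  rewrite /a2 /t2 (unsplitK (inl i)) (unsplitK (inr i)) /D /Y /X/=.
  by rewrite mulNr -mulrBr.
Qed.

(** The autocovariance of fractional Gaussian noise, as a function of the lag. *)
Definition fgn_cov (x : R) : R :=
  2^-1 * (`|x + 1| `^ (2 * H) + `|x - 1| `^ (2 * H) - 2 * `|x| `^ (2 * H)).

Lemma increments_prod i j : \int[P]_w (D i w * D j w) = fgn_cov (j%:R - i%:R).
Proof.
have iB := family_prod_integrable fbm_family.
transitivity (\int[P]_w (B (b i.+1) w * B (b j.+1) w - B (b i.+1) w * B (b j) w
  - (B (b i) w * B (b j.+1) w - B (b i) w * B (b j) w))).
  by apply: eq_Rintegral => w _; rewrite /D /Y /X/= /b; ring.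
rewrite !RintegralB//; try exact: iB; try exact: (integrableB measurableT (iB _ _) (iB _ _)).
rewrite !fbm_prod /= /fgn_cov.
have -> : i.+1%:R - j.+1%:R = - (j%:R - i%:R) :> R by rewrite -!natr1; ring.
have -> : i.+1%:R - j%:R = - (j%:R - i%:R - 1) :> R by rewrite -natr1; ring.
have -> : i%:R - j.+1%:R = - (j%:R - i%:R + 1) :> R by rewrite -natr1; ring.
have -> : i%:R - j%:R = - (j%:R - i%:R) :> R by ring.
by rewrite !normrN; lra.
Qed.

Lemma rhoE k : rho B k = fgn_cov k%:R.
Proof.
rewrite /rho covariance.unlock.
have [_ E0 _] := increments_family.
have E i : ('E_P[Y B i.+1] = (\int[P]_w D i w)%:E)%E.
  by rewrite expectation.unlock /Rintegral fineK//;
    exact: (integrable_fin_num measurableT (family_integrable increments_family i)).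
rewrite !E !E0 expectation.unlock -[k%:R]subr0 -(increments_prod 0%N k) /Rintegral.
congr fine; apply: eq_integral => w _.
by rewrite -[LHS]/(((Y B 1 w - 0) * (Y B k.+1 w - 0))%:E) !subr0.
Qed.

End fractional_increments.

(** * Decay of the autocovariance of the noise *)

Section fgn_asymptotics.
Context (R : realType).
Implicit Types (p c x : R).

Lemma is_derive_powR_affine p c x : 0 < 1 + c * x ->
  is_derive x (1 : R) (fun y : R => (1 + c * y) `^ p) (c * (p * (1 + c * x) `^ (p - 1))).
Proof.
move=> h.
have d1 : is_derive x (1 : R) (fun y : R => 1 + c * y) c.
  by apply: is_derive_eq; rewrite /GRing.scale/=; ring.
have d2 := is_derive1_powR p h.
have d3 := @is_derive1_comp R (fun y => y `^ p) (fun y : R => 1 + c * y) x _ _ d2 d1.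
by apply: (is_derive_eq (df := _) d3); rewrite mulrC.
Qed.

Lemma is_derive_cvg_right (f : R -> R) (l : R) : is_derive (0 : R) (1 : R) f l ->
  f x @[x --> 0^'+] --> f 0.
Proof.
move=> [df _]; apply: cvg_at_right_filter; apply: differentiable_continuous.
exact/derivable1_diffP.
Qed.

(** Second-order expansion of [(1 + c x)^p] at [0+]: after one use of
    l'Hopital's rule the quotient is a difference quotient of the derivative. *)
Lemma cvg_powR_taylor2 p c : `|c| <= 2 ->
  ((1 + c * x) `^ p - 1 - p * c * x) / x ^+ 2 @[x --> (0 : R)^'+] -->
  (p * (p - 1) / 2 * c ^+ 2 : R).
Proof.
rewrite ler_norml => /andP[c1 c2].
have pos x : x \in `]0, 4^-1[ -> 0 < 1 + c * x.
  by rewrite in_itv/= => /andP[x0 x1]; nra.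
have h : 0 < 1 + c * 0 :> R by rewrite mulr0 addr0.
have e1 : 1 + c * 0 = 1 :> R by rewrite mulr0 addr0.
have q0 : 0 < 4^-1 :> R by rewrite invr_gt0.
apply: (@lhopital_at_right R (fun x => (1 + c * x) `^ p - 1 - p * c * x) (fun x => c * (p * (1 + c * x) `^ (p - 1)) - p * c)
   (fun x => x ^+ 2)
   (fun x => 2 * x) 0 4^-1 _ q0).
- move=> x /pos hx; have d1 := is_derive_powR_affine p hx.
  by apply: is_derive_eq; rewrite /GRing.scale/=; ring.
- by move=> x _; apply: is_derive_eq; rewrite /GRing.scale/=; ring.
- have d1 := is_derive_powR_affine p h.
  have d2 : is_derive (0 : R) (1 : R) (fun x => (1 + c * x) `^ p - 1 - p * c * x)
    (c * (p * (1 + c * 0) `^ (p - 1)) - p * c).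
    by apply: is_derive_eq; rewrite /GRing.scale/=; ring.
  by have := is_derive_cvg_right d2; rewrite e1 powR1 mulr0 subr0 subrr.
- have d2 : is_derive (0 : R) (1 : R) (fun x => x ^+ 2) 0.
    by apply: is_derive_eq; rewrite /GRing.scale/=; ring.
  by have := is_derive_cvg_right d2; rewrite expr0n.
- by move=> x; rewrite in_itv/= => /andP[x0 _]; rewrite gt_eqF// mulr_gt0.
- have [d2 d3] := is_derive_powR_affine (p - 1) h.
  rewrite /derivable -/(derive _ _ _) d3 in d2.
  have {}d2 := cvg_dnbhs_at_right d2.
  have -> : p * (p - 1) / 2 * c ^+ 2 =
      p * c / 2 * (c * ((p - 1) * (1 + c * 0) `^ (p - 1 - 1))) :> R.
    by rewrite e1 powR1; ring.
  apply: cvg_trans (cvgM (cvg_cst (p * c / 2)) d2).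
  apply: near_eq_cvg; near=> x.
  have x0 : 0 < x by near: x; exact: nbhs_right_gt.
  rewrite /GRing.scale/= addr0 mulr1 e1 powR1; field.
  by rewrite gt_eqF.
Unshelve. all: by end_near. Qed.

Lemma cvg_inv_nat (f : R -> R) (l : R) : f x @[x --> 0^'+] --> l ->
  f (n%:R^-1) @[n --> \oo] --> l.
Proof.
move=> fl.
have h : (forall n : nat, (0 : R) < n.+1%:R^-1) /\ n.+1%:R^-1 @[n --> \oo] --> (0 : R).
  by split; [by []|exact: cvg_harmonic].
have := (cvg_at_rightP f 0 l).1 fl (fun n => n.+1%:R^-1) h.
by rewrite -(cvg_shiftS (fun n : nat => f n%:R^-1)).
Qed.

(** With [x = 1 / k], twice the quotient is
    [((1 + (j + 1) x)^p + (1 + (j - 1) x)^p - 2 (1 + j x)^p) / x^2], [p = 2 H]. The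
    terms of order 0 and 1 cancel, and [(j + 1)^2 + (j - 1)^2 - 2 j^2 = 2] makes
    the limit the same for every [j]. *)
Lemma cvg_fgn_cov (H j : R) : 0 < H -> `|j| <= 1 ->
  fgn_cov H (k%:R + j) / k%:R `^ (2 * H - 2) @[k --> \oo] --> H * (2 * H - 1).
Proof.
move=> H0 j1; pose p := 2 * H.
have [j2 j3] : -1 <= j /\ j <= 1 by move: j1; rewrite ler_norml => /andP[].
have T1 := @cvg_powR_taylor2 p (j + 1) _; have T2 := @cvg_powR_taylor2 p (j - 1) _.
have T3 := @cvg_powR_taylor2 p j _.
have {}T1 := cvg_inv_nat (T1 ltac:(by rewrite ler_norml; apply/andP; split; lra)).
have {}T2 := cvg_inv_nat (T2 ltac:(by rewrite ler_norml; apply/andP; split; lra)).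
have {}T3 := cvg_inv_nat (T3 ltac:(by rewrite ler_norml; apply/andP; split; lra)).
have -> : H * (2 * H - 1) = 2^-1 * (p * (p - 1) / 2 * (j + 1) ^+ 2 +
   p * (p - 1) / 2 * (j - 1) ^+ 2 - 2 * (p * (p - 1) / 2 * j ^+ 2)).
  by rewrite /p; field.
have c2 (c : R) : (fun _ : nat => c) @ \oo --> c by exact: cvg_cst.
apply: cvg_trans (cvgM (c2 2^-1) (cvgB (cvgD T1 T2) (cvgM (c2 2) T3))).
apply: near_eq_cvg; near=> k.
have k0 : (0 : R) < k%:R by rewrite ltr0n; near: k; exact: nbhs_infty_gt.
have k2 : (2 : R) <= k%:R by rewrite ler_nat; near: k; exact: nbhs_infty_ge.
have E (y : R) : -2 <= y -> `|k%:R + y| `^ p = k%:R `^ p * (1 + y * k%:R^-1) `^ p.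
  move=> y2; have -> : k%:R + y = k%:R * (1 + y * k%:R^-1) by field; rewrite gt_eqF.
  have h : 0 <= 1 + y / k%:R.
    by rewrite -lerBlDl sub0r ler_pdivlMr//; lra.
  by rewrite ger0_norm ?mulr_ge0 ?(ltW k0)// powRM// ltW.
rewrite /fgn_cov -/p -!addrA (E (j + 1)) ?(E (j + -1)) ?(E j); try lra.
have -> : k%:R `^ (p - 2) = k%:R `^ p / k%:R ^+ 2.
  by rewrite powRD ?(gt_eqF k0) ?implybT// powRN (@powR_mulrn R k%:R 2 (ltW k0)).
have := powR_gt0 p k0 => kp0.
pose q c := (1 + c / k%:R) `^ p.
rewrite -[LHS]/(2^-1 * ((q (j + 1) - 1 - p * (j + 1) / k%:R) / k%:R^-1 ^+ 2 +
  ((q (j - 1) - 1 - p * (j - 1) / k%:R) / k%:R^-1 ^+ 2 -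
   2 * ((q j - 1 - p * j / k%:R) / k%:R^-1 ^+ 2)))).
rewrite -/(q (j + 1)) -/(q (j - 1)) -/(q j).
move: (q (j + 1)) (q (j - 1)) (q j) => q1 q2 q3; move: (k%:R) k0 kp0 => x x0 xp0; field.
by rewrite !gt_eqF.
Unshelve. all: by end_near. Qed.

End fgn_asymptotics.

(** * Covariance of functions of two correlated pairs *)

Section pair_covariance.
Context (R : realType).
Local Notation plane := (measurableTypeR R * measurableTypeR R)%type.
Let N : probability (measurableTypeR R) R := normal_prob 0 1.
Let N2 : probability plane R := prod_probability N N.
Let N4 : probability (plane * plane)%type R := prod_probability N2 N2.

Lemma cond_sd3N (al be : R) : cond_sd3 (- al) (- be) = cond_sd3 al be.
Proof. by rewrite /cond_sd3 !sqrrN. Qed.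

Lemma cond_sd4N (al be ga de : R) : cond_sd4 (- al) (- be) (- ga) (- de) = cond_sd4 al be ga de.
Proof. by rewrite /cond_sd4 /resid_cov cond_sd3N !sqrrN !mulrNN. Qed.

Lemma pair_ratio0 x : pair_ratio 0 0 0 0 x = 1 :> R.
Proof.
have s3E : cond_sd3 0 0 = 1 :> R by rewrite /cond_sd3 expr0n/= !subr0 sqrtr1.
have eE : resid_cov 0 0 0 0 = 0 :> R by rewrite /resid_cov !mul0r addr0 oppr0 mul0r.
have s4E : cond_sd4 0 0 0 0 = 1 :> R by rewrite /cond_sd4 eE expr0n/= !subr0 sqrtr1.
rewrite /pair_ratio /cond_mean4 /cond_mean3 s3E s4E eE !mul0r !addr0 /normal_ratio !subr0.
by rewrite invr1 expr1n !mulr1 !subrr expR0 !mulr1.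
Qed.

Section independent_copies.
Context d (T : measurableType d) (P : probability T R).
Variables (al be ga de : R) (U V U' V' : T -> R).
Hypotheses (mU : measurable_fun setT U) (mV : measurable_fun setT V)
  (mU' : measurable_fun setT U') (mV' : measurable_fun setT V').
Hypothesis HG : gaussian_pairs al be ga de P U V U' V'.

(** On the product of the space with itself the two pairs, read on different
    factors, are independent. Comparing with this model expresses the product of
    two expectations by the density formula for zero correlations. *)
Lemma gaussian_pairs_indep : gaussian_pairs 0 0 0 0 (prod_probability P P)
  (fun z => U z.1) (fun z => V z.1) (fun z => U' z.2) (fun z => V' z.2).
Proof.
have [Hc Hs] := HG.
have mL a b : measurable_fun setT (fun w => a * U w + b * V w).
  by apply: measurable_funD; exact: measurable_funM.
have mL' c e : measurable_fun setT (fun w => c * U' w + e * V' w).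
  by apply: measurable_funD; exact: measurable_funM.
have c1 a b : \int[P]_w cos (a * U w + b * V w) = expR (- ((a ^+ 2 + b ^+ 2) / 2)).
  transitivity (\int[P]_w cos (a * U w + b * V w + 0 * U' w + 0 * V' w)).
    by apply: eq_Rintegral => w _; rewrite !mul0r !addr0.
  by rewrite Hc; congr expR; ring.
have c2 c e : \int[P]_w cos (c * U' w + e * V' w) = expR (- ((c ^+ 2 + e ^+ 2) / 2)).
  transitivity (\int[P]_w cos (0 * U w + 0 * V w + c * U' w + e * V' w)).
    by apply: eq_Rintegral => w _; rewrite !mul0r !add0r.
  by rewrite Hc; congr expR; ring.
have d1 a b : \int[P]_w sin (a * U w + b * V w) = 0.
  rewrite -(Hs a b 0 0); by apply: eq_Rintegral => w _; rewrite !mul0r !addr0.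
have d2 c e : \int[P]_w sin (c * U' w + e * V' w) = 0.
  rewrite -(Hs 0 0 c e); by apply: eq_Rintegral => w _; rewrite !mul0r !add0r.
have mLz a b : measurable_fun setT (fun z : T * T => a * U z.1 + b * V z.1).
  exact: measurableT_comp (mL a b) measurable_fst.
have mLz' c e : measurable_fun setT (fun z : T * T => c * U' z.2 + e * V' z.2).
  exact: measurableT_comp (mL' c e) measurable_snd.
have mS a b c e : measurable_fun setT (fun z : T * T =>
    a * U z.1 + b * V z.1 + c * U' z.2 + e * V' z.2).
  have := measurable_funD (mLz a b) (mLz' c e).
  by apply: eq_measurable_fun => z _ /=; rewrite addrA.
split=> a b c e.
- have [-> _] := Rintegral_prod_probability P P (bmfun_cos (mS a b c e)).
  have bc := bmfun_cos (mL' c e); have bs := bmfun_sin (mL' c e).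
  transitivity (\int[P]_x (expR (- ((c ^+ 2 + e ^+ 2) / 2)) * cos (a * U x + b * V x))).
    apply: eq_Rintegral => x _ /=.
    transitivity (\int[P]_y (cos (a * U x + b * V x) * cos (c * U' y + e * V' y) -
                            sin (a * U x + b * V x) * sin (c * U' y + e * V' y))).
      by apply: eq_Rintegral => y _; rewrite -addrA cosD.
    rewrite expectB; try exact: bmfunZ.
    by rewrite !expectZ// c2 d2 mulr0 subr0 mulrC.
  rewrite expectZ; last exact: bmfun_cos.
  by rewrite c1 -expRD; congr expR; ring.
- have [-> _] := Rintegral_prod_probability P P (bmfun_sin (mS a b c e)).
  have bc := bmfun_cos (mL' c e); have bs := bmfun_sin (mL' c e).
  transitivity (\int[P]_x (expR (- ((c ^+ 2 + e ^+ 2) / 2)) * sin (a * U x + b * V x))).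
    apply: eq_Rintegral => x _ /=.
    transitivity (\int[P]_y (sin (a * U x + b * V x) * cos (c * U' y + e * V' y) +
                            cos (a * U x + b * V x) * sin (c * U' y + e * V' y))).
      by apply: eq_Rintegral => y _; rewrite -addrA sinD.
    rewrite expectD; try exact: bmfunZ.
    by rewrite !expectZ// c2 d2 mulr0 addr0 mulrC.
  rewrite expectZ; last exact: bmfun_sin.
  by rewrite d1 mulr0.
Qed.

Lemma gaussian_pairs_opp :
  gaussian_pairs (- al) (- be) (- ga) (- de) P (fun w => - U w) (fun w => - V w) U' V'.
Proof.
have [Hc Hs] := HG; split=> a b c e.
  transitivity (\int[P]_w cos (- a * U w + - b * V w + c * U' w + e * V' w)).
    by apply: eq_Rintegral => w _; rewrite !mulrN !mulNr.
  by rewrite Hc; congr expR; ring.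
rewrite -(Hs (- a) (- b) c e).
by apply: eq_Rintegral => w _; rewrite !mulrN !mulNr.
Qed.

Hypotheses (s3_gt0 : 0 < cond_sd3 al be) (s4_gt0 : 0 < cond_sd4 al be ga de).
Variables (f g : plane -> R).
Hypotheses (bf : bmfun f) (bg : bmfun g) (f0 : forall z, 0 <= f z) (g0 : forall z, 0 <= g z)
  (fN : forall z, f (- z.1, - z.2) = f z).

Let mf := bmfun_measurable bf.
Let mg := bmfun_measurable bg.

Let bfU : bmfun (fun w => f (U w, V w)).
Proof.
case: bf => m [c fc]; split; last by exists c.
by apply: measurableT_comp m _; exact: measurable_fun_pair.
Qed.

Let bgU : bmfun (fun w => g (U' w, V' w)).
Proof.
case: bg => m [c fc]; split; last by exists c.
by apply: measurableT_comp m _; exact: measurable_fun_pair.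
Qed.

Let bfg1 : bmfun (fun x : plane * plane => f x.1 * g x.2).
Proof.
apply: bmfunM.
  by case: bf => m [c fc]; split; [exact: measurableT_comp m measurable_fst|exists c].
by case: bg => m [c fc]; split; [exact: measurableT_comp m measurable_snd|exists c].
Qed.

Let ratio_expect a b c e : measurable_fun setT (pair_ratio a b c e : plane * plane -> R) ->
  (forall x, 0 <= pair_ratio a b c e x :> R) ->
  (\int[P]_w (f (U w, V w) * g (U' w, V' w))%:E =
   \int[N4]_x (f x.1 * g x.2 * pair_ratio a b c e x)%:E)%E ->
  N4.-integrable setT (EFin \o (fun x => f x.1 * g x.2 * pair_ratio a b c e x)) /\
  \int[N4]_x (f x.1 * g x.2 * pair_ratio a b c e x) =
  \int[P]_w (f (U w, V w) * g (U' w, V' w)).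
Proof.
move=> mr r0 E; split; last by rewrite /Rintegral E.
apply/integrableP; split.
  by apply/measurable_EFinP; apply: measurable_funM => //; exact: bmfun_measurable bfg1.
rewrite (_ : (\int[N4]_x _ = \int[N4]_x (f x.1 * g x.2 * pair_ratio a b c e x)%:E)%E).
  2: by apply: eq_integral => x _ /=; rewrite ger0_norm//; apply: mulr_ge0 => //; exact: mulr_ge0.
rewrite -E ltey_eq; apply/orP; left.
exact: (integrable_fin_num measurableT (bmfun_integrable P (bmfunM bfU bgU))).
Qed.

(** Since [f] is even, the joint expectation may be averaged over the two signs
    of the cross-covariances, which cancels the first-order term. *)
Lemma pair_covariance (k : R) :
  (\int[P]_w (f (U w, V w) * g (U' w, V' w)) -
   \int[P]_w f (U w, V w) * \int[P]_w g (U' w, V' w)) / k =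
  \int[N4]_x (f x.1 * g x.2 *
    (((pair_ratio al be ga de x + pair_ratio (- al) (- be) (- ga) (- de) x) / 2 - 1) / k)).
Proof.
have s3N0 : 0 < cond_sd3 (- al) (- be) by rewrite cond_sd3N.
have s4N0 : 0 < cond_sd4 (- al) (- be) (- ga) (- de) by rewrite cond_sd4N.
have [i1 e1] := ratio_expect (measurable_pair_ratio _ _ _ _)
  (pair_ratio_ge0 s3_gt0 s4_gt0) (pair_density s3_gt0 s4_gt0 mU mV mU' mV' HG mf mg f0 g0).
have mN (h : T -> R) : measurable_fun setT h -> measurable_fun setT (fun w => - h w).
  by move=> mh; exact: measurableT_comp mh.
have EN : (\int[P]_w (f (U w, V w) * g (U' w, V' w))%:E =
   \int[N4]_x (f x.1 * g x.2 * pair_ratio (- al) (- be) (- ga) (- de) x)%:E)%E.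
  rewrite -(pair_density s3N0 s4N0 (mN _ mU) (mN _ mV) mU' mV' gaussian_pairs_opp mf mg f0 g0).
  by apply: eq_integral => w _; rewrite (fN (U w, V w)).
have [i2 e2] := ratio_expect (measurable_pair_ratio _ _ _ _) (pair_ratio_ge0 s3N0 s4N0) EN.
have e3 : \int[N4]_x (f x.1 * g x.2) = \int[P]_w f (U w, V w) * \int[P]_w g (U' w, V' w).
  have z1 : 0 < cond_sd3 0 0 :> R by rewrite /cond_sd3 expr0n/= !subr0 sqrtr1.
  have z2 : 0 < cond_sd4 0 0 0 0 :> R.
    by rewrite /cond_sd4 /resid_cov !mul0r addr0 oppr0 mul0r expr0n/= !subr0 sqrtr1.
  have m1 (h : T -> R) : measurable_fun setT h -> measurable_fun setT (fun w : T * T => h w.1).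
    by move=> mh; exact: measurableT_comp mh measurable_fst.
  have m2 (h : T -> R) : measurable_fun setT h -> measurable_fun setT (fun w : T * T => h w.2).
    by move=> mh; exact: measurableT_comp mh measurable_snd.
  have E0 := pair_density z1 z2 (m1 _ mU) (m1 _ mV) (m2 _ mU') (m2 _ mV')
    gaussian_pairs_indep mf mg f0 g0.
  transitivity (\int[prod_probability P P]_w (f (U w.1, V w.1) * g (U' w.2, V' w.2))).
    rewrite /Rintegral; congr fine; rewrite E0.
    by apply: eq_integral => x _; rewrite pair_ratio0 mulr1.
  exact: (Rintegral_prod_probabilityM (bmfun_integrable P bfU) (bmfun_integrable P bgU)).
rewrite -e3; have i3 := bmfun_integrable N4 bfg1.
rewrite -[X in (X - _) / _](_ : (\int[N4]_x (f x.1 * g x.2 * pair_ratio al be ga de x) +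
  \int[N4]_x (f x.1 * g x.2 * pair_ratio (- al) (- be) (- ga) (- de) x)) / 2 = _); last first.
  by rewrite e1 e2; field.
pose F1 x := f x.1 * g x.2 * pair_ratio al be ga de x.
pose F2 x := f x.1 * g x.2 * pair_ratio (- al) (- be) (- ga) (- de) x.
pose F3 (x : plane * plane) := f x.1 * g x.2.
have iS : N4.-integrable setT (EFin \o (fun x => F1 x + F2 x)) := integrableD measurableT i1 i2.
have iH : N4.-integrable setT (EFin \o (fun x => 2^-1 * (F1 x + F2 x))) :=
  integrableZl measurableT 2^-1 iS.
have iD : N4.-integrable setT (EFin \o (fun x => 2^-1 * (F1 x + F2 x) - F3 x)) :=
  integrableB measurableT iH i3.
rewrite -(RintegralD measurableT i1 i2) [X in X - _]mulrC -(RintegralZl 2^-1 measurableT iS).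
rewrite -(RintegralB measurableT iH i3) mulrC -(RintegralZl k^-1 measurableT iD).
by apply: eq_Rintegral => x _; rewrite /F1 /F2 /F3; ring.
Qed.

End independent_copies.
End pair_covariance.

(** * Changes between up and down as membership in a double cone *)

Section bounded_covariance.
Context (R : realType) d (T : measurableType d) (P : probability T R).

Lemma bmfun_covariance (f g : T -> R) : bmfun f -> bmfun g ->
  fine (covariance P f g) = \int[P]_w (f w * g w) - \int[P]_w f w * \int[P]_w g w.
Proof.
move=> bf bg; rewrite covariance.unlock expectation.unlock.
set a := fine (\int[P]_w (f w)%:E)%E; set b := fine (\int[P]_w (g w)%:E)%E.
rewrite -[LHS]/(\int[P]_w ((f w - a) * (g w - b))).
transitivity (\int[P]_w (f w * g w - (b * f w + (a * g w - a * b)))).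
  by apply: eq_Rintegral => w _; ring.
have bb := bmfunZ b bf; have ba := bmfunZ a bg.
have bab : bmfun (fun _ : T => a * b) by exact: bmfun_cst.
rewrite expectB ?expectD ?expectB ?expectZ ?expect_cst//; first last.
- by apply: bmfunD => //; exact: bmfunB.
- exact: bmfunM.
- exact: bmfunB.
- exact: bmfun_cst.
by rewrite -[\int[P]_w f w]/a -[\int[P]_w g w]/b; ring.
Qed.

Lemma ae_eq_expect (E : set T) (f g : T -> R) : P.-negligible E ->
  measurable_fun setT f -> measurable_fun setT g ->
  (forall w, ~ E w -> f w = g w) -> \int[P]_w f w = \int[P]_w g w.
Proof.
move=> NE mf mg fg; rewrite /Rintegral; congr fine.
apply: ae_eq_integral => //; try exact/measurable_EFinP.
by apply: negligibleS NE => w /= h; apply: contrapT => nE; apply: h => _; rewrite fg.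
Qed.

End bounded_covariance.

Section gaussian_null_sets.
Context (R : realType) d (T : measurableType d) (P : probability T R).
Context (I : Type) (Z : I -> T -> R).
Hypothesis GZ : centered_gaussian_family P Z.
Variables (n : nat) (t : 'I_n -> I) (a : 'I_n -> R).
Let S w := \sum_(i < n) a i * Z (t i) w.

Let mS (A : set R) : measurable A -> measurable (S @^-1` A).
Proof.
move=> mA; have mf : measurable_fun setT S.
  by have [mZ _ _] := GZ; apply: measurable_sum => i; exact: measurable_funM.
by rewrite -[X in measurable X]setTI; exact: mf.
Qed.

Lemma combination_nonzero : combination_variance P Z t a != 0 ->
  P.-negligible [set w | S w = 0].
Proof.
have [s <- h] := combination_law GZ t a => s0.
have {}s0 : s != 0 by move: s0; rewrite sqrf_eq0.
apply/negligibleP; first exact: mS (measurable_set1 0).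
have := h [set 0] (measurable_set1 0).
rewrite /gaussian_law (negPf s0) => hP; rewrite [LHS]hP.
exact: integral_set1.
Qed.

Lemma combination_zero : combination_variance P Z t a = 0 ->
  P.-negligible [set w | S w != 0].
Proof.
have [s <- h] := combination_law GZ t a => /eqP; rewrite sqrf_eq0 => /eqP s0.
have mC : measurable (~` [set (0 : R)]) by apply: measurableC; exact: measurable_set1.
rewrite (_ : [set w | _] = S @^-1` (~` [set 0])).
  apply/negligibleP; first exact: mS mC.
  rewrite [LHS]h// s0 /gaussian_law eqxx diracE memNset//.
  by move=> /(_ erefl).
by apply/seteqP; split => w /= /eqP.
Qed.

End gaussian_null_sets.

Section fgn_values.
Context (R : realType) (H : R).
Hypothesis H_gt0 : 0 < H.
Local Notation rh := (fgn_cov H).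

Lemma fgn_covN x : rh (- x) = rh x.
Proof.
rewrite /fgn_cov normrN (_ : - x + 1 = - (x - 1)); last by ring.
by rewrite (_ : - x - 1 = - (x + 1)) ?normrN; [ring|ring].
Qed.

Let pow0 : (0 : R) `^ (2 * H) = 0.
Proof. by rewrite powR0// mulf_neq0// gt_eqF. Qed.

Lemma fgn_cov0 : rh 0 = 1.
Proof. by rewrite /fgn_cov add0r sub0r normrN normr1 normr0 powR1 pow0; field. Qed.

Lemma fgn_cov1E : rh 1 = 2 `^ (2 * H) / 2 - 1.
Proof.
rewrite /fgn_cov subrr normr0 pow0 normr1 powR1 (_ : 1 + 1 = 2 :> R)//.
by rewrite ger0_norm//; field.
Qed.

Lemma fgn_cov1_gt : -1 < rh 1.
Proof.
have h : 0 < 2 `^ (2 * H) :> R by exact: powR_gt0.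
by rewrite fgn_cov1E; lra.
Qed.

Lemma fgn_cov1_lt : H < 1 -> rh 1 < 1.
Proof.
move=> H1; suff h : (2 : R) `^ (2 * H) < 4 by rewrite fgn_cov1E; lra.
have -> : 4 = 2 `^ 2%:R :> R by rewrite powR_mulrn//; ring.
rewrite /powR (gt_eqF (ltr0Sn R 1)) ltr_expR ltr_pM2r.
  by lra.
by rewrite ln_gt0// ltr1n.
Qed.

End fgn_values.

Section updown_process.
Context (R : realType) (H : R) d (T : measurableType d) (P : probability T R).
Context (B : {nonneg R} -> {RV P >-> R}).
Hypotheses (H_gt0 : 0 < H) (fBm_B : is_fBm H B).
Local Notation rh := (fgn_cov H).
Local Notation D := (fun i : nat => Y B i.+1).
Local Notation plane := (measurableTypeR R * measurableTypeR R)%type.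

Let GD := increments_family fBm_B.

Let mD i : measurable_fun setT (D i). Proof. by have [+ _ _] := GD. Qed.

Lemma increment_nonzero i : P.-negligible [set w | D i w = 0].
Proof.
rewrite (_ : [set w | _] = [set w | \sum_(k < 1) (fun=> 1) k * D ((fun=> i) k) w = 0]).
  apply: (@combination_nonzero _ _ _ _ _ _ GD).
  rewrite /combination_variance !big_ord1 (increments_prod fBm_B) subrr fgn_cov0// !mulr1.
by apply/seteqP; split => w /=; rewrite big_ord1 mul1r.
Qed.

(** If consecutive increments have correlation one, their difference has variance
    zero. *)
Lemma increments_equal i : rh 1 = 1 -> P.-negligible [set w | D i w != D i.+1 w].
Proof.
move=> r1; pose t (k : 'I_2) := (i + k)%N; pose a (k : 'I_2) : R := (-1) ^+ k.
rewrite (_ : [set w | _] = [set w | \sum_(k < 2) a k * D (t k) w != 0]).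
  apply: (@combination_zero _ _ _ _ _ _ GD).
  rewrite /combination_variance /a !big_ord_recl !big_ord0/= /bump/=.
  rewrite !(increments_prod fBm_B) /t/= addn0 addn1 -natr1 !subrr.
  rewrite (_ : i%:R - (i%:R + 1) = -1); last by ring.
  rewrite (_ : i%:R + 1 - i%:R = 1); last by ring.
  by rewrite fgn_covN r1 fgn_cov0//; ring.
apply/seteqP; split => w /=;
  rewrite !big_ord_recl big_ord0 /a /t/= /bump/= addn0 addn1 expr0 expr1 mul1r addr0 mulN1r;
  by rewrite subr_eq0.
Qed.

Section coordinates.
Variables (p q : R).
Hypotheses (p_gt0 : 0 < p) (q_gt0 : 0 < q).

Definition updown_sum k w := (D k w + D k.+1 w) / p.
Definition updown_diff k w := (D k.+1 w - D k w) / q.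

Lemma measurable_updown_sum k : measurable_fun setT (updown_sum k).
Proof. by apply: measurable_funM => //; exact: measurable_funD. Qed.

Lemma measurable_updown_diff k : measurable_fun setT (updown_diff k).
Proof. by apply: measurable_funM => //; exact: measurable_funB. Qed.

Lemma C_increments k w : C B k w =
  ((D k w <= 0) && (0 < D k.+1 w))%:R + ((0 < D k w) && (D k.+1 w <= 0))%:R.
Proof.
rewrite /C /= !indicE; congr ((nat_of_bool _)%:R + (nat_of_bool _)%:R); apply/idP/idP.
- by move=> /set_mem[h1 h2]; rewrite /Y/= subr_le0 subr_gt0 h1.
- by rewrite /Y/= subr_le0 subr_gt0 => /andP[h1 h2]; apply/mem_set.
- by move=> /set_mem[h1 h2]; rewrite /Y/= subr_le0 subr_gt0 h1.
- by rewrite /Y/= subr_le0 subr_gt0 => /andP[h1 h2]; apply/mem_set.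
Qed.

(** Two nonzero increments [x], [y] have opposite signs exactly when
    [(x + y)^2 < (y - x)^2]. A zero increment counts as a descent, which is why
    zeros are excluded. *)
Lemma C_eq_cone k w : D k w <> 0 -> D k.+1 w <> 0 ->
  C B k w = \1_(cone p q) (updown_sum k w, updown_diff k w).
Proof.
rewrite C_increments indicE; set x := D k w; set y := D k.+1 w => /eqP x0 /eqP y0.
have -> : ((updown_sum k w, updown_diff k w) \in cone p q) = (x * y < 0).
  have e : (p * updown_sum k w) ^+ 2 - (q * updown_diff k w) ^+ 2 = 4 * (x * y).
    rewrite /updown_sum /updown_diff -/x -/y; field.
    by rewrite !gt_eqF.
  apply/idP/idP => [/set_mem|h]; first by rewrite /cone/= => h; lra.
  by apply/mem_set; rewrite /cone/=; lra.
case: (ltgtP x 0) x0 => // xs _; case: (ltgtP y 0) y0 => // ys _ /=.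
- by rewrite nmulr_llt0// (lt_gtF xs) addr0.
- by rewrite pmulr_llt0// xs addr0.
- by rewrite nmulr_llt0// xs add0r.
- by rewrite pmulr_llt0// (lt_gtF xs) addr0.
Qed.

Lemma bmfun_C k : bmfun (C B k).
Proof.
have mX j : measurable_fun setT (X B j) by exact: measurable_funPT.
have mle i j : measurable [set w | X B i w <= X B j w].
  by rewrite -[X in measurable X]setTI; exact: measurable_fun_le.
have mlt i j : measurable [set w | X B i w < X B j w].
  rewrite (_ : [set w | _] = setT `&` (fun w => X B i w < X B j w) @^-1` [set true]).
    exact: measurable_fun_ltr (mX i) (mX j) measurableT _ _.
  by rewrite setTI; apply/seteqP; split => w.
by apply: bmfunD; apply: bmfun_indic; apply: measurableI (mle _ _) (mlt _ _) ||
  apply: measurableI (mlt _ _) (mle _ _).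
Qed.

Hypotheses (p2E : p ^+ 2 = 2 * (1 + rh 1)) (q2E : q ^+ 2 = 2 * (1 - rh 1)).

Definition cor_ss k := (2 * rh k%:R + rh (k%:R + 1) + rh (k%:R - 1)) / p ^+ 2.
Definition cor_ds k := (rh (k%:R - 1) - rh (k%:R + 1)) / (p * q).
Definition cor_sd k := (rh (k%:R + 1) - rh (k%:R - 1)) / (p * q).
Definition cor_dd k := (2 * rh k%:R - rh (k%:R + 1) - rh (k%:R - 1)) / q ^+ 2.

(** Consecutive increments have equal variances, hence their sum and their
    difference are uncorrelated; dividing by [p] and [q] normalises them. *)
Lemma updown_gaussian_pairs k :
  gaussian_pairs (cor_ss k) (cor_ds k) (cor_sd k) (cor_dd k) P
    (updown_sum 0) (updown_diff 0) (updown_sum k) (updown_diff k).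
Proof.
pose t (i : 'I_4) := nth 0%N [:: 0%N; 1%N; k; k.+1] i.
pose co a b c e (i : 'I_4) := nth 0 [:: a / p - b / q; a / p + b / q; c / p - e / q; c / p + e / q] i.
have SE a b c e w : a * updown_sum 0 w + b * updown_diff 0 w + c * updown_sum k w + e * updown_diff k w =
    \sum_(i < 4) co a b c e i * D (t i) w.
  rewrite !big_ord_recl big_ord0 /co /t/= /updown_sum /updown_diff; field.
  by rewrite !gt_eqF.
have VE a b c e : combination_variance P D t (co a b c e) =
    a ^+ 2 + b ^+ 2 + c ^+ 2 + e ^+ 2 + 2 * (cor_ss k * a * c + cor_ds k * b * c +
                    cor_sd k * a * e + cor_dd k * b * e).
  rewrite /combination_variance !big_ord_recl !big_ord0 /co /t/=.
  rewrite !(increments_prod fBm_B) -[k.+1%:R]natr1 !mulr0n !mulr1n.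
  rewrite !(subr0, sub0r, subrr, addrK).
  rewrite (_ : 1 - k%:R = - (k%:R - 1) :> R); last by ring.
  rewrite (_ : 1 - (k%:R + 1) = - k%:R :> R); last by ring.
  rewrite (_ : k%:R - (k%:R + 1) = - 1 :> R); last by ring.
  rewrite (_ : k%:R + 1 - k%:R = 1 :> R); last by ring.
  rewrite !fgn_covN fgn_cov0//.
  have -> : a ^+ 2 + b ^+ 2 + c ^+ 2 + e ^+ 2 = (a ^+ 2 + c ^+ 2) / p ^+ 2 * (2 * (1 + rh 1))
     + (b ^+ 2 + e ^+ 2) / q ^+ 2 * (2 * (1 - rh 1)).
    by rewrite -p2E -q2E; field; rewrite !gt_eqF.
  rewrite /cor_ss /cor_ds /cor_sd /cor_dd.
  move: (rh 1) (rh k%:R) (rh (k%:R + 1)) (rh (k%:R - 1)) => r1 r2 r3 r4.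
  by field; rewrite !gt_eqF.
split=> a b c e.
  transitivity (\int[P]_w cos (\sum_(i < 4) co a b c e i * D (t i) w)).
    by apply: eq_Rintegral => w _; rewrite SE.
  by rewrite (combination_cos GD) VE.
rewrite -(combination_sin GD t (co a b c e)).
by apply: eq_Rintegral => w _; rewrite SE.
Qed.

Lemma gammaE k : let f := \1_(cone p q) : plane -> R in
  gamma B k = \int[P]_w (f (updown_sum 0 w, updown_diff 0 w) * f (updown_sum k w, updown_diff k w)) -
  \int[P]_w f (updown_sum 0 w, updown_diff 0 w) * \int[P]_w f (updown_sum k w, updown_diff k w).
Proof.
move=> f; rewrite /gamma bmfun_covariance; try exact: bmfun_C.
have mf j : measurable_fun setT (fun w => f (updown_sum j w, updown_diff j w)).
  have mp : measurable_fun setT (fun w => (updown_sum j w, updown_diff j w) : plane).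
    exact: measurable_fun_pair (measurable_updown_sum j) (measurable_updown_diff j).
  by apply: measurableT_comp mp; apply: measurable_indic; exact: measurable_cone.
have mC j := bmfun_measurable (bmfun_C j).
pose E := [set w | D 0%N w = 0] `|` [set w | D 1%N w = 0] `|`
  ([set w | D k w = 0] `|` [set w | D k.+1 w = 0]).
have nE : P.-negligible E.
  by apply: negligibleU; apply: negligibleU; exact: increment_nonzero.
have E0 w : ~ E w -> C B 0 w = f (updown_sum 0 w, updown_diff 0 w).
  by move=> h; apply: C_eq_cone => h0; apply: h; left; [left|right].
have Ek w : ~ E w -> C B k w = f (updown_sum k w, updown_diff k w).
  by move=> h; apply: C_eq_cone => h0; apply: h; right; [left|right].
rewrite (ae_eq_expect nE (mC 0%N) (mf 0%N) E0) (ae_eq_expect nE (mC k) (mf k) Ek).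
rewrite (@ae_eq_expect _ _ _ _ E _ (fun w => f (updown_sum 0 w, updown_diff 0 w) *
   f (updown_sum k w, updown_diff k w)))//; try exact: measurable_funM.
by move=> w h; rewrite E0// Ek.
Qed.

End coordinates.
End updown_process.

(** * Asymptotics of the autocovariance of changes *)

Section gamma_asymptotics.
Context (R : realType) (H : R) d (T : measurableType d) (P : probability T R).
Context (B : {nonneg R} -> {RV P >-> R}).
Hypotheses (H_gt0 : 0 < H) (fBm_B : is_fBm H B).
Local Notation rh := (fgn_cov H).
Local Notation plane := (measurableTypeR R * measurableTypeR R)%type.
Let N : probability (measurableTypeR R) R := normal_prob 0 1.
Let N2 : probability plane R := prod_probability N N.
Let N4 : probability (plane * plane)%type R := prod_probability N2 N2.

(** Nondegeneracy of the four-dimensional law once the correlations are small; the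
    bound 1/4 is one of many that suffice. *)
Lemma cond_sd_gt0 (al be ga de : R) : `|al| <= 4^-1 -> `|be| <= 4^-1 ->
  `|ga| <= 4^-1 -> `|de| <= 4^-1 -> 0 < cond_sd3 al be /\ 0 < cond_sd4 al be ga de.
Proof.
have sq (x : R) : `|x| <= 4^-1 -> x ^+ 2 <= 16^-1.
  rewrite -(real_normK (num_real x)) => h.
  have -> : 16^-1 = 4^-1 ^+ 2 :> R by field.
  by rewrite ler_pXn2r ?nnegrE// invr_ge0.
move=> /[dup] a4 /sq a2 /[dup] b4 /sq b2 /[dup] c4 /sq c2 /[dup] d4 /sq d2.
have h3 : 0 < 1 - al ^+ 2 - be ^+ 2 by lra.
have p3 : 0 < cond_sd3 al be by rewrite sqrtr_gt0.
split=> //; rewrite sqrtr_gt0.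
have s3sq : cond_sd3 al be ^+ 2 = 1 - al ^+ 2 - be ^+ 2 by rewrite sqr_sqrtr// ltW.
have e2 : resid_cov al be ga de ^+ 2 = (al * ga + be * de) ^+ 2 / (1 - al ^+ 2 - be ^+ 2).
  by rewrite /resid_cov expr_div_n sqrrN s3sq.
suff : resid_cov al be ga de ^+ 2 <= 2^-1 by lra.
rewrite e2 ler_pdivrMr//.
have := sqr_ge0 (al * de - be * ga) => h.
have : (al * ga + be * de) ^+ 2 <= (al ^+ 2 + be ^+ 2) * (ga ^+ 2 + de ^+ 2) by nra.
have : (al ^+ 2 + be ^+ 2) * (ga ^+ 2 + de ^+ 2) <= 8^-1 * 8^-1.
  by apply: ler_pM; rewrite ?addr_ge0 ?sqr_ge0//; lra.
by move: (al ^+ 2) (be ^+ 2) a2 b2 h3 => x y *; lra.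
Qed.

Lemma cvg_powR_neg (a : R) : a < 0 -> k%:R `^ a @[k --> \oo] --> (0 : R).
Proof.
move=> a0; have h := @powR_cvg0 R (- a).
have := cvg_inv_nat (h ltac:(by rewrite oppr_gt0)).
apply: cvg_trans; apply: near_eq_cvg; near=> k.
by rewrite -powR_inv1// -powRrM mulrNN mul1r.
Unshelve. all: by end_near. Qed.

Section coordinates.
Variables (p q : R).
Hypotheses (p_gt0 : 0 < p) (q_gt0 : 0 < q).
Hypotheses (p2E : p ^+ 2 = 2 * (1 + rh 1)) (q2E : q ^+ 2 = 2 * (1 - rh 1)).
Let ss k := cor_ss H p k.
Let ds k := cor_ds H p q k.
Let sd k := cor_sd H p q k.
Let dd k := cor_dd H q k.
Let f := \1_(cone p q) : plane -> R.

Lemma gamma_integral k (c : R) : 0 < cond_sd3 (ss k) (ds k) ->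
  0 < cond_sd4 (ss k) (ds k) (sd k) (dd k) ->
  gamma B k / c = \int[N4]_x (f x.1 * f x.2 *
    (((pair_ratio (ss k) (ds k) (sd k) (dd k) x +
       pair_ratio (- ss k) (- ds k) (- sd k) (- dd k) x) / 2 - 1) / c)).
Proof.
move=> h3 h4; rewrite (gammaE H_gt0 fBm_B p_gt0 q_gt0)/=.
have bf : bmfun f by apply: bmfun_indic; exact: measurable_cone.
have mS j := measurable_updown_sum fBm_B p j.
have mF j := measurable_updown_diff fBm_B q j.
apply: (pair_covariance (mS 0%N) (mF 0%N) (mS k) (mF k)
  (updown_gaussian_pairs H_gt0 fBm_B p_gt0 q_gt0 p2E q2E k) h3 h4 bf bf) => // z.
rewrite /f !indicE; congr (nat_of_bool _)%:R.
by apply/idP/idP => /set_mem h; apply/mem_set; move: h; rewrite /cone/= !mulrN !sqrrN.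
Qed.

Hypothesis H_lt1 : H < 1.
Let ka k : R := k%:R `^ (2 * H - 2).
Let L := H * (2 * H - 1).

Let kacv : ka k @[k --> \oo] --> (0 : R).
Proof. by apply: cvg_powR_neg; have := H_lt1; lra. Qed.

Let c0cv : rh k%:R / ka k @[k --> \oo] --> L.
Proof.
have := @cvg_fgn_cov R H 0 H_gt0; rewrite normr0 => /(_ ler01).
by under eq_fun do rewrite addr0.
Qed.

Let cpcv : rh (k%:R + 1) / ka k @[k --> \oo] --> L.
Proof. by apply: cvg_fgn_cov; rewrite // normr1. Qed.

Let cmcv : rh (k%:R - 1) / ka k @[k --> \oo] --> L.
Proof. by apply: cvg_fgn_cov; rewrite // normrN1. Qed.

Let cst_cv (c : R) : (fun _ : nat => c) @ \oo --> c. Proof. exact: cvg_cst. Qed.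

Let sscv : ss k / ka k @[k --> \oo] --> 4 * L / p ^+ 2.
Proof.
have -> : 4 * L / p ^+ 2 = (2 * L + L + L) / p ^+ 2 by ring.
apply: cvg_trans (cvgM (cvgD (cvgD (cvgM (@cst_cv 2) c0cv) cpcv) cmcv) (@cst_cv (p ^+ 2)^-1)).
apply: near_eq_cvg; near=> k.
rewrite -[LHS]/((2 * (rh k%:R / ka k) + rh (k%:R + 1) / ka k + rh (k%:R - 1) / ka k) * (p ^+ 2)^-1) /ss /cor_ss.
by ring.
Unshelve. all: by end_near. Qed.

Let dscv : ds k / ka k @[k --> \oo] --> (0 : R).
Proof.
have -> : 0 = (L - L) / (p * q) by ring.
apply: cvg_trans (cvgM (cvgB cmcv cpcv) (@cst_cv (p * q)^-1)).
apply: near_eq_cvg; near=> k.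
rewrite -[LHS]/((rh (k%:R - 1) / ka k - rh (k%:R + 1) / ka k) * (p * q)^-1) /ds /cor_ds.
by ring.
Unshelve. all: by end_near. Qed.

Let sdcv : sd k / ka k @[k --> \oo] --> (0 : R).
Proof.
have -> : 0 = (L - L) / (p * q) by ring.
apply: cvg_trans (cvgM (cvgB cpcv cmcv) (@cst_cv (p * q)^-1)).
apply: near_eq_cvg; near=> k.
rewrite -[LHS]/((rh (k%:R + 1) / ka k - rh (k%:R - 1) / ka k) * (p * q)^-1) /sd /cor_sd.
by ring.
Unshelve. all: by end_near. Qed.

Let ddcv : dd k / ka k @[k --> \oo] --> (0 : R).
Proof.
have -> : 0 = (2 * L - L - L) / q ^+ 2 by ring.
apply: cvg_trans (cvgM (cvgB (cvgB (cvgM (@cst_cv 2) c0cv) cpcv) cmcv) (@cst_cv (q ^+ 2)^-1)).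
apply: near_eq_cvg; near=> k.
rewrite -[LHS]/((2 * (rh k%:R / ka k) - rh (k%:R + 1) / ka k - rh (k%:R - 1) / ka k) * (q ^+ 2)^-1) /dd /cor_dd.
by ring.
Unshelve. all: by end_near. Qed.

Let small (u : nat -> R) (l : R) : u k / ka k @[k --> \oo] --> l -> \forall k \near \oo, `|u k| <= 4^-1.
Proof.
move=> ul; have : u k @[k --> \oo] --> (0 : R).
  rewrite -[X in _ --> X](mulr0 l); apply: cvg_trans (cvgM ul kacv).
  apply: near_eq_cvg; near=> k.
  have : 0 < ka k by apply: powR_gt0; rewrite ltr0n; near: k; exact: nbhs_infty_gt.
  by move=> k0; rewrite /= mulfVK// gt_eqF.
move=> /cvgrPdist_le /(_ 4^-1); rewrite invr_gt0 => /(_ (ltr0Sn _ _)).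
by apply: filterS => k; rewrite sub0r normrN.
Unshelve. all: by end_near. Qed.

(** Correlations are nondegenerate only from some rank [n0] on, whence the shift
    by [n0] before the expansion is applied. *)
Lemma cvg_gamma_coordinates : gamma B k / ka k ^+ 2 @[k --> \oo] -->
  (4 * L / p ^+ 2) ^+ 2 / 2 * (2 / pi * (p * q / (p ^+ 2 + q ^+ 2))) ^+ 2.
Proof.
have : \forall k \near \oo, [/\ (0 < k)%N, 0 < cond_sd3 (ss k) (ds k) & 0 < cond_sd4 (ss k) (ds k) (sd k) (dd k)].
  near=> k; have [||||h3 h4] := @cond_sd_gt0 (ss k) (ds k) (sd k) (dd k).
  - by near: k; exact: small sscv.
  - by near: k; exact: small dscv.
  - by near: k; exact: small sdcv.
  - by near: k; exact: small ddcv.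
  by split => //; near: k; exact: nbhs_infty_gt.
move=> [n0 _ hn].
have {}hn n : [/\ (0 < n + n0)%N, 0 < cond_sd3 (ss (n + n0)) (ds (n + n0)) &
    0 < cond_sd4 (ss (n + n0)) (ds (n + n0)) (sd (n + n0)) (dd (n + n0))].
  by apply: hn => /=; exact: leq_addl.
have sh (u : nat -> R) (l : R) : u k @[k --> \oo] --> l -> u (n + n0)%N @[n --> \oo] --> l.
  by move=> ul; rewrite (cvg_shiftn n0 u (nbhs l)).
have bf : bmfun f by apply: bmfun_indic; exact: measurable_cone.
have ka0 n : 0 < ka (n + n0) by apply: powR_gt0; rewrite ltr0n; have [] := hn n.
have := cvg_pair_expansion ka0 (sh _ _ kacv) (sh _ _ sscv) (sh _ _ dscv) (sh _ _ sdcv)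
  (sh _ _ ddcv) (fun n => let: And3 _ h _ := hn n in h) (fun n => let: And3 _ _ h := hn n in h) bf bf.
rewrite hermite2_cone// mulrNN -expr2 => h.
rewrite -(cvg_shiftn n0); apply: cvg_trans h; apply: near_eq_cvg; near=> n.
by have [_ h3 h4] := hn n; rewrite /= gamma_integral.
Unshelve. all: by end_near. Qed.

End coordinates.

Lemma cvg_gamma : H < 1 -> gamma B k / (k%:R `^ (2 * H - 2)) ^+ 2 @[k --> \oo] -->
  2 * (1 - rh 1) / (pi ^+ 2 * (1 + rh 1)) * H ^+ 2 * (2 * H - 1) ^+ 2.
Proof.
move=> H1; have r1 := fgn_cov1_gt H_gt0; have r2 := fgn_cov1_lt H_gt0 H1.
have [p p0 pE] : exists2 p, 0 < p & p ^+ 2 = 2 * (1 + rh 1).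
  by exists (Num.sqrt (2 * (1 + rh 1))); rewrite ?sqrtr_gt0 ?sqr_sqrtr//; lra.
have [q q0 qE] : exists2 q, 0 < q & q ^+ 2 = 2 * (1 - rh 1).
  by exists (Num.sqrt (2 * (1 - rh 1))); rewrite ?sqrtr_gt0 ?sqr_sqrtr//; lra.
have := cvg_gamma_coordinates p0 q0 pE qE H1.
have pi0 := pi_gt0 R.
have -> : (2 / pi * (p * q / (p ^+ 2 + q ^+ 2))) ^+ 2 =
    (2 / pi) ^+ 2 * (p ^+ 2 * q ^+ 2) / (p ^+ 2 + q ^+ 2) ^+ 2.
  move: (pi) pi0 => w w0; field.
  by rewrite !gt_eqF// addr_gt0// exprn_gt0.
rewrite pE qE; set l1 := (X in _ --> X -> _); set l2 := (X in _ -> _ --> X).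
suff -> : l1 = l2 by [].
rewrite /l1 /l2; move: (pi) pi0 (rh 1) r1 r2 => w w0 r r1 r2; field.
by rewrite !gt_eqF//; lra.
Qed.

Lemma gamma_H1 k : H = 1 -> gamma B k = 0.
Proof.
move=> H1; have r1 : rh 1 = 1.
  by rewrite fgn_cov1E// H1 mulr1 powR_mulrn//; field.
have nE := increments_equal H_gt0 fBm_B 0 r1.
have C0 w : ~ [set w | Y B 1 w != Y B 2 w] w -> C B 0 w = 0.
  move=> /negP; rewrite negbK => /eqP h; rewrite C_increments h.
  by rewrite leNgt; case: (0 < _); rewrite addr0.
have mC j := bmfun_measurable (bmfun_C B j).
rewrite /gamma bmfun_covariance; try exact: bmfun_C.
have m0 : measurable_fun setT (fun _ : T => 0 : R) by exact: measurable_cst.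
rewrite (ae_eq_expect nE (mC 0%N) m0 C0) expect_cst mul0r subr0.
rewrite (ae_eq_expect nE (measurable_funM (mC 0%N) (mC k)) m0) ?expect_cst//.
by move=> w h; rewrite -[LHS]/(C B 0 w * C B k w) C0// mul0r.
Qed.

Lemma gamma_Hhalf k : 2 * H = 1 -> (1 < k)%N -> gamma B k = 0.
Proof.
move=> H2 k1; have rh0 x : 1 <= x -> rh x = 0.
  move=> x1; rewrite /fgn_cov H2 !powRr1//.
  by rewrite !ger0_norm; lra.
have H1 : H < 1 by lra.
have k2 : (2 : R) <= k%:R by rewrite ler_nat.
have r1 := fgn_cov1_gt H_gt0; have r2 := fgn_cov1_lt H_gt0 H1.
have [p p0 pE] : exists2 p, 0 < p & p ^+ 2 = 2 * (1 + rh 1).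
  by exists (Num.sqrt (2 * (1 + rh 1))); rewrite ?sqrtr_gt0 ?sqr_sqrtr//; lra.
have [q q0 qE] : exists2 q, 0 < q & q ^+ 2 = 2 * (1 - rh 1).
  by exists (Num.sqrt (2 * (1 - rh 1))); rewrite ?sqrtr_gt0 ?sqr_sqrtr//; lra.
have [e0 e1 e2] : [/\ rh k%:R = 0, rh (k%:R + 1) = 0 & rh (k%:R - 1) = 0].
  by split; apply: rh0; lra.
have h3 : 0 < cond_sd3 0 0 :> R by rewrite /cond_sd3 expr0n/= !subr0 sqrtr1.
have h4 : 0 < cond_sd4 0 0 0 0 :> R.
  by rewrite /cond_sd4 /resid_cov !mul0r addr0 oppr0 mul0r expr0n/= !subr0 sqrtr1.
have := gamma_integral p0 q0 pE qE (k := k) 1.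
rewrite /cor_ss /cor_ds /cor_sd /cor_dd e0 e1 e2 !(mulr0, addr0, subr0, mul0r, oppr0, divr1).
move=> ->//; rewrite -[RHS](expect_cst N4 0); apply: eq_Rintegral => x _.
by rewrite pair_ratio0; field.
Qed.

End gamma_asymptotics.

Theorem theorem13 (R : realType) (H : R) (H_gt0 : 0 < H) (H_le1 : H <= 1)
    (d : measure_display) (T : measurableType d) (P : probability T R)
    (B : {nonneg R} -> {RV P >-> R}) (fBm_B : is_fBm H B) :
  asymp_equiv (gamma B)
    (fun k : nat => 2 * (1 - rho B 1) / (pi ^+ 2 * (1 + rho B 1))
       * H ^+ 2 * (2 * H - 1) ^+ 2 * k%:R `^ (4 * H - 4)).
Proof.
rewrite /asymp_equiv (rhoE fBm_B).
(* The two degenerate exponents, where the right-hand side is zero and the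
   convention 0 / 0 = 1 decides. *)
have [H1|H1] := eqVneq H 1.
  have r1 : fgn_cov H 1 = 1 by rewrite fgn_cov1E// H1 mulr1 powR_mulrn//; field.
  apply: cvg_near_cst; near=> k.
  by rewrite (gamma_H1 H_gt0 fBm_B k H1) r1 subrr mulr0 !mul0r /quot01 eqxx.
have [H2|H2] := eqVneq (2 * H) 1.
  apply: cvg_near_cst; near=> k.
  rewrite (gamma_Hhalf H_gt0 fBm_B H2) ?H2 ?subrr ?expr0n/= ?mulr0 ?mul0r ?/quot01 ?eqxx//.
  by near: k; exact: nbhs_infty_gt.
have {H1 H_le1}H1 : H < 1 by rewrite lt_neqAle H1.
have r1 := fgn_cov1_gt H_gt0; have r2 := fgn_cov1_lt H_gt0 H1.
have pi0 := pi_gt0 R.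
set K := 2 * _ / _ * _ * _.
have K0 : K != 0.
  have b0 : pi ^+ 2 * (1 + fgn_cov H 1) != 0 :> R.
    by apply: mulf_neq0; [rewrite expf_neq0// gt_eqF|rewrite gt_eqF//; lra].
  do !apply: mulf_neq0; rewrite ?invr_neq0 ?expf_neq0 ?subr_eq0 ?(gt_eqF H_gt0)//.
  by rewrite eq_sym lt_eqF.
have Kcv := cvg_gamma H_gt0 fBm_B H1; rewrite -/K in Kcv.
have KV : (fun _ : nat => K^-1) @ \oo --> K^-1 by exact: cvg_cst.
rewrite -[X in _ --> X](mulfV K0); apply: cvg_trans (cvgM Kcv KV); apply: near_eq_cvg; near=> k.
have k0 : (0 : R) < k%:R by rewrite ltr0n; near: k; exact: nbhs_infty_gt.
have kp := powR_gt0 (2 * H - 2) k0.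
have -> : k%:R `^ (4 * H - 4) = (k%:R `^ (2 * H - 2)) ^+ 2.
  by rewrite expr2 -powRD ?(gt_eqF k0) ?implybT//; congr (_ `^ _); ring.
set c := k%:R `^ _ in kp *.
have c0 : c != 0 by rewrite gt_eqF.
rewrite /quot01 (negPf (mulf_neq0 K0 (expf_neq0 2 c0))) andbF.
rewrite -[LHS]/(gamma B k / c ^+ 2 * K^-1).
by rewrite (invfM K) [in RHS](mulrC K^-1) mulrA.
Unshelve. all: by end_near. Qed.
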